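(* Let $1<\alpha\le 2$, $\beta=1-\frac{\alpha}{2}$, and let $(p,q)$, $c_{-1},c_0,c_1$, $d_p,d_q$ be the data of any one of the quasi-compact approximations of the families (F1), (F2), (F3) described in the context (so $(p,q)\in\{(-1,1),(0,1),(-1,0)\}$). (i) If $f\in C^3[a,b]$, $D^4f\in L^1[a,b]$, and $D^kf(a)=0$ for $k=0,1,2,3$, then $$c_{-1}\,{}_aD_x^{\alpha}f(x-h)+c_0\,{}_aD_x^{\alpha}f(x)+c_1\,{}_aD_x^{\alpha}f(x+h)=d_p\delta^{\alpha}_{h,p}f(x)+d_q\delta^{\alpha}_{h,q}f(x)+O(h^2),$$ with $c_{-1}+c_0+c_1=d_p+d_q=1$. (ii) If moreover $f\in C^4[a,b]$, $D^5f\in L^1[a,b]$, and $D^kf(a)=0$ for $k=0,\dots,4$, then $$c_{-1}\,{}_aD_x^{\alpha}f(x-h)+c_0\,{}_aD_x^{\alpha}f(x)+c_1\,{}_aD_x^{\alpha}f(x+h)=d_p\delta^{\alpha}_{h,p}f(x)+d_q\delta^{\alpha}_{h,q}f(x)+e_2\,{}_aD_x^{\alpha+2}f(x)\,h^2+O(h^3),$$ with $c_{-1}+c_0+c_1=d_p+d_q=1$ and $$e_2=c_{-1}a_2(-1,p)+(d_p-c_{-1})a_2(0,p)+(d_q-c_1)a_2(0,q)+c_1a_2(1,q).$$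
   Context: $D=d/dx$. The left Riemann-Liouville derivative of order $\alpha\in(m-1,m)$ is ${}_aD_x^{\alpha}u(x)=D^m\,{}_aD_x^{-(m-\alpha)}u(x)$ with ${}_aD_x^{-\gamma}u(x)=\frac{1}{\Gamma(\gamma)}\int_a^x(x-\xi)^{\gamma-1}u(\xi)\,d\xi$ for $\gamma>0$; for integer order it is the classical derivative. The shifted Grünwald operator is $\delta^{\alpha}_{h,p}f(x)=h^{-\alpha}\sum_{k=0}^{\infty}g_k^{(\alpha)}f(x-(k-p)h)$ with $g_k^{(\alpha)}=(-1)^k\binom{\alpha}{k}$. Functions on $[a,b]$ are extended by zero to the left of $a$. The relations are considered at points $x$ with $x-h,x,x+h\in[a,b]$, and $O(\cdot)$ is as $h\to0^+$. For real $\gamma$ and integer $p$, $a_2(\gamma,p)$ is the coefficient of $z^2$ in the power series at $0$ of $e^{\gamma z}-e^{pz}\left(\frac{1-e^{-z}}{z}\right)^{\alpha}$; explicitly $a_2(\gamma,p)=-\frac{\alpha}{24}-\frac12\left(p-\frac{\alpha}{2}\right)^2+\frac{\gamma^2}{2}$. For integers $m\ne n$ and $p\neq q$ put $$\lambda^{(\beta)}_{m,n}=\frac{\beta-n+1}{m-n},\quad \lambda^{(\beta)}_{n,m}=\frac{\beta-m+1}{n-m},\quad \xi^{(\beta)}_{p,q}=\frac{\beta+q-1}{q-p},\quad \xi^{(\beta)}_{q,p}=\frac{\beta+p-1}{p-q}.$$ Quasi-compact means that only the points $x-h,x,x+h$ occur on the left-hand side and only shifts $-1,0,1$ occur in the Grünwald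 operators. In each family below, $c_k$ ($k=-1,0,1$) is the total coefficient of ${}_aD_x^{\alpha}f(x+kh)$ in the displayed left-hand side, and $d_p,d_q$ are the coefficients of $\delta^\alpha_{h,p}f(x),\delta^\alpha_{h,q}f(x)$ on the right. (F1) For $(m,n)\in\{(0,1),(1,2),(0,2)\}$: left side $\lambda^{(\beta)}_{m,n}\,{}_aD_x^{\alpha}f(x+(m-1)h)+\lambda^{(\beta)}_{n,m}\,{}_aD_x^{\alpha}f(x+(n-1)h)$, right side $\delta^{\alpha}_{h,1}f(x)$ (i.e. $(p,q)=(0,1)$, $d_0=0$, $d_1=1$). (F2) For $(p,q)\in\{(0,1),(-1,1),(-1,0)\}$ and integers $m_1<n_1$, $m_2<n_2$ such that $p+m_1-2,\ p+n_1-2,\ q+m_2-2,\ q+n_2-2\in\{-1,0,1\}$: left side $$\xi^{(\beta)}_{p,q}\left[\lambda^{(\beta)}_{m_1,n_1}\,{}_aD_x^{\alpha}f(x+(p+m_1-2)h)+\lambda^{(\beta)}_{n_1,m_1}\,{}_aD_x^{\alpha}f(x+(p+n_1-2)h)\right]$$ $$+\,\xi^{(\beta)}_{q,p}\left[\lambda^{(\beta)}_{m_2,n_2}\,{}_aD_x^{\alpha}f(x+(q+m_2-2)h)+\lambda^{(\beta)}_{n_2,m_2}\,{}_aD_x^{\alpha}f(x+(q+n_2-2)h)\right],$$ right side $\xi^{(\beta)}_{p,q}\delta^{\alpha}_{h,p}f(x)+\xi^{(\beta)}_{q,p}\delta^{\alpha}_{h,q}f(x)$ (i.e. $d_p=\xi^{(\beta)}_{p,q}$,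 $d_q=\xi^{(\beta)}_{q,p}$). (F3) $c_{-1}=-\frac{\beta(1-\beta)}{2}$, $c_0=1-\beta^2$, $c_1=\frac{\beta(1+\beta)}{2}$, right side $\delta^{\alpha}_{h,1}f(x)$ (i.e. $(p,q)=(0,1)$, $d_0=0$, $d_1=1$).
   Formalization: The O-relations are stated for each fixed x in (a,b) at which D^4 f(x) exists (for (ii), D^5 f(x)); if these derivatives exist only almost everywhere, the claim fails at other points, e.g. α=2, f=|x-x0|^{7/2} near x0, where the error is of order h^{3/2}. The O is not uniform in x. *)

(* Defs.v *)
From HB Require Import structures.
From mathcomp Require Import all_boot all_order all_algebra.
From mathcomp Require Import all_classical all_reals all_analysis.

Set Implicit Arguments.
Unset Strict Implicit.
Unset Printing Implicit Defensive.

Import Order.TTheory GRing.Theory Num.Theory.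
Import numFieldNormedType.Exports.

Local Open Scope classical_set_scope.
Local Open Scope ring_scope.

Section interval_calculus.
Context {R : realType}.
Implicit Types (a b x : R) (f : R -> R).

(* Difference quotients at x are taken along the points of [a, b] only, so D is
   the one-sided derivative at a and at b, the usual derivative inside, and
   values of f outside [a, b] never matter. *)
Definition derivable_ab a b f x :=
  cvg ((f y - f x) / (y - x) @[y --> within `[a, b] x^']).

Definition D a b f : R -> R :=
  fun x => lim ((f y - f x) / (y - x) @[y --> within `[a, b] x^']).

Definition Dn a b (n : nat) f : R -> R := iter n (D a b) f.

Definition Cn a b (n : nat) f :=
  (forall k x, (k < n)%N -> x \in `[a, b] -> derivable_ab a b (Dn a b k f) x) /\
  {within `[a, b], continuous (Dn a b n f)}.

(* D^(n+1) f exists almost everywhere on [a, b] and is Lebesgue integrable.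
   Differentiability everywhere is not required: this covers in particular the
   case where D^n f is absolutely continuous. *)
Definition DS_L1 a b (n : nat) f :=
  {ae lebesgue_measure, forall x : R,
     x \in `[a, b] -> derivable_ab a b (Dn a b n f) x} /\
  lebesgue_measure.-integrable `[a, b] (EFin \o Dn a b n.+1 f).

End interval_calculus.

Section fractional.
Context {R : realType}.
Implicit Types (a b x h alpha gamma : R) (f u : R -> R).

Definition Gamma gamma : R :=
  \int[lebesgue_measure]_(t in `]0, +oo[) (t `^ (gamma - 1) * expR (- t)).

Definition RLint a gamma u : R -> R := fun x =>
  (Gamma gamma)^-1 *
  \int[lebesgue_measure]_(xi in `[a, x]) ((x - xi) `^ (gamma - 1) * u xi).

(* For alpha > 0; at integer order m = alpha, elsewhere m - 1 < alpha < m. *)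
Definition RLder a b alpha u : R -> R :=
  let m := `|Num.ceil alpha|%N in
  if alpha == m%:R then Dn a b m u
  else Dn a b m (RLint a (m%:R - alpha) u).

Definition gbinom alpha (k : nat) : R :=
  (\prod_(i < k) (alpha - i%:R)) / k`!%:R.

Definition grunwald_coef alpha (k : nat) : R := (-1) ^+ k * gbinom alpha k.

Definition ext0 a f : R -> R := fun x => if x < a then 0 else f x.

Definition grunwald a alpha h (p : int) f : R -> R := fun x =>
  h `^ (- alpha) *
  limn (series (fun k : nat =>
    grunwald_coef alpha k * ext0 a f (x - (k%:Z - p)%:~R * h))).

(* The value at 0 fills the removable singularity of (1 - e^-z) / z. *)
Definition backward_symbol (z : R) : R :=
  if z == 0 then 1 else (1 - expR (- z)) / z.

Definition error_symbol alpha gamma (p : int) (z : R) : R :=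
  expR (gamma * z) - expR (p%:~R * z) * backward_symbol z `^ alpha.

(* Coefficient of z^2 in the power series of error_symbol at 0. *)
Definition a2 alpha gamma (p : int) : R :=
  derive1n 2 (error_symbol alpha gamma p) 0 / 2`!%:R.

End fractional.

Section families.
Context {R : realType}.
Variable beta : R.
Implicit Types (m n p q k : int).

(* lam m n and lam n m are the two weights attached to the pair (m, n), and
   likewise for xi. *)
Definition lam m n : R := (beta - n%:~R + 1) / (m - n)%:~R.

Definition xi p q : R := (beta + q%:~R - 1) / (q - p)%:~R.

(* Total coefficient at the node x + k h of the two-point combination
   lam m n * g (x + (s + m) h) + lam n m * g (x + (s + n) h). *)
Definition lam_coef (s m n k : int) : R :=
  lam m n * (k == s + m)%:R + lam n m * (k == s + n)%:R.

Definition compact_node k : bool := k \in [:: -1; 0; 1 : int].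

(* quasi_compact beta p q c dp dq: the approximation
   \sum_k c k * D^alpha f (x + k h) ~ dp * delta_p f x + dq * delta_q f x
   belongs to one of the three families. *)
Inductive quasi_compact : int -> int -> (int -> R) -> R -> R -> Prop :=
| QC_single m n :
    (m, n) \in [:: (0, 1); (1, 2); (0, 2) : int * int] ->
    quasi_compact 0 1 (lam_coef (-1) m n) 0 1
| QC_double p q m1 n1 m2 n2 :
    (p, q) \in [:: (0, 1); (-1, 1); (-1, 0) : int * int] ->
    m1 < n1 -> m2 < n2 ->
    compact_node (p + m1 - 2) -> compact_node (p + n1 - 2) ->
    compact_node (q + m2 - 2) -> compact_node (q + n2 - 2) ->
    quasi_compact p q
      (fun k => xi p q * lam_coef (p - 2) m1 n1 k +
                xi q p * lam_coef (q - 2) m2 n2 k)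
      (xi p q) (xi q p)
| QC_three_point :
    quasi_compact 0 1
      (fun k => if k == -1 then - (beta * (1 - beta) / 2)
                else if k == 0 then 1 - beta ^+ 2
                else if k == 1 then beta * (1 + beta) / 2
                else 0)
      0 1.

End families.

(* Main.v *)
Require Import Defs.
From HB Require Import structures.
From mathcomp Require Import all_boot all_order all_algebra.
From mathcomp Require Import all_classical all_reals all_analysis.
From mathcomp Require Import measurable_realfun.
From mathcomp Require Import ring lra.

(** The highest derivative [g = f^(r + 1)] ([r = 2] for the first estimate, [r = 3]
    for the second) represents every term of the scheme. Because [f] and its
    derivatives up to order [r] vanish at [a], Taylor's formula gives [f] as the
    integral of [(y - s)_+^r / r!] against [g s] ([function_frac_int]), and the
    Riemann-Liouville derivative at [y] is the integral of
    [(y - s)_+^(r - alpha) / Gamma (r + 1 - alpha)] against [g s]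
    ([RLder_frac_int]): integrate by parts, then differentiate under the integral
    sign. A Grünwald difference becomes the integral of [g] against a [spline],
    the sum of the weights times shifted truncated powers. By homogeneity the
    whole error is [h^(r - alpha)] times the integral of [kernel ((x - s) / h)]
    against [g s] ([scheme_kernel]), so the question is how fast one fixed
    function decays.

    The decay of the kernel replaces Fourier analysis. With [s = 2 - alpha], a
    spline at [t] is the weight of order [alpha - 2] at the integer part of [t]
    times a rational function ([quadratic_weighted_sum] and its two successors),
    and that weight, [Gamma (n + s) / (n! Gamma s)], is expanded with remainder
    [O(n^-3)]. Its logarithm has telescoping increments which are odd about a
    half-way point, so only odd orders occur ([log_ratio_bound],
    [ln_weight_asymptotics]); the constant is found by comparing the Gamma
    integral with tangent lines ([gamma_int_bounds], [ln_weight_limit]). The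
    spline thus has a three-term expansion in [1 / t] whose coefficients are, up to
    Gamma factors, those of the symbol [((1 - exp (- z)) / z)^alpha]
    ([spline_asymptotics_rl]). Shifting and combining, the kernel loses one order
    of growth for each of the identities satisfied by the coefficients
    ([kernel_expands]): the sums equal to 1, the equality of the first moments
    ([quasi_compact_moments]), and, once the correction term is subtracted, the
    definition of [e2] ([symbol_coef2E], with [a2E] for the coefficients [a2]).

    Finally [g s] is split into [g x] and [g s - g x] ([scheme_error]). The
    constant part integrates the kernel exactly, giving the kernel of index
    [r + 1] at [(x - a) / h], of order [h^r] after scaling. The other part is at
    most a multiple of [|x - s|], since [g] is differentiable at [x], and the
    first moment of the kernel converges, which gives [h^r] again.

    The same formulas cover [alpha = 2]: there the weights are those of the second
    difference, [1 / Gamma (2 - alpha)] is read as [0], and the kernel whose first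
    moment is taken has compact support. *)

Import Order.TTheory GRing.Theory Num.Theory.
Import numFieldNormedType.Exports.

Local Open Scope classical_set_scope.
Local Open Scope ring_scope.

Set Implicit Arguments.
Unset Strict Implicit.
Unset Printing Implicit Defensive.


(** * Taylor estimates *)

Section taylor.
Context {R : realType}.
Implicit Types (u M e E : R).

(** Mean value inequality on each side of [0]: integrating a bound gains one
    order, so Taylor estimates follow by iteration. *)
Lemma mvt_pow_bound (F F' : R -> R) (M r : R) (n : nat) :
  F 0 = 0 ->
  (forall u, `|u| <= r -> is_derive u 1 F (F' u)) ->
  (forall u, `|u| <= r -> `|F' u| <= M * `|u| ^+ n) ->
  forall u, `|u| <= r -> `|F u| <= M * `|u| ^+ n.+1.
Proof.
move=> F0 dF bF u ur.
have cF : {in `[- r, r], forall v, {for v, continuous F}}.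
  move=> v; rewrite in_itv/= -ler_norml => vr.
  exact/differentiable_continuous/derivable1_diffP/ex_derive/dF.
have M0 (v : R) : `|v| <= r -> 0 <= M * `|v| ^+ n.
  by move=> vr; apply: le_trans (bF v vr).
have key (a b w : R) : a <= w <= b -> `|a| <= `|u| -> `|b| <= `|u| -> `|w| <= `|u|.
  move=> /andP[aw wb]; rewrite !ler_norml => /andP[? _] /andP[_ ?].
  by apply/andP; split; lra.
have bound (w : R) : `|w| <= `|u| -> `|F' w| <= M * `|u| ^+ n.
  move=> wu; apply: le_trans (bF w (le_trans wu ur)) _.
  have [->|n0] := posnP n; first by rewrite !expr0.
  have [->|w0] := eqVneq w 0.
    by rewrite normr0 expr0n gtn_eqF// mulr0 M0.
  rewrite ler_wpM2l// ?lerXn2r//.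
  have := M0 w (le_trans wu ur).
  by rewrite pmulr_lge0// exprn_gt0// normr_gt0.
have mvt (a b : R) : a <= b -> `|a| <= `|u| -> `|b| <= `|u| ->
    `|F b - F a| <= M * `|u| ^+ n * (b - a).
  move=> ab au bu.
  have [||c cab ->] := @MVT_segment R F F' a b ab.
  - move=> x; rewrite in_itv/= => /andP[/ltW ax /ltW xb].
    by apply/dF/(le_trans _ ur)/(key a b x) => //; rewrite ax xb.
  - apply: continuous_in_subspaceT => x; rewrite inE/= in_itv/= => axb.
    apply: cF; rewrite in_itv/= -ler_norml.
    by apply: (le_trans _ ur); apply: (key a b x).
  rewrite normrM (ger0_norm (_ : 0 <= b - a)) ?subr_ge0//.
  apply: ler_wpM2r; first by rewrite subr_ge0.
  by apply: bound; apply: (key a b c) => //; move: cab; rewrite in_itv.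
rewrite exprSr mulrA.
have [u0|u0] := leP 0 u.
  have := mvt 0 u u0; rewrite normr0 F0 !subr0 normr_ge0 lexx.
  by move/(_ isT isT); rewrite (ger0_norm u0).
have := mvt u 0 (ltW u0); rewrite normr0 F0 !sub0r normrN normr_ge0 lexx.
by move/(_ isT isT); rewrite (ltr0_norm u0).
Qed.

Lemma powR_bound E : exists2 M : R, 0 <= M &
  forall u, `|u| <= 1 / 2 -> `|(1 + u) `^ E| <= M.
Proof.
exists (expR (`|E|)) => [|u]; first exact: expR_ge0.
rewrite ler_norml => /andP[u1 u2].
have u0 : 0 < 1 + u by lra.
rewrite ger0_norm ?powR_ge0// /powR gt_eqF// ler_expR.
apply: le_trans (ler_norm _) _; rewrite normrM ler_piMr//.
rewrite ler_norml; apply/andP; split.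
  have h : 0 < (1 + u)^-1 by rewrite invr_gt0.
  have := le_ln1Dx (_ : -1 < (1 + u)^-1 - 1).
  rewrite ltrBDr addNr subrKC lnV ?posrE// => /(_ h) h1.
  have : (1 + u)^-1 <= 2 by rewrite invf_ple ?posrE//; lra.
  lra.
have : ln (1 + u) <= u by apply: le_ln1Dx; lra.
lra.
Qed.

Lemma is_derive_powR1D E u : `|u| <= 1 / 2 ->
  is_derive u 1 (fun u => (1 + u) `^ E) (E * (1 + u) `^ (E - 1)).
Proof.
rewrite ler_norml => /andP[u1 u2].
have u0 : 0 < 1 + u by lra.
have h1 : is_derive (1 + u) 1 ((@powR R) ^~ E) (E * (1 + u) `^ (E - 1)).
  exact: is_derive1_powR.
have h2 : is_derive u 1 (fun u : R => 1 + u) 1.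
  by have := is_derive_shift u (1 : R) 1; under eq_fun do rewrite addrC.
by have := is_derive1_comp h1 h2; rewrite mulr1.
Qed.

Lemma powR_taylor0 E : exists2 M : R, 0 <= M &
  forall u, `|u| <= 1 / 2 -> `|(1 + u) `^ E - 1| <= M * `|u| ^+ 1.
Proof.
have [M M0 bM] := powR_bound (E - 1).
exists (`|E| * M); first by rewrite mulr_ge0.
apply: (@mvt_pow_bound _ (fun u => E * (1 + u) `^ (E - 1))).
- by rewrite addr0 powR1 subrr.
- move=> u ur; have h := is_derive_powR1D E ur.
  by apply: is_derive_eq; rewrite subr0.
- by move=> u ur; rewrite normrM expr0 mulr1 ler_wpM2l// bM.
Qed.

Lemma powR_taylor1 E : exists2 M : R, 0 <= M &
  forall u, `|u| <= 1 / 2 -> `|(1 + u) `^ E - 1 - E * u| <= M * `|u| ^+ 2.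
Proof.
have [M M0 bM] := powR_taylor0 (E - 1).
exists (`|E| * M); first by rewrite mulr_ge0.
apply: (@mvt_pow_bound _ (fun u => E * ((1 + u) `^ (E - 1) - 1))).
- by rewrite addr0 powR1 subrr mulr0 subrr.
- move=> u ur; have h := is_derive_powR1D E ur.
  by apply: is_derive_eq; rewrite /GRing.scale/=; ring.
- by move=> u ur; rewrite normrM -mulrA ler_wpM2l// bM.
Qed.

Lemma powR_taylor2 E : exists2 M : R, 0 <= M &
  forall u, `|u| <= 1 / 2 ->
    `|(1 + u) `^ E - 1 - E * u - E * (E - 1) / 2 * u ^+ 2| <= M * `|u| ^+ 3.
Proof.
have [M M0 bM] := powR_taylor1 (E - 1).
exists (`|E| * M); first by rewrite mulr_ge0.
apply: (@mvt_pow_bound _ (fun u => E * ((1 + u) `^ (E - 1) - 1 - (E - 1) * u))).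
- by rewrite addr0 powR1 subrr; ring.
- move=> u ur; have h := is_derive_powR1D E ur.
  by apply: is_derive_eq; rewrite /GRing.scale/=; field.
- by move=> u ur; rewrite normrM -mulrA ler_wpM2l// bM.
Qed.

Lemma expR_taylor1 u : `|u| <= 1 -> `|expR u - 1 - u| <= expR 1 * `|u| ^+ 2.
Proof.
move: u; apply: (@mvt_pow_bound _ (fun u => expR u - 1)).
- by rewrite expR0 !subrr.
- by move=> u ur; apply: is_derive_eq; rewrite subr0.
apply: (@mvt_pow_bound _ expR).
- by rewrite expR0 subrr.
- by move=> u ur; apply: is_derive_eq; rewrite subr0.
- move=> u; rewrite ler_norml => /andP[_ ur].
  by rewrite expr0 mulr1 ger0_norm ?expR_ge0// ler_expR.
Qed.

End taylor.

(** * Truncated expansions in [y = 1 / t] *)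

Section truncated_expansion.
Context {R : realType}.
Implicit Types (phi psi : R -> R).

(** The coefficients are bounded functions rather than constants, because the
    fractional part of [1 / y] occurs in the expansions of the weights. *)
Definition expands (phi a0 a1 a2 : R -> R) := exists M : R, \forall y \near 0^'+,
  [/\ `|a0 y| <= M, `|a1 y| <= M, `|a2 y| <= M &
      `|phi y - (a0 y + a1 y * y + a2 y * y ^+ 2)| <= M * y ^+ 3].

Lemma expands_eq (phi psi a0 a1 a2 b0 b1 b2 : R -> R) : expands phi a0 a1 a2 ->
  (\forall y \near 0^'+, [/\ phi y = psi y, a0 y = b0 y, a1 y = b1 y & a2 y = b2 y]) ->
  expands psi b0 b1 b2.
Proof.
move=> [M HM] E; exists M; apply: filterS2 HM E => y [? ? ? ?] [<- <- <- <-].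
by split.
Qed.

Lemma expands_approx (phi psi a0 a1 a2 : R -> R) (K : R) : expands psi a0 a1 a2 ->
  (\forall y \near 0^'+, `|phi y - psi y| <= K * y ^+ 3) -> expands phi a0 a1 a2.
Proof.
move=> [M HM] HK; exists (M + `|K|); near=> y.
have y0 : 0 < y by near: y; exact: nbhs_right_gt.
have [h0 h1 h2 h3] : [/\ `|a0 y| <= M, `|a1 y| <= M, `|a2 y| <= M &
      `|psi y - (a0 y + a1 y * y + a2 y * y ^+ 2)| <= M * y ^+ 3] by near: y.
have hK : `|phi y - psi y| <= K * y ^+ 3 by near: y.
split; try by rewrite -[leLHS]addr0 lerD.
rewrite [X in `|X|](_ : _ = (psi y - (a0 y + a1 y * y + a2 y * y ^+ 2)) + (phi y - psi y)); last by ring.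
rewrite (le_trans (ler_normD _ _))// mulrDl lerD// (le_trans hK)//.
by rewrite ler_wpM2r ?exprn_ge0 ?(ltW y0)// ler_norm.
Unshelve. all: by end_near. Qed.

Lemma expands_cst (k : R) : expands (cst k) (cst k) (cst 0) (cst 0).
Proof.
exists `|k|; near=> y; split => //=; rewrite ?normr0//.
by rewrite !mul0r !addr0 subrr normr0 mulr_ge0// exprn_ge0.
Unshelve. all: by end_near. Qed.

Lemma expandsD (phi psi a0 a1 a2 b0 b1 b2 : R -> R) :
  expands phi a0 a1 a2 -> expands psi b0 b1 b2 ->
  expands (phi \+ psi) (a0 \+ b0) (a1 \+ b1) (a2 \+ b2).
Proof.
move=> [M HM] [N HN]; exists (M + N).
apply: filterS2 HM HN => y [? ? ? hM] [? ? ? hN] /=; split.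
- by rewrite (le_trans (ler_normD _ _))// lerD.
- by rewrite (le_trans (ler_normD _ _))// lerD.
- by rewrite (le_trans (ler_normD _ _))// lerD.
have -> : phi y + psi y - (a0 y + b0 y + (a1 y + b1 y) * y + (a2 y + b2 y) * y ^+ 2)
   = (phi y - (a0 y + a1 y * y + a2 y * y ^+ 2)) +
     (psi y - (b0 y + b1 y * y + b2 y * y ^+ 2)) by ring.
by rewrite (le_trans (ler_normD _ _))// mulrDl lerD.
Qed.

Lemma expandsM (phi psi a0 a1 a2 b0 b1 b2 : R -> R) :
  expands phi a0 a1 a2 -> expands psi b0 b1 b2 ->
  expands (phi \* psi) (a0 \* b0) (fun y => a0 y * b1 y + a1 y * b0 y)
    (fun y => a0 y * b2 y + a1 y * b1 y + a2 y * b0 y).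
Proof.
move=> [M HM] [N HN]; exists (11 * (M * N)); near=> y.
have y0 : 0 < y by near: y; exact: nbhs_right_gt.
have y1 : y < 1 by near: y; exact: nbhs_right_lt.
have [A0 A1 A2 hM] : [/\ `|a0 y| <= M, `|a1 y| <= M, `|a2 y| <= M &
      `|phi y - (a0 y + a1 y * y + a2 y * y ^+ 2)| <= M * y ^+ 3].
  by near: y.
have [B0 B1 B2 hN] : [/\ `|b0 y| <= N, `|b1 y| <= N, `|b2 y| <= N &
      `|psi y - (b0 y + b1 y * y + b2 y * y ^+ 2)| <= N * y ^+ 3].
  by near: y.
have M0 : 0 <= M by apply: le_trans A0.
have N0 : 0 <= N by apply: le_trans B0.
have MN0 : 0 <= M * N by rewrite mulr_ge0.
have y20 : 0 <= y ^+ 2 by rewrite exprn_ge0 ?ltW.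
have y30 : 0 <= y ^+ 3 by rewrite exprn_ge0 ?ltW.
have y21 : y ^+ 2 <= 1 by rewrite exprn_ile1// ltW.
have y31 : y ^+ 3 <= 1 by rewrite exprn_ile1// ltW.
have T3 (c0 c1 c2 K : R) : `|c0| <= K -> `|c1| <= K -> `|c2| <= K ->
    `|c0 + c1 + c2| <= 3 * K.
  move=> h0 h1 h2.
  rewrite (le_trans (ler_normD _ _))// (_ : 3 * K = (K + K) + K); last by ring.
  by rewrite lerD// (le_trans (ler_normD _ _))// lerD.
have yM (c z K : R) : `|c| <= K -> 0 <= z <= 1 -> `|c * z| <= K.
  move=> cK /andP[z0 z1]; rewrite normrM (ger0_norm z0).
  by rewrite (le_trans _ cK)// ler_piMr.
have pM (c d K L : R) : `|c| <= K -> `|d| <= L -> `|c * d| <= K * L.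
  by move=> cM dN; rewrite normrM ler_pM.
have MNle k : 1 <= k <= 11 -> k * (M * N) <= 11 * (M * N).
  by move=> /andP[_ ?]; rewrite ler_wpM2r.
split.
- rewrite (le_trans (pM _ _ _ _ A0 B0))// -[leLHS]mul1r; apply: MNle; lra.
- rewrite (le_trans (ler_normD _ _))// (le_trans (lerD (pM _ _ _ _ A0 B1) (pM _ _ _ _ A1 B0)))//.
  by lra.
- by rewrite (le_trans (T3 _ _ _ _ (pM _ _ _ _ A0 B2) (pM _ _ _ _ A1 B1) (pM _ _ _ _ A2 B0)))//; apply: MNle; lra.
set TM := a0 y + a1 y * y + a2 y * y ^+ 2 in hM.
set TN := b0 y + b1 y * y + b2 y * y ^+ 2 in hN.
have bTM : `|TM| <= 3 * M.
  by apply: T3 => //; apply: yM => //; rewrite ?(ltW y0) ?(ltW y1) ?y20 ?y21.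
have bTN : `|TN| <= 3 * N.
  by apply: T3 => //; apply: yM => //; rewrite ?(ltW y0) ?(ltW y1) ?y20 ?y21.
have bpsi : `|psi y| <= 4 * N.
  rewrite -(subrK TN (psi y)) (le_trans (ler_normD _ _))//.
  rewrite (_ : 4 * N = N + 3 * N); last by ring.
  by rewrite lerD// (le_trans hN)// ler_piMr.
rewrite [X in `|X|](_ : _ = (phi y - TM) * psi y + TM * (psi y - TN) +
   (a1 y * b2 y + a2 y * b1 y + a2 y * b2 y * y) * y ^+ 3); last first.
  by rewrite /TM /TN /=; ring.
rewrite (_ : 11 * (M * N) * y ^+ 3 =
  (M * y ^+ 3 * (4 * N) + 3 * M * (N * y ^+ 3)) + 4 * (M * N) * y ^+ 3 ); last by ring.
rewrite (le_trans (ler_normD _ _))// lerD//.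
  by rewrite (le_trans (ler_normD _ _))// lerD// pM.
rewrite normrM (ger0_norm y30) ler_wpM2r//.
apply: le_trans (_ : 3 * (M * N) <= _); last by rewrite ler_wpM2r//; lra.
by apply: T3; [exact: pM|exact: pM|apply: yM; rewrite ?pM// !ltW].
Unshelve. all: by end_near. Qed.

Lemma expands_X : expands id (cst 0) (cst 1) (cst 0).
Proof.
exists 1; near=> y; rewrite /= normr0 normr1; split => //.
by rewrite mul1r mul0r add0r addr0 subrr normr0 mul1r exprn_ge0.
Unshelve. all: by end_near. Qed.

Lemma expandsZ (k : R) (phi a0 a1 a2 : R -> R) : expands phi a0 a1 a2 ->
  expands (k \*o phi) (k \*o a0) (k \*o a1) (k \*o a2).
Proof.
move=> h; apply: expands_eq (expandsM (expands_cst k) h) _.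
by near=> y; split => //=; rewrite ?mul0r ?addr0//; ring.
Unshelve. all: by end_near. Qed.

Lemma expands_powR (k : R -> R) (K E : R) : (\forall y \near 0^'+, `|k y| <= K) ->
  expands (fun y => (1 + k y * y) `^ E) (cst 1) (fun y => E * k y)
    (fun y => E * (E - 1) / 2 * (k y) ^+ 2).
Proof.
move=> kK; have [M M0 bM] := powR_taylor2 E.
have K0 : 0 <= K.
  near ((0 : R)^'+) => y.
  have yK : `|k y| <= K by near: y.
  exact: le_trans yK.
exists (1 + `|E| * K + `|E * (E - 1) / 2| * K ^+ 2 + M * K ^+ 3); near=> y.
have kyK1 : `|k y| <= K by near: y.
have y0 : 0 < y by near: y; exact: nbhs_right_gt.
have h1 : 0 <= `|E| * K by rewrite mulr_ge0.
have h2 : 0 <= `|E * (E - 1) / 2| * K ^+ 2 by rewrite mulr_ge0// exprn_ge0.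
have h3 : 0 <= M * K ^+ 3 by rewrite mulr_ge0// exprn_ge0.
have kyK n : `|k y ^+ n| <= K ^+ n by rewrite normrX lerXn2r// nnegrE.
split.
- by rewrite /= normr1; lra.
- rewrite normrM; have : `|E| * `|k y| <= `|E| * K by rewrite ler_wpM2l.
  by lra.
- rewrite normrM.
  have : `|E * (E - 1) / 2| * `|k y ^+ 2| <= `|E * (E - 1) / 2| * K ^+ 2.
    by rewrite ler_wpM2l.
  by lra.
have yK : K * y <= 1 / 2.
  have yd : y < (2 * (K + 1))^-1.
    by near: y; apply: nbhs_right_lt; rewrite invr_gt0; lra.
  have : y * (2 * (K + 1)) <= 1.
    by rewrite -ler_pdivlMr ?mul1r ?ltW//; lra.
  by lra.
have ky : `|k y * y| <= 1 / 2.
  by rewrite normrM (gtr0_norm y0) (le_trans _ yK)// ler_wpM2r// ltW.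
have := bM _ ky.
rewrite [X in `|X| <= _ -> _](_ : _ = (1 + k y * y) `^ E -
   (cst 1 y + E * k y * y + E * (E - 1) / 2 * k y ^+ 2 * y ^+ 2)); last by rewrite /=; ring.
move=> /le_trans; apply; rewrite normrM exprMn (gtr0_norm y0) mulrA.
rewrite ler_wpM2r ?exprn_ge0 ?(ltW y0)//.
rewrite (le_trans (_ : _ <= M * K ^+ 3))//; last by lra.
by rewrite ler_wpM2l// -normrX.
Unshelve. all: by end_near. Qed.

Lemma expands_lin (a : R) (k : R -> R) (K : R) : (\forall y \near 0^'+, `|k y| <= K) ->
  expands (fun y => a + k y * y) (cst a) k (cst 0).
Proof.
move=> kK; exists (`|a| + K); near=> y.
have kyK : `|k y| <= K by near: y.
have a0 : 0 <= `|a| by [].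
have k0 : 0 <= `|k y| by [].
rewrite /= mul0r addr0 subrr !normr0; split; try lra.
by rewrite mulr_ge0 ?exprn_ge0//; lra.
Unshelve. all: by end_near. Qed.

Lemma expands_exact (phi : R -> R) (a0 a1 a2 : R) :
  (\forall y \near 0^'+, phi y = a0 + a1 * y + a2 * y ^+ 2) ->
  expands phi (cst a0) (cst a1) (cst a2).
Proof.
move=> E; exists (`|a0| + `|a1| + `|a2|); near=> y.
have -> : phi y = a0 + a1 * y + a2 * y ^+ 2 by near: y.
have h0 : 0 <= `|a0| by []. have h1 : 0 <= `|a1| by []. have h2 : 0 <= `|a2| by [].
rewrite /= subrr normr0; split; try lra.
by rewrite mulr_ge0 ?exprn_ge0//; lra.
Unshelve. all: by end_near. Qed.

Lemma expands_bounded (k : R -> R) (K : R) : (\forall y \near 0^'+, `|k y| <= K) ->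
  expands k k (cst 0) (cst 0).
Proof.
move=> kK; exists K; near=> y.
have kyK : `|k y| <= K by near: y.
have k0 : 0 <= `|k y| by [].
rewrite /= !mul0r !addr0 subrr !normr0; split; try lra.
by rewrite mulr_ge0 ?exprn_ge0//; lra.
Unshelve. all: by end_near. Qed.

Lemma expands_expR (c K : R) (w : R -> R) :
  (\forall y \near 0^'+, `|w y - c * y ^+ 2| <= K * y ^+ 3) ->
  expands (fun y => expR (w y)) (cst 1) (cst 0) (cst c).
Proof.
move=> hw; exists (1 + `|c| + `|K| + expR 1 * (`|c| + `|K|) ^+ 2); near=> y.
have y0 : 0 < y by near: y; exact: nbhs_right_gt.
have y1 : y < 1 by near: y; exact: nbhs_right_lt.
have hwy : `|w y - c * y ^+ 2| <= K * y ^+ 3 by near: y.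
have Ly : (`|c| + `|K|) * y <= 1.
  have L0 : 0 < `|c| + `|K| + 1 by rewrite ltr_wpDl// addr_ge0.
  have yd : y < (`|c| + `|K| + 1)^-1.
    by near: y; apply: nbhs_right_lt; rewrite invr_gt0.
  have : y * (`|c| + `|K| + 1) <= 1 by rewrite -ler_pdivlMr ?mul1r ?ltW.
  by lra.
have e0 : 0 <= expR 1 * (`|c| + `|K|) ^+ 2 :> R.
  by rewrite mulr_ge0 ?expR_ge0// exprn_ge0// addr_ge0.
have c0 : 0 <= `|c| by []. have K0 : 0 <= `|K| by [].
rewrite /= normr1 normr0; split => //; try lra.
have wb : `|w y| <= (`|c| + `|K|) * y ^+ 2.
  rewrite -(subrK (c * y ^+ 2) (w y)) (le_trans (ler_normD _ _))// addrC mulrDl.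
  rewrite lerD//.
    by rewrite normrM (ger0_norm (exprn_ge0 _ (ltW y0))).
  rewrite (le_trans hwy)// (le_trans (_ : _ <= `|K| * y ^+ 3))//.
    by rewrite ler_wpM2r ?exprn_ge0 ?(ltW y0)// ler_norm.
  by rewrite ler_wpM2l// exprSr ler_piMr ?exprn_ge0 ?(ltW y0) ?(ltW y1).
have : 0 <= `|c| + `|K| by lra.
move: e0 wb Ly; move: (`|c| + `|K|) (erefl (`|c| + `|K|)) => L LE e0 wb Ly L0.
have wy : `|w y| <= L * y.
  rewrite (le_trans wb)// ler_wpM2l// expr2 ler_piMr ?(ltW y0) ?(ltW y1)//.
have := expR_taylor1 (le_trans wy Ly) => hexp.
rewrite [X in `|X|](_ : _ = (expR (w y) - 1 - w y) + (w y - c * y ^+ 2)); last by ring.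
rewrite (le_trans (ler_normD _ _))//.
have E1 : `|expR (w y) - 1 - w y| <= expR 1 * L ^+ 2 * y ^+ 3.
  rewrite (le_trans hexp)// -mulrA ler_wpM2l ?expR_ge0//.
  rewrite (le_trans (_ : _ <= (L * y ^+ 2) ^+ 2)) ?lerXn2r ?nnegrE//.
    by rewrite mulr_ge0 ?exprn_ge0 ?(ltW y0).
  rewrite exprMn ler_wpM2l ?exprn_ge0// -exprM (exprS _ 3).
  by rewrite ler_piMl ?exprn_ge0 ?(ltW y0) ?(ltW y1).
have E2 : `|w y - c * y ^+ 2| <= `|K| * y ^+ 3.
  by rewrite (le_trans hwy)// ler_wpM2r ?exprn_ge0 ?(ltW y0)// ler_norm.
rewrite (le_trans (lerD E1 E2))// -mulrDl ler_wpM2r ?exprn_ge0 ?(ltW y0)//; lra.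
Unshelve. all: by end_near. Qed.

End truncated_expansion.

(** * Grünwald weights *)

Section weights.
Context {R : realType}.
Implicit Types (a s : R) (n : nat).

Lemma grunwald_coef0 a : grunwald_coef a 0 = 1.
Proof. by rewrite /grunwald_coef /gbinom big_ord0 expr0 fact0 divr1 mulr1. Qed.

Lemma grunwald_coefS a n :
  grunwald_coef a n.+1 = grunwald_coef a n * (n%:R - a) / n.+1%:R.
Proof.
rewrite /grunwald_coef /gbinom big_ord_recr/= factS natrM exprS.
have h1 : n.+1%:R != 0 :> R by [].
have h2 : n`!%:R != 0 :> R by rewrite pnatr_eq0 -lt0n fact_gt0.
by rewrite -natr1 in h1 *; field; rewrite h2 h1.
Qed.

Lemma grunwald_coef_gt0 s n : 0 < s -> 0 < grunwald_coef (- s) n.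
Proof.
move=> s0; elim: n => [|n ih]; first by rewrite grunwald_coef0.
by rewrite grunwald_coefS divr_gt0// mulr_gt0// opprK ltr_wpDl.
Qed.

(** Passing from order [a] to order [a - 1] is partial summation; here it is
    the multiplication by a rational function of the index. *)
Lemma grunwald_coef_shift a n :
  (n%:R - a) * grunwald_coef a n = - a * grunwald_coef (a - 1) n.
Proof.
elim: n => [|n ih]; first by rewrite !grunwald_coef0 sub0r !mulr1.
rewrite !grunwald_coefS; have h1 : n.+1%:R != 0 :> R by [].
rewrite -natr1 in h1 *.
move: (grunwald_coef a n) (grunwald_coef (a - 1) n) ih => A B ih.
rewrite [LHS](_ : _ = (n%:R + 1 - a) * ((n%:R - a) * A) / (n%:R + 1)); last by field.
by rewrite ih; field.
Qed.

End weights.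


(** * Logarithmic asymptotics of the weights *)

Section log_ratio.
Context {R : realType}.

(** Both differences of logarithms are odd in [y]: the linear terms cancel, the
    cubic ones are removed by the last summand, and the next order is five. *)
Lemma log_ratio_bound (e : R) : `|e| < 1 -> exists2 M : R, 0 <= M &
  forall y, `|y| <= 1 / 2 ->
    `|ln (1 + e / 2 * y) - ln (1 + - e / 2 * y)
      - e * (ln (1 + 1 / 2 * y) - ln (1 + - 1 / 2 * y))
      + (e - e ^+ 3) / 12 * (y ^+ 3 / (1 - y ^+ 2 / 4) ^+ 2)| <= M * `|y| ^+ 5.
Proof.
move=> e1.
have dln (k y : R) : `|k| <= 1 / 2 -> `|y| <= 1 / 2 ->
    0 < 1 + k * y /\ is_derive y 1 (fun y => ln (1 + k * y)) (k / (1 + k * y)).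
  move=> k1 y1.
  have h0 : 0 < 1 + k * y.
    have : `|k * y| <= 1 / 2 * (1 / 2) by rewrite normrM ler_pM.
    by rewrite ler_norml => /andP[? _]; lra.
  split => //.
  have h1 : is_derive y 1 (fun y : R => 1 + k * y) k.
    apply: is_derive_eq; rewrite /GRing.scale/=.
    by ring.
  have := @is_derive1_comp _ (@ln R) (fun y : R => 1 + k * y) y _ _ (is_derive1_ln h0) h1.
  by move/is_derive_eq; apply; rewrite mulrC.
(* The derivative is [y ^ 4] times the sum of two fractions, each at most 4. *)
exists 8 => //; apply: (@mvt_pow_bound _ _ (fun y =>
   y ^+ 4 * (e * (1 - e ^+ 2) ^+ 2 / 16 / ((1 - y ^+ 2 / 4) ^+ 2 * (1 - e ^+ 2 * y ^+ 2 / 4))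
     + (e - e ^+ 3) / 12 / (1 - y ^+ 2 / 4) ^+ 3))).
- by rewrite !mulr0 !addr0 !subrr mulr0 expr0n/= mul0r mulr0 subrr addr0.
- move=> y y1.
  have e2 : `|e / 2| <= 1 / 2 by move: e1; rewrite ltr_norml ler_norml => /andP[? ?]; apply/andP; split; lra.
  have e2' : `|- e / 2| <= 1 / 2 by rewrite mulNr normrN.
  have [p1 d1] := dln _ _ e2 y1.
  have [p2 d2] := dln _ _ e2' y1.
  have [p3 d3] : 0 < 1 + 1 / 2 * y /\ is_derive y 1 (fun y => ln (1 + 1 / 2 * y)) (1 / 2 / (1 + 1 / 2 * y)).
    by apply: dln => //; rewrite ger0_norm.
  have [p4 d4] : 0 < 1 + - 1 / 2 * y /\ is_derive y 1 (fun y => ln (1 + - 1 / 2 * y)) (- 1 / 2 / (1 + - 1 / 2 * y)).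
    by apply: dln => //; rewrite mulNr normrN ger0_norm.
  have p5 : 0 < 1 - y ^+ 2 / 4.
    rewrite (_ : _ - _ = (1 + 1 / 2 * y) * (1 + - 1 / 2 * y)); last by field.
    exact: mulr_gt0.
  have d5 : is_derive y 1 (fun y : R => (1 - y ^+ 2 / 4) ^+ 2) (- (1 - y ^+ 2 / 4) * y).
    by apply: is_derive_eq; rewrite /GRing.scale/=; field.
  have d6 : is_derive y 1 (fun y : R => ((1 - y ^+ 2 / 4) ^+ 2)^-1) (y / (1 - y ^+ 2 / 4) ^+ 3).
    have p52 : (1 - y ^+ 2 / 4) ^+ 2 != 0 by rewrite expf_neq0// gt_eqF.
    have := @is_deriveV _ (fun y : R => (1 - y ^+ 2 / 4) ^+ 2) y _ 1 p52 d5.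
    move/is_derive_eq; apply; rewrite /GRing.scale/=.
    by move: (1 - y ^+ 2 / 4) (lt0r_neq0 p5) => d d0; field.
  have d7 : is_derive y 1 (fun y : R => y ^+ 3 / (1 - y ^+ 2 / 4) ^+ 2)
     (3 * y ^+ 2 / (1 - y ^+ 2 / 4) ^+ 2 + y ^+ 3 * (y / (1 - y ^+ 2 / 4) ^+ 3)).
    apply: is_derive_eq; rewrite /GRing.scale/=.
    by move: (1 - y ^+ 2 / 4) (lt0r_neq0 p5) => d d0; field.
  have d8 := is_deriveB d1 d2.
  have d9 := is_deriveZ e (is_deriveB d3 d4).
  have d10 := is_deriveZ ((e - e ^+ 3) / 12) d7.
  have d11 := is_deriveD (is_deriveB d8 d9) d10.
  apply: (@is_derive_eq _ _ _ _ _ _ _ _ d11).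
  rewrite /GRing.scale/=.
  have q1 : 2 + e * y != 0 by rewrite gt_eqF//; lra.
  have q2 : 2 - e * y != 0 by rewrite gt_eqF//; lra.
  have q3 : 2 + y != 0 by rewrite gt_eqF//; lra.
  have q4 : 2 - y != 0 by rewrite gt_eqF//; lra.
  have q5 : 1 - y ^+ 2 / 4 = (2 + y) * (2 - y) / 4 by field.
  have q6 : 1 - e ^+ 2 * y ^+ 2 / 4 = (2 + e * y) * (2 - e * y) / 4 by field.
  have -> : e / 2 / (1 + e / 2 * y) = e / (2 + e * y) by field; rewrite q1; lra.
  have -> : - e / 2 / (1 + - e / 2 * y) = - e / (2 - e * y) by field; rewrite q2; lra.
  have -> : 1 / 2 / (1 + 1 / 2 * y) = 1 / (2 + y) by field; rewrite q3; lra.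
  have -> : - 1 / 2 / (1 + - 1 / 2 * y) = - 1 / (2 - y) by field; rewrite q4; lra.
  rewrite q5 q6; field.
  by rewrite q1 q2 q3 q4.
- move=> y y1; rewrite normrM normrX mulrC ler_wpM2r ?exprn_ge0//.
  have y2 : 0 <= y ^+ 2 <= 1 / 4.
    by rewrite sqr_ge0/=; move: y1; rewrite ler_norml => /andP[? ?]; nra.
  have e2 : 0 <= e ^+ 2 <= 1.
    by rewrite sqr_ge0/=; move: e1; rewrite ltr_norml => /andP[? ?]; nra.
  case/andP: y2 => y20 y21; case/andP: e2 => e20 e21.
  have D1 : 1 / 2 <= 1 - y ^+ 2 / 4 by lra.
  have D2 : 1 / 2 <= 1 - e ^+ 2 * y ^+ 2 / 4.
    by have : e ^+ 2 * y ^+ 2 <= 1 * (1 / 4) by [rewrite ler_pM]; lra.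
  have frac (A B : R) : `|A| <= 1 / 2 -> 1 / 8 <= B -> `|A / B| <= 4.
    move=> hA hB; have B0 : 0 < B by lra.
    by rewrite normrM normfV (gtr0_norm B0) ler_pdivrMr//; lra.
  have e1' : `|e| <= 1 by exact: ltW.
  have D13 : 1 / 8 <= (1 - y ^+ 2 / 4) ^+ 3.
    rewrite (_ : 1 / 8 = (1 / 2) ^+ 3); last by field.
    by rewrite lerXn2r ?nnegrE//; lra.
  have D12 : 1 / 8 <= (1 - y ^+ 2 / 4) ^+ 2 * (1 - e ^+ 2 * y ^+ 2 / 4).
    rewrite (_ : 1 / 8 = (1 / 2) ^+ 2 * (1 / 2)); last by field.
    by rewrite ler_pM// lerXn2r ?nnegrE//; lra.
  rewrite (le_trans (ler_normD _ _))// (_ : 8 = 4 + 4); last by ring.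
  have f2 : `|(1 - e ^+ 2) ^+ 2| <= 1.
    by rewrite normrX exprn_ile1// ger0_norm; lra.
  rewrite lerD// frac//.
    rewrite normrM normfV (@ger0_norm _ 16)// ler_pdivrMr// normrM.
    by have := ler_pM (normr_ge0 _) (normr_ge0 _) e1' f2; lra.
  rewrite (_ : e - e ^+ 3 = e * (1 - e ^+ 2)); last by ring.
  rewrite normrM normfV (@ger0_norm _ 12)// ler_pdivrMr// normrM.
  have f1 : `|1 - e ^+ 2| <= 1 by rewrite ger0_norm; lra.
  by have := ler_pM (normr_ge0 _) (normr_ge0 _) e1' f1; lra.
Qed.

End log_ratio.


Section weight_asymptotics.
Context {R : realType}.

(** Summing the increments from [n] to infinity turns a bound on one step into a
    rate of convergence. *)
Lemma telescoping_rate (q d : nat -> R) (L : R) (m : nat) :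
  q @ \oo --> L -> d @ \oo --> (0 : R) ->
  (forall n, (m <= n)%N -> `|q n.+1 - q n| <= d n - d n.+1) ->
  forall n, (m <= n)%N -> `|q n - L| <= d n.
Proof.
move=> qL d0 qd n mn.
have step k : `|q (k + n)%N - q n| <= d n - d (k + n)%N.
  elim: k => [|k ih]; first by rewrite add0n !subrr normr0.
  rewrite addSn (_ : _ - _ = (q (k + n).+1 - q (k + n)%N) + (q (k + n)%N - q n)); last by ring.
  rewrite (le_trans (ler_normD _ _))//.
  have := qd (k + n)%N (leq_trans mn (leq_addl _ _)).
  by move: ih; lra.
have qL' : q (k + n)%N @[k --> \oo] --> L.
  by have := cvg_shiftn n q (nbhs L) => ->.
have d0' : d (k + n)%N @[k --> \oo] --> (0 : R).
  by have := cvg_shiftn n d (nbhs (0 : R)) => ->.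
have h1 : `|q (k + n)%N - q n| @[k --> \oo] --> `|L - q n|.
  by apply: cvg_norm; apply: cvgB => //; exact: cvg_cst.
have h2 : `|q (k + n)%N - q n| + d (k + n)%N @[k --> \oo] --> `|L - q n| + 0.
  exact: cvgD.
have := @cvgr_to_le _ _ _ _ _ _ (d n) h2.
rewrite addr0 distrC; apply.
by apply: nearW => k; have := step k; lra.
Qed.

(** Measured from [M], half-way between [n + s / 2] and [n + 1 + s / 2], the four
    points of the quotient of consecutive terms come in symmetric pairs, which
    is the situation of [log_ratio_bound]. *)
Lemma weight_log_increment (s : R) (n : nat) (e := s - 1)
    (M := n%:R + s / 2 + 1 / 2 : R) (y := M^-1) : 0 < s < 1 -> (2 <= n)%N ->
  let q (n : nat) := ln (grunwald_coef (- s) n) - e * ln (n%:R + s / 2)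
    - (e - e ^+ 3) / 24 / (n%:R + s / 2) ^+ 2 in
  q n.+1 - q n = ln (1 + e / 2 * y) - ln (1 + - e / 2 * y)
      - e * (ln (1 + 1 / 2 * y) - ln (1 + - 1 / 2 * y))
      + (e - e ^+ 3) / 12 * (y ^+ 3 / (1 - y ^+ 2 / 4) ^+ 2).
Proof.
move=> /andP[s0 s1] n2 q; rewrite /q grunwald_coefS opprK -natr1.
have n0 : 2 <= n%:R :> R by rewrite ler_nat.
have M2 : 2 < M by rewrite /M; lra.
have M0 : 0 < M by lra.
have y0 : 0 < y by rewrite invr_gt0.
have r0 := grunwald_coef_gt0 n s0.
have p1 : 0 < n%:R + s by lra.
have p2 : 0 < n%:R + 1 :> R by lra.
have -> : ln (grunwald_coef (- s) n * (n%:R + s) / (n%:R + 1)) =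
    ln (grunwald_coef (- s) n) + ln (n%:R + s) - ln (n%:R + 1).
  move: (grunwald_coef (- s) n) r0 => r r0.
  by rewrite ln_div ?posrE ?mulr_gt0// lnM ?posrE.
move: (ln (grunwald_coef (- s) n)) => lr.
have E1 : n%:R + s = M * (1 + e / 2 * y) by rewrite /e /y /M; field; rewrite gt_eqF//; move: M2; rewrite /M; lra.
have E2 : n%:R + 1 = M * (1 + - e / 2 * y) by rewrite /e /y /M; field; rewrite gt_eqF//; move: M2; rewrite /M; lra.
have E3 : n%:R + s / 2 = M * (1 + - 1 / 2 * y) by rewrite /y /M; field; rewrite gt_eqF//; move: M2; rewrite /M; lra.
have E4 : n%:R + 1 + s / 2 = M * (1 + 1 / 2 * y) by rewrite /y /M; field; rewrite gt_eqF//; move: M2; rewrite /M; lra.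
have pos (A : R) : 0 < M * A -> 0 < A by rewrite pmulr_rgt0.
have P1 : 0 < 1 + e / 2 * y by apply: pos; rewrite -E1; lra.
have P2 : 0 < 1 + - e / 2 * y by apply: pos; rewrite -E2; lra.
have P3 : 0 < 1 + - 1 / 2 * y by apply: pos; rewrite -E3; lra.
have P4 : 0 < 1 + 1 / 2 * y by apply: pos; rewrite -E4; lra.
rewrite E4 E1 E2 E3 !lnM ?posrE//.
rewrite [y ^+ 3 / _](_ : _ = ((M * (1 + - 1 / 2 * y)) ^- 2 - (M * (1 + 1 / 2 * y)) ^- 2) / 2).
  move: ((M * (1 + 1 / 2 * y)) ^- 2) ((M * (1 + - 1 / 2 * y)) ^- 2) => U V.
  by field.
have Py : 1 - y ^+ 2 / 4 = (1 + - 1 / 2 * y) * (1 + 1 / 2 * y) by field.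
have My : M = y^-1 by rewrite /y invrK.
rewrite Py My.
have Q1 : 0 < 2 + y by lra.
have Q2 : 0 < 2 + - 1 * y by lra.
by field; rewrite !gt_eqF.
Qed.

(** Bounds a step of order five by a telescoping difference of inverse cubes. *)
Lemma inv_cube_step (a : R) : 2 <= a ->
  (a + 1 / 2)^-1 ^+ 5 <= (a ^+ 3)^-1 - ((a + 1) ^+ 3)^-1.
Proof.
move=> a2; have a0 : 0 < a by lra.
have p0 : 0 < a * (a + 1) by rewrite mulr_gt0//; lra.
have h1 : ((a * (a + 1)) ^+ 2)^-1 <= (a ^+ 3)^-1 - ((a + 1) ^+ 3)^-1.
  rewrite (_ : (a ^+ 3)^-1 - _ = (3 * (a * (a + 1)) + 1) / (a * (a + 1)) ^+ 3); last first.
    by field; rewrite !gt_eqF//; lra.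
  rewrite ler_pdivlMr ?exprn_gt0// (exprSr _ 2) mulKf; first lra.
  by rewrite expf_neq0 ?gt_eqF.
apply: le_trans h1; rewrite exprVn lef_pV2 ?posrE ?exprn_gt0//; last lra.
have h2 : (a * (a + 1)) ^+ 2 <= ((a + 1 / 2) ^+ 2) ^+ 2.
  by rewrite lerXn2r ?nnegrE ?sqr_ge0 ?(ltW p0)//; nra.
rewrite (le_trans h2)// -exprM exprSr ler_peMr ?exprn_ge0//; lra.
Qed.

(** The points [n + s / 2] and [n + 1 + s / 2] are symmetric about the midpoint of
    [n + s] and [n + 1], which is why no term of first order appears. *)
Lemma ln_weight_asymptotics (s L : R) : 0 < s < 1 ->
  (fun n => ln (grunwald_coef (- s) n) - (s - 1) * ln (n%:R + s / 2)) @ \oo --> L ->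
  exists2 M : R, 0 <= M & forall n, (2 <= n)%N ->
  `|ln (grunwald_coef (- s) n) - (s - 1) * ln (n%:R + s / 2)
    - ((s - 1) - (s - 1) ^+ 3) / 24 / (n%:R + s / 2) ^+ 2 - L|
  <= M / (n%:R + s / 2) ^+ 3.
Proof.
move=> /andP[s0 s1] qL.
set e := s - 1; set B := (e - e ^+ 3) / 24.
have e1 : `|e| < 1 by rewrite /e ltr_norml; apply/andP; split; lra.
have N0 n : 0 < n%:R + s / 2 by have : 0 <= n%:R :> R by []; lra.
have Ninf : (n%:R + s / 2)^-1 @[n --> \oo] --> (0 : R).
  apply/cvgrVy; first by near=> n; rewrite invr_gt0.
  apply/cvgryPge => A; near=> n; rewrite /= invrK.
  have : A <= n%:R by near: n; exact: (cvgry_ge cvgr_idn).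
  by move/le_trans; apply; rewrite lerDl; lra.
have [M M0 bM] := log_ratio_bound e1.
exists M => //.
pose q n := ln (grunwald_coef (- s) n) - (s - 1) * ln (n%:R + s / 2)
    - B / (n%:R + s / 2) ^+ 2.
apply: (@telescoping_rate q (fun n => M / (n%:R + s / 2) ^+ 3)).
- rewrite -[X in _ --> X]subr0; apply: cvgB => //.
  rewrite -(mulr0 B); apply: cvgM; first exact: cvg_cst.
  under eq_fun do rewrite -exprVn.
  rewrite (_ : 0 = 0 ^+ 2); last by rewrite expr0n.
  by rewrite expr2; apply: cvgM.
- rewrite -(mulr0 M); apply: cvgM; first exact: cvg_cst.
  under eq_fun do rewrite -exprVn exprS expr2.
  by rewrite -(mulr0 0) -{2}(mulr0 0); apply: cvgM => //; apply: cvgM.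
- move=> n n2; have s01 : 0 < s < 1 by rewrite s0.
  rewrite (weight_log_increment s01 n2).
  have n0 : 2 <= n%:R :> R by rewrite ler_nat.
  rewrite -[n.+1%:R]natr1 (_ : n%:R + 1 + s / 2 = n%:R + s / 2 + 1); last by ring.
  have a2 : 2 <= n%:R + s / 2 by lra.
  move: (n%:R + s / 2) a2 => a a2.
  have y0 : 0 < (a + 1 / 2)^-1 by rewrite invr_gt0; lra.
  have y2 : `|(a + 1 / 2)^-1| <= 1 / 2.
    by rewrite gtr0_norm// invf_ple ?posrE; lra.
  rewrite (le_trans (bM _ y2))// -mulrBr ler_wpM2l// gtr0_norm//.
  exact: inv_cube_step.
Unshelve. all: by end_near.
Qed.

End weight_asymptotics.


(** * Closed forms of weighted power sums *)

Section closed_forms.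
Context {R : realType}.
Variable alpha : R.
Hypothesis alpha12 : 1 < alpha < 2.
Implicit Types (n : nat) (th : R).

Let pole n : n%:R + 1 - alpha != 0 :> R.
Proof.
case: n => [|n]; case/andP: alpha12 => a1 a2.
  by rewrite add0r lt_eqF//; lra.
by rewrite gt_eqF// -natr1; have : 0 <= n%:R :> R by []; lra.
Qed.

(** The sum at [n + 1] with offset [th] is the sum at [n] with offset [th + 1]
    plus one term, so a closed form is checked by one rational identity. *)
Lemma weighted_sum_closed (phi : R -> R) (F : R -> R -> R) :
  (forall th, phi th = F 0 th) ->
  (forall n th, F n%:R (th + 1) +
     alpha * (alpha - 1) / ((n%:R + 1 - alpha) * (n%:R + 1)) * phi th =
     (n%:R + 2 - alpha) / (n%:R + 1) * F (n%:R + 1) th) ->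
  forall n th, \sum_(j < n.+1) grunwald_coef alpha j * phi (n%:R - j%:R + th) =
    grunwald_coef (alpha - 2) n * F n%:R th.
Proof.
move=> F0 FS; elim=> [|n ih] th.
  by rewrite big_ord1 !grunwald_coef0 !mul1r subrr add0r F0.
rewrite big_ord_recr/= subrr add0r.
under eq_bigr do rewrite -[n.+1%:R]natr1 (addrAC _ 1) -(addrA _ 1 th) (addrC 1).
rewrite ih.
have n1 : n%:R + 1 != 0 :> R by rewrite natr1.
have nz : n%:R + 2 - alpha != 0.
  case/andP: alpha12 => a1 a2; rewrite gt_eqF//.
  by have : 0 <= n%:R :> R by []; lra.
have r1 : grunwald_coef (alpha - 2) n.+1 =
    grunwald_coef (alpha - 2) n * (n%:R + 2 - alpha) / (n%:R + 1).
  by rewrite grunwald_coefS natr1 opprB addrA.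
have g1 : grunwald_coef alpha n.+1 =
    alpha * (alpha - 1) / ((n%:R + 1 - alpha) * (n%:R + 1)) * grunwald_coef (alpha - 2) n.
  have := grunwald_coef_shift alpha n.+1.
  have := grunwald_coef_shift (alpha - 1) n.+1.
  rewrite (_ : alpha - 1 - 1 = alpha - 2); last by ring.
  rewrite r1 -natr1; have := pole n.
  move: (grunwald_coef alpha _) (grunwald_coef (alpha - 1) _) (grunwald_coef _ n).
  move=> A B r p h1 h2; apply: (mulfI p).
  rewrite h2; apply: (mulfI nz).
  rewrite (_ : _ * (- alpha * B) = - alpha * ((n%:R + 1 - (alpha - 1)) * B)); last by ring.
  by rewrite h1; field; rewrite n1 p.
rewrite g1 r1 -[n.+1%:R]natr1.
have := FS n th; move: (grunwald_coef _ n) => r h.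
rewrite -[in RHS]mulrA -[in RHS]mulrA [X in _ = r * X]mulrA -h.
by ring.
Qed.

Let n1 n : n%:R + 1 != 0 :> R. Proof. by rewrite natr1. Qed.

Let pole2 n : n%:R + 1 + 1 - alpha != 0.
Proof.
by case/andP: alpha12 => a1 a2; rewrite gt_eqF//; have : 0 <= n%:R :> R by []; lra.
Qed.

Let a1 : 1 - alpha != 0. Proof. by case/andP: alpha12 => *; rewrite lt_eqF//; lra. Qed.
Let a2 : 2 - alpha != 0. Proof. by case/andP: alpha12 => *; rewrite gt_eqF//; lra. Qed.
Let a3 : 3 - alpha != 0. Proof. by case/andP: alpha12 => *; rewrite gt_eqF//; lra. Qed.
Let a4 : 4 - alpha != 0. Proof. by case/andP: alpha12 => *; rewrite gt_eqF//; lra. Qed.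

(** Summing twice the weights of order [alpha] gives those of order [alpha - 2],
    which are factored out; what remains is a polynomial in [n] and a pole that
    turns the factored weight into the one of order [alpha - 1]. *)
Lemma quadratic_weighted_sum n th :
  \sum_(j < n.+1) grunwald_coef alpha j * ((n%:R - j%:R + th) ^+ 2 / 2) =
  grunwald_coef (alpha - 2) n *
    ((n%:R + 2 - alpha) / (2 - alpha) + (th - 3 / 2)
     + (th - 1) ^+ 2 / 2 * ((1 - alpha) / (n%:R + 1 - alpha))).
Proof.
apply: (@weighted_sum_closed (fun th => th ^+ 2 / 2) (fun x th =>
   (x + 2 - alpha) / (2 - alpha) + (th - 3 / 2)
     + (th - 1) ^+ 2 / 2 * ((1 - alpha) / (x + 1 - alpha))) _ _ n th) => [t|m t].
  by field; rewrite a1 a2.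
field.
by rewrite ?a2 ?a3 ?a4 ?pole ?n1 ?pole2.
Qed.

Lemma cubic_weighted_sum n th :
  \sum_(j < n.+1) grunwald_coef alpha j * ((n%:R - j%:R + th) ^+ 3 / 6) =
  grunwald_coef (alpha - 2) n *
    ((n%:R + 2 - alpha) / (2 - alpha) * ((n%:R + 3 - alpha) / (3 - alpha))
     + (th - 2) * ((n%:R + 2 - alpha) / (2 - alpha))
     + ((th - 1) ^+ 2 / 2 - (th - 1) / 2 + 1 / 6)
     + (th - 1) ^+ 3 / 6 * ((1 - alpha) / (n%:R + 1 - alpha))).
Proof.
apply: (@weighted_sum_closed (fun th => th ^+ 3 / 6) (fun x th =>
    (x + 2 - alpha) / (2 - alpha) * ((x + 3 - alpha) / (3 - alpha))
     + (th - 2) * ((x + 2 - alpha) / (2 - alpha))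
     + ((th - 1) ^+ 2 / 2 - (th - 1) / 2 + 1 / 6)
     + (th - 1) ^+ 3 / 6 * ((1 - alpha) / (x + 1 - alpha))) _ _ n th) => [t|m t].
  by field; rewrite a1 a2 a3.
field.
by rewrite ?a2 ?a3 ?a4 ?pole ?n1 ?pole2.
Qed.

Lemma quartic_weighted_sum n th :
  \sum_(j < n.+1) grunwald_coef alpha j * ((n%:R - j%:R + th) ^+ 4 / 24) =
  grunwald_coef (alpha - 2) n *
    ((n%:R + 2 - alpha) / (2 - alpha) * ((n%:R + 3 - alpha) / (3 - alpha))
       * ((n%:R + 4 - alpha) / (4 - alpha))
     + (th - 5 / 2) * ((n%:R + 2 - alpha) / (2 - alpha) * ((n%:R + 3 - alpha) / (3 - alpha)))
     + ((th - 1) ^+ 2 / 2 - (th - 1) + 7 / 12) * ((n%:R + 2 - alpha) / (2 - alpha))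
     + ((th - 1) ^+ 3 / 6 - (th - 1) ^+ 2 / 4 + (th - 1) / 6 - 1 / 24)
     + (th - 1) ^+ 4 / 24 * ((1 - alpha) / (n%:R + 1 - alpha))).
Proof.
apply: (@weighted_sum_closed (fun th => th ^+ 4 / 24) (fun x th =>
    (x + 2 - alpha) / (2 - alpha) * ((x + 3 - alpha) / (3 - alpha))
       * ((x + 4 - alpha) / (4 - alpha))
     + (th - 5 / 2) * ((x + 2 - alpha) / (2 - alpha) * ((x + 3 - alpha) / (3 - alpha)))
     + ((th - 1) ^+ 2 / 2 - (th - 1) + 7 / 12) * ((x + 2 - alpha) / (2 - alpha))
     + ((th - 1) ^+ 3 / 6 - (th - 1) ^+ 2 / 4 + (th - 1) / 6 - 1 / 24)
     + (th - 1) ^+ 4 / 24 * ((1 - alpha) / (x + 1 - alpha))) _ _ n th) => [t|m t].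
  by field; rewrite a1 a2 a3 a4.
field.
by rewrite ?a2 ?a3 ?a4 ?pole ?n1 ?pole2.
Qed.

End closed_forms.


(** * Splines of the weights *)

Section truncated_power.
Context {R : realType}.
Implicit Types (e u t alpha : R) (r N : nat).

Definition tpow e u : R := if 0 < u then u `^ e else 0.

Lemma tpow_gt0 e u : 0 < u -> tpow e u = u `^ e.
Proof. by rewrite /tpow => ->. Qed.

Lemma tpow_le0 e u : u <= 0 -> tpow e u = 0.
Proof. by rewrite /tpow leNgt; case: (0 < u). Qed.

Lemma tpow_ge0 e u : 0 <= tpow e u.
Proof. by rewrite /tpow; case: ifP => // _; exact: powR_ge0. Qed.

Lemma tpow_exprn r u : (0 < r)%N -> 0 <= u -> tpow r%:R u = u ^+ r.
Proof.
move=> r0; rewrite le_eqVlt => /predU1P[<-|u0].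
  by rewrite tpow_le0// expr0n gtn_eqF.
by rewrite tpow_gt0// powR_mulrn// ltW.
Qed.

Lemma tpowM e (h u : R) : 0 < h -> tpow e (h * u) = h `^ e * tpow e u.
Proof.
move=> h0; rewrite /tpow pmulr_rgt0//; case: ifP => u0; last by rewrite mulr0.
by rewrite powRM ?ltW.
Qed.

Definition spline_sum alpha r N t : R :=
  \sum_(j < N) grunwald_coef alpha j * (tpow r%:R (t - j%:R) / r`!%:R).

Lemma spline_sum_widen alpha r N M t : t <= N%:R -> t <= M%:R ->
  spline_sum alpha r N t = spline_sum alpha r M t.
Proof.
wlog NM : N M / (N <= M)%N.
  by move=> H tN tM; case/orP: (leq_total N M) => h; [exact: H|apply/esym/H].
move=> tN _; rewrite /spline_sum.
rewrite (big_ord_widen M (fun j => grunwald_coef alpha j * (tpow r%:R (t - j%:R) / r`!%:R)) NM).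
rewrite [RHS](bigID (fun j : 'I_M => (j < N)%N))/=.
rewrite [X in _ + X]big1 ?addr0// => j; rewrite -leqNgt => Nj.
by rewrite tpow_le0 ?mul0r ?mulr0// subr_le0 (le_trans tN)// ler_nat.
Qed.

(** The [r + 1]-fold integral of the measure with the Grünwald weights as masses
    at the natural numbers. It approximates the fractional integral kernel
    [t ^ (r - alpha) / Gamma (r + 1 - alpha)]. *)
Definition spline alpha r t := spline_sum alpha r (Num.trunc t).+1 t.

Lemma splineE alpha r N t : t <= N%:R -> spline_sum alpha r N t = spline alpha r t.
Proof.
move=> tN; apply: spline_sum_widen => //.
have [t0|t0] := leP 0 t; first by have /andP[_ /ltW] := truncn_itv t0.
by rewrite (le_trans (ltW t0)).
Qed.

Lemma spline_lt0 alpha r t : t <= 0 -> spline alpha r t = 0.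
Proof. by move=> t0; rewrite -(@splineE _ _ 0)// /spline_sum big_ord0. Qed.

End truncated_power.

Section spline_expansion.
Context {R : realType}.
Variables alpha L : R.
Hypothesis alpha12 : 1 < alpha < 2.
Hypothesis weight_limit : (fun n => ln (grunwald_coef (alpha - 2) n) -
  (1 - alpha) * ln (n%:R + (2 - alpha) / 2)) @ \oo --> L.

Let nu (y : R) := Num.trunc y^-1.
Let th (y : R) := y^-1 - (nu y)%:R.

Let th01 y : 0 < y -> 0 <= th y <= 1.
Proof.
move=> y0; have yV : 0 <= y^-1 by rewrite invr_ge0 ltW.
have /andP[h1 h2] := truncn_itv yV.
by rewrite /th subr_ge0 h1/= lerBlDr addrC natr1 ltW.
Qed.

Let near_nu (m : nat) : \forall y \near (0 : R)^'+, (m <= nu y)%N.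
Proof.
near=> y.
have y0 : 0 < y by near: y; exact: nbhs_right_gt.
rewrite -(ler_nat R); have yV : 0 <= y^-1 by rewrite invr_ge0 ltW.
have /andP[h1 h2] := truncn_itv yV.
rewrite ler_nat -ltnS -(ltr_nat R) (le_lt_trans _ h2)//.
have ym : y < (m%:R + 1)^-1 by near: y; apply: nbhs_right_lt; rewrite invr_gt0.
have : m%:R + 1 <= y^-1.
  by rewrite -[leLHS]invrK lef_pV2 ?posrE ?invr_gt0// ltW.
by apply: le_trans; rewrite lerDl.
Unshelve. all: by end_near. Qed.

Let near_th (K : R) (k : R -> R) : (forall x, 0 <= x <= 1 -> `|k x| <= K) ->
  \forall y \near (0 : R)^'+, `|k (th y)| <= K.
Proof.
move=> kK; near=> y; apply: kK; apply: th01.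
by near: y; exact: nbhs_right_gt.
Unshelve. all: by end_near. Qed.

Let e := 1 - alpha.
Let B := (e - e ^+ 3) / 24.
Let dl (x : R) := x - (2 - alpha) / 2.

(** At [t = 1 / y] the last knot is [nu y]; re-expanding from [nu y] to [t] brings
    in the fractional part [th y]. *)
Lemma expands_weight : expands (fun y => grunwald_coef (alpha - 2) (nu y) * y `^ e)
  (cst (expR L)) (fun y => - expR L * e * dl (th y))
  (fun y => expR L * (e * (e - 1) / 2 * dl (th y) ^+ 2 + B)).
Proof.
case/andP: alpha12 => a1 a2.
have s01 : 0 < 2 - alpha < 1 by apply/andP; split; lra.
have [M M0 HM] : exists2 M : R, 0 <= M & forall n, (2 <= n)%N ->
  `|ln (grunwald_coef (alpha - 2) n) - e * ln (n%:R + (2 - alpha) / 2)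
    - B / (n%:R + (2 - alpha) / 2) ^+ 2 - L| <= M / (n%:R + (2 - alpha) / 2) ^+ 3.
  have := @ln_weight_asymptotics R (2 - alpha) L s01.
  by rewrite opprB (_ : 2 - alpha - 1 = e); [exact|rewrite /e; ring].
have dlb (x : R) : 0 <= x <= 1 -> `|- dl x| <= 1.
  by move=> /andP[? ?]; rewrite normrN /dl ler_norml; apply/andP; split; lra.
have E1 := expands_powR e (near_th (k := fun x => - dl x) dlb).
pose w y := ln (grunwald_coef (alpha - 2) (nu y))
  - e * ln ((nu y)%:R + (2 - alpha) / 2) - L.
have E2 : expands (fun y => expR (w y)) (cst 1) (cst 0) (cst B).
  have [M2 M20 bM2] := powR_taylor0 (R := R) (-2).
  apply: (@expands_expR _ _ (M * 8 + `|B| * M2)).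
  near=> y.
  have y0 : 0 < y by near: y; exact: nbhs_right_gt.
  have n2 : (2 <= nu y)%N by near: y; exact: near_nu.
  have Ny : (nu y)%:R + (2 - alpha) / 2 = y^-1 * (1 + - dl (th y) * y).
    by rewrite /dl /th; field; rewrite gt_eqF.
  have y12 : y < 1 / 2 by near: y; exact: nbhs_right_lt.
  have dly : `|- dl (th y) * y| <= y.
    by rewrite normrM (gtr0_norm y0) ler_piMl ?(ltW y0)// dlb// th01.
  have dly2 : `|- dl (th y) * y| <= 1 / 2 by rewrite (le_trans dly)// ltW.
  have u0 : 1 / 2 <= 1 + - dl (th y) * y.
    by move: dly2; rewrite ler_norml => /andP[? _]; lra.
  have := HM _ n2; rewrite Ny => hM.
  have h1 := bM2 _ dly2.
  rewrite [X in `|X|](_ : _ = (ln (grunwald_coef (alpha - 2) (nu y)) -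
      e * ln (y^-1 * (1 + - dl (th y) * y)) -
      B / (y^-1 * (1 + - dl (th y) * y)) ^+ 2 - L)
     + B * y ^+ 2 * ((1 + - dl (th y) * y) `^ (- 2) - 1)); last first.
    rewrite /w Ny powR_invn; last by lra.
    by field; rewrite !gt_eqF//; lra.
  rewrite (le_trans (ler_normD _ _))// [leRHS]mulrDl lerD//.
    rewrite (le_trans hM)// -mulrA ler_wpM2l//.
    rewrite (_ : 8 * y ^+ 3 = (2 * y) ^+ 3); last by ring.
    rewrite -exprVn lerXn2r ?nnegrE//; first by rewrite invr_ge0 mulr_ge0 ?invr_ge0 ?(ltW y0)//; lra.
      by rewrite mulr_ge0// ltW.
    rewrite invfM invrK mulrC ler_wpM2r ?(ltW y0)// invf_ple ?posrE; lra.
  rewrite 2!normrM normrX (gtr0_norm y0) -!mulrA ler_wpM2l//.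
  rewrite mulrA -expr2 (_ : M2 * y ^+ 3 = y ^+ 2 * (M2 * y)); last by ring.
  rewrite ler_wpM2l ?exprn_ge0 ?(ltW y0)//.
  by rewrite (le_trans h1)// ler_wpM2l// expr1.
have E := expandsZ (expR L) (expandsM E1 E2).
apply: (expands_eq E); near=> y.
have y0 : 0 < y by near: y; exact: nbhs_right_gt.
split => /=; [|ring|ring|ring].
have Ny : (nu y)%:R + (2 - alpha) / 2 = y^-1 * (1 + - dl (th y) * y).
  by rewrite /dl /th; field; rewrite gt_eqF.
have N0 : 0 < (nu y)%:R + (2 - alpha) / 2.
  by have : 0 <= (nu y)%:R :> R by []; lra.
have P0 : 0 < 1 + - dl (th y) * y.
  by move: N0; rewrite Ny pmulr_rgt0// invr_gt0.
have r0 : 0 < grunwald_coef (alpha - 2) (nu y).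
  by rewrite (_ : alpha - 2 = - (2 - alpha)); [apply: grunwald_coef_gt0; lra|ring].
rewrite -[in RHS](lnK (x := grunwald_coef (alpha - 2) (nu y))) ?posrE//.
rewrite /powR !gt_eqF// mulrCA -!expRD; congr expR.
have lnN : ln (y^-1 * (1 + - dl (th y) * y)) = - ln y + ln (1 + - dl (th y) * y).
  by rewrite lnM ?posrE ?invr_gt0// lnV ?posrE.
by rewrite /w Ny lnN; ring.
Unshelve. all: by end_near. Qed.

Let spline_weighted (r : nat) y : (0 < r)%N -> 0 < y ->
  spline alpha r y^-1 =
  \sum_(j < (nu y).+1) grunwald_coef alpha j * (((nu y)%:R - j%:R + th y) ^+ r / r`!%:R).
Proof.
move=> r0 y0; apply: eq_bigr => j _; congr (_ * (_ / _)).
rewrite (_ : (nu y)%:R - j%:R + th y = y^-1 - j%:R); last by rewrite /th; ring.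
apply: tpow_exprn => //; rewrite subr_ge0.
have yV : 0 <= y^-1 by rewrite invr_ge0 ltW.
have /andP[h1 h2] := truncn_itv yV.
by apply: le_trans h1; rewrite ler_nat -ltnS.
Qed.

Let E_X i : i%:R - alpha != 0 ->
  expands (fun y => ((nu y)%:R + i%:R - alpha) / (i%:R - alpha) * y)
    (cst (i%:R - alpha)^-1) (fun y => (i%:R - alpha - th y) / (i%:R - alpha)) (cst 0).
Proof.
move=> ia.
have kb (x : R) : 0 <= x <= 1 -> `|(i%:R - alpha - x) / (i%:R - alpha)| <= (`|i%:R - alpha| + 1) * `|(i%:R - alpha)^-1|.
  move=> /andP[x0 x1]; rewrite normrM ler_wpM2r// (le_trans (ler_normB _ _))//.
  by rewrite lerD// ger0_norm.
apply: (expands_eq (expands_lin (i%:R - alpha)^-1 (near_th (k := fun x => (i%:R - alpha - x) / (i%:R - alpha)) kb))).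
near=> y.
have y0 : 0 < y by near: y; exact: nbhs_right_gt.
split => //; rewrite /th; field.
by rewrite ia gt_eqF.
Unshelve. all: by end_near. Qed.

Let E_P : expands (fun y => (((nu y)%:R + 1 - alpha) * y)^-1)
   (cst 1) (fun y => - (1 - alpha - th y)) (fun y => (1 - alpha - th y) ^+ 2).
Proof.
case/andP: alpha12 => a1 a2.
have kb (x : R) : 0 <= x <= 1 -> `|1 - alpha - x| <= 2.
  by move=> /andP[x0 x1]; rewrite ler_norml; apply/andP; split; lra.
apply: (expands_eq (expands_powR (-1) (near_th (k := fun x => 1 - alpha - x) kb))).
near=> y.
have y0 : 0 < y by near: y; exact: nbhs_right_gt.
have n2 : (2 <= nu y)%N by near: y; exact: near_nu.
have n2' : 2 <= (nu y)%:R :> R by rewrite ler_nat.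
have E0 : 1 + (1 - alpha - th y) * y = ((nu y)%:R + 1 - alpha) * y.
  by rewrite /th; field; rewrite gt_eqF.
have p0 : 0 < (nu y)%:R + 1 - alpha by lra.
split => /=; [|by []|ring|by field].
by rewrite E0 powR_inv1 ?mulr_ge0 ?ltW.
Unshelve. all: by end_near. Qed.

Let E_th (k : R -> R) (K : R) : (forall x, 0 <= x <= 1 -> `|k x| <= K) ->
  expands (fun y => k (th y)) (fun y => k (th y)) (cst 0) (cst 0).
Proof. by move=> kK; apply: expands_bounded (near_th kK). Qed.

Let powR_split (r : nat) y : (0 < r)%N -> 0 < y ->
  y `^ (r%:R - alpha) = y `^ e * y ^+ r.-1.
Proof.
move=> r0 y0; rewrite -powR_mulrn ?ltW// -powRD; last by rewrite (gt_eqF y0) implybT.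
by congr (_ `^ _); rewrite /e -[in LHS](prednK r0) -natr1; ring.
Qed.

Let i2 : 2%:R - alpha != 0. Proof. by case/andP: alpha12 => *; rewrite gt_eqF//; lra. Qed.
Let i3 : 3%:R - alpha != 0. Proof. by case/andP: alpha12 => *; rewrite gt_eqF//; lra. Qed.
Let i4 : 4%:R - alpha != 0. Proof. by case/andP: alpha12 => *; rewrite gt_eqF//; lra. Qed.

Let near_pole : \forall y \near (0 : R)^'+, (nu y)%:R + 1 - alpha != 0.
Proof.
case/andP: alpha12 => a1 a2; near=> y.
have n2 : (2 <= nu y)%N by near: y; exact: near_nu.
have n2' : 2 <= (nu y)%:R :> R by rewrite ler_nat.
by rewrite gt_eqF//; lra.
Unshelve. all: by end_near. Qed.

Let pow_bound (x : R) n : 0 <= x <= 1 -> 0 <= (1 - x) ^+ n <= 1.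
Proof. by move=> /andP[? ?]; rewrite exprn_ge0 ?exprn_ile1//; lra. Qed.

Let last_bound (r : nat) (c x : R) : 1 <= c ->
  0 <= x <= 1 -> `|(x - 1) ^+ r / c * (1 - alpha)| <= 1.
Proof.
case/andP: alpha12 => a1 a2 f1 /andP[x0 x1].
have f0 : 0 < c by lra.
rewrite normrM mulr_ile1//.
  rewrite normrM normfV (gtr0_norm f0) ler_pdivrMr// mul1r (le_trans _ f1)//.
  by rewrite normrX exprn_ile1// ler_norml; apply/andP; split; lra.
by rewrite ler_norml; apply/andP; split; lra.
Qed.

(** The fractional part cancels from all three coefficients: a spline of degree at
    least two feels its knots only in the remainder. *)
Lemma expands_spline2 : expands (fun y => spline alpha 2 y^-1 * y `^ (2%:R - alpha))
  (cst (expR L / (2 - alpha))) (cst (- alpha / 2 * expR L))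
  (cst ((alpha / 24 + alpha ^+ 2 / 8) * ((1 - alpha) * expR L))).
Proof.
have k1 (x : R) : 0 <= x <= 1 -> `|x - 3 / 2| <= 2.
  by move=> /andP[x0 x1]; rewrite ler_norml; apply/andP; split; lra.
have c1 : 1 <= 2 :> R by rewrite ler1n.
have E := expandsM expands_weight
  (expandsD (expandsD (E_X i2) (expandsM (E_th k1) expands_X))
     (expandsM (E_th (fun x => last_bound (x := x) 2 c1)) (expandsM expands_X (expandsM expands_X E_P)))).
apply: (expands_eq E); near=> y.
have y0 : 0 < y by near: y; exact: nbhs_right_gt.
have p0 : (nu y)%:R + 1 - alpha != 0 by near: y; exact: near_pole.
split.
- rewrite spline_weighted// powR_split//= (quadratic_weighted_sum alpha12).
  move: (grunwald_coef _ _) (y `^ e) => r ye; rewrite /=.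
  field.
  by rewrite i2 p0 gt_eqF.
- by rewrite /=; field; rewrite i2.
- by rewrite /= /dl /e; field; rewrite i2.
- by rewrite /= /dl /B /e; field; rewrite i2.
Unshelve. all: by end_near. Qed.

Lemma expands_spline3 : expands (fun y => spline alpha 3 y^-1 * y `^ (3%:R - alpha))
  (cst (expR L / ((2 - alpha) * (3 - alpha)))) (cst (- alpha / 2 * (expR L / (2 - alpha))))
  (cst ((alpha / 24 + alpha ^+ 2 / 8) * expR L)).
Proof.
have k2 (x : R) : 0 <= x <= 1 -> `|x - 2| <= 2.
  by move=> /andP[x0 x1]; rewrite ler_norml; apply/andP; split; lra.
have k1 (x : R) : 0 <= x <= 1 -> `|(x - 1) ^+ 2 / 2 - (x - 1) / 2 + 1 / 6| <= 2.
  move=> x01; have /andP[h1 h2] := pow_bound 2 x01; case/andP: x01 => x0 x1.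
  by rewrite ler_norml; apply/andP; split; lra.
have c1 : 1 <= 6 :> R by rewrite ler1n.
have E := expandsM expands_weight
  (expandsD (expandsD (expandsD (expandsM (E_X i2) (E_X i3))
     (expandsM (E_th k2) (expandsM (E_X i2) expands_X)))
     (expandsM (E_th k1) (expandsM expands_X expands_X)))
     (expandsM (E_th (fun x => last_bound (x := x) 3 c1)) (expandsM expands_X
       (expandsM expands_X (expandsM expands_X E_P))))).
apply: (expands_eq E); near=> y.
have y0 : 0 < y by near: y; exact: nbhs_right_gt.
have p0 : (nu y)%:R + 1 - alpha != 0 by near: y; exact: near_pole.
split.
- rewrite spline_weighted// powR_split//= (cubic_weighted_sum alpha12).
  move: (grunwald_coef _ _) (y `^ e) => r ye; rewrite /=.
  field.
  by rewrite i2 i3 p0 gt_eqF.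
- by rewrite /=; field; rewrite i2 i3.
- by rewrite /= /dl /e; field; rewrite i2 i3.
- by rewrite /= /dl /B /e; field; rewrite i2 i3.
Unshelve. all: by end_near. Qed.

Lemma expands_spline4 : expands (fun y => spline alpha 4 y^-1 * y `^ (4%:R - alpha))
  (cst (expR L / ((2 - alpha) * (3 - alpha) * (4 - alpha))))
  (cst (- alpha / 2 * (expR L / ((2 - alpha) * (3 - alpha)))))
  (cst ((alpha / 24 + alpha ^+ 2 / 8) * (expR L / (2 - alpha)))).
Proof.
have k3 (x : R) : 0 <= x <= 1 -> `|x - 5 / 2| <= 3.
  by move=> /andP[x0 x1]; rewrite ler_norml; apply/andP; split; lra.
have k2 (x : R) : 0 <= x <= 1 -> `|(x - 1) ^+ 2 / 2 - (x - 1) + 7 / 12| <= 3.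
  move=> x01; have /andP[h1 h2] := pow_bound 2 x01; case/andP: x01 => x0 x1.
  by rewrite ler_norml; apply/andP; split; lra.
have k1 (x : R) : 0 <= x <= 1 ->
    `|(x - 1) ^+ 3 / 6 - (x - 1) ^+ 2 / 4 + (x - 1) / 6 - 1 / 24| <= 3.
  move=> x01; have /andP[h1 h2] := pow_bound 2 x01; have /andP[h3 h4] := pow_bound 3 x01.
  by case/andP: x01 => x0 x1; rewrite ler_norml; apply/andP; split; lra.
have c1 : 1 <= 24 :> R by rewrite ler1n.
have E := expandsM expands_weight
  (expandsD (expandsD (expandsD (expandsD (expandsM (expandsM (E_X i2) (E_X i3)) (E_X i4))
     (expandsM (E_th k3) (expandsM (expandsM (E_X i2) (E_X i3)) expands_X)))
     (expandsM (E_th k2) (expandsM (E_X i2) (expandsM expands_X expands_X))))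
     (expandsM (E_th k1) (expandsM expands_X (expandsM expands_X expands_X))))
     (expandsM (E_th (fun x => last_bound (x := x) 4 c1)) (expandsM expands_X
       (expandsM expands_X (expandsM expands_X (expandsM expands_X E_P)))))).
apply: (expands_eq E); near=> y.
have y0 : 0 < y by near: y; exact: nbhs_right_gt.
have p0 : (nu y)%:R + 1 - alpha != 0 by near: y; exact: near_pole.
split.
- rewrite spline_weighted// powR_split//= (quartic_weighted_sum alpha12).
  move: (grunwald_coef _ _) (y `^ e) => r ye; rewrite /=.
  field.
  by rewrite i2 i3 i4 p0 gt_eqF.
- by rewrite /=; field; rewrite i2 i3 i4.
- by rewrite /= /dl /e; field; rewrite i2 i3 i4.
- by rewrite /= /dl /B /e; field; rewrite i2 i3 i4.
Unshelve. all: by end_near. Qed.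

End spline_expansion.

(** Coefficients [Gamma(r + 1 - alpha)^-1] for [r <= 4], written through the
    value at [r = 2] so that [alpha = 2], where those of index [0] and [1]
    vanish, needs no separate treatment. *)
Definition kappa {R : realType} (alpha k2 : R) (r : nat) : R :=
  match r with
  | 0 => k2 * (2 - alpha) * (1 - alpha)
  | 1 => k2 * (2 - alpha)
  | 2 => k2
  | 3 => k2 / (3 - alpha)
  | _ => k2 / ((3 - alpha) * (4 - alpha))
  end.

Definition spline_asymptotics {R : realType} (alpha k2 : R) :=
  forall r : nat, (2 <= r <= 4)%N ->
  expands (fun y => spline alpha r y^-1 * y `^ (r%:R - alpha))
    (cst (kappa alpha k2 r)) (cst (- alpha / 2 * kappa alpha k2 r.-1))
    (cst ((alpha / 24 + alpha ^+ 2 / 8) * kappa alpha k2 r.-2)).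

Section kappa.
Context {R : realType}.
Implicit Types alpha L : R.

Lemma kappaS alpha (k2 : R) (r : nat) : alpha <= 2 -> (r <= 3)%N ->
  kappa alpha k2 r = (r.+1%:R - alpha) * kappa alpha k2 r.+1.
Proof.
move=> a2; have a3 : 3 - alpha != 0 by rewrite gt_eqF//; lra.
have a4 : 4 - alpha != 0 by rewrite gt_eqF//; lra.
case: r => [|[|[|[|//]]]] _ /=; first by ring.
- by rewrite mulrC.
- by field.
- by field; rewrite a3 a4.
Qed.

Lemma spline_asymptotics_lt2 alpha L : 1 < alpha < 2 ->
  (fun n => ln (grunwald_coef (alpha - 2) n) -
    (1 - alpha) * ln (n%:R + (2 - alpha) / 2)) @ \oo --> L ->
  spline_asymptotics alpha (expR L / (2 - alpha)).
Proof.
move=> a12 hL; case/andP: (a12) => a1 a2.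
have i2 : 2 - alpha != 0 by rewrite gt_eqF//; lra.
have i3 : 3 - alpha != 0 by rewrite gt_eqF//; lra.
have i4 : 4 - alpha != 0 by rewrite gt_eqF//; lra.
case=> [|[|[|[|[|//]]]]] // _.
- apply: (expands_eq (expands_spline2 a12 hL)).
  by near=> y; split => //=; field; rewrite ?i2.
- apply: (expands_eq (expands_spline3 a12 hL)).
  by near=> y; split => //=; field; rewrite ?i2 ?i3.
- apply: (expands_eq (expands_spline4 a12 hL)).
  by near=> y; split => //=; field; rewrite ?i2 ?i3 ?i4.
Unshelve. all: by end_near. Qed.

(** At [alpha = 2] the weights are those of the second difference, so the
    splines are polynomials beyond the last knot. *)
Lemma spline_second_difference (r : nat) (t : R) : (0 < r)%N -> 2 <= t ->
  spline 2 r t = (t ^+ r - 2 * (t - 1) ^+ r + (t - 2) ^+ r) / r`!%:R.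
Proof.
have g1 : grunwald_coef (2 : R) 1 = - 2.
  by rewrite grunwald_coefS grunwald_coef0 mul1r sub0r divr1.
have g2 : grunwald_coef (2 : R) 2 = 1 by rewrite grunwald_coefS g1; field.
have g3 n : grunwald_coef (2 : R) (n.+3) = 0.
  by elim: n => [|n ih]; rewrite grunwald_coefS ?ih ?subrr ?mulr0 mul0r// mul0r.
move=> r0 t2; rewrite -(@splineE _ _ _ (3 + Num.trunc t)).
    have t0 : 0 <= t - 0 by lra. have t1 : 0 <= t - 1 by lra. have t3 : 0 <= t - 2 by lra.
    rewrite /spline_sum !big_ord_recl big1 => [|j _]; last first.
      by rewrite !lift0 g3 mul0r.
    rewrite !lift0/= grunwald_coef0 g1 g2 !tpow_exprn//.
    by rewrite subr0; field; rewrite pnatr_eq0 -lt0n fact_gt0.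
  have t0 : 0 <= t by lra.
  have /andP[_ /ltW h] := truncn_itv t0.
  by rewrite (le_trans h)// ler_nat -[X in (X <= _)%N]add1n leq_add2r.
Qed.

Lemma spline_asymptotics_eq2 : spline_asymptotics (2 : R) 1.
Proof.
have near2 : \forall y \near (0 : R)^'+, 0 < y /\ 2 <= y^-1.
  near=> y; have y0 : 0 < y by near: y; exact: nbhs_right_gt.
  split=> //; rewrite -[leLHS]invrK lef_pV2 ?posrE ?invr_gt0//.
  by near: y; apply: nbhs_right_le; rewrite invr_gt0.
move=> [|[|[|[|[|//]]]]] // _; apply: expands_exact; apply: filterS near2 => y [y0 y2];
  rewrite spline_second_difference//.
- rewrite subrr powRr0 (_ : 2`!%:R = 2)//=.
  by field; rewrite gt_eqF.
- rewrite (_ : 3 - 2 = 1 :> R); last by ring.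
  rewrite powRr1 ?ltW// (_ : 3`!%:R = 6)//=.
  by field; rewrite gt_eqF.
- rewrite (_ : 4 - 2 = 2%:R :> R); last by ring.
  rewrite powR_mulrn ?ltW// (_ : 4`!%:R = 24)//=.
  by field; rewrite gt_eqF.
Unshelve. all: by end_near. Qed.

End kappa.


(** * The error kernel *)

Section shifted_expansion.
Context {R : realType}.

Lemma near0r_at_infty (P : R -> Prop) : (\forall y \near (0 : R)^'+, P y) ->
  exists2 T : R, 1 <= T & forall t, T <= t -> P t^-1.
Proof.
move=> [e /= e0 He]; exists (e^-1 + 1) => [|t tT]; first by rewrite lerDr invr_ge0 ltW.
have eV : 0 < e^-1 by rewrite invr_gt0.
have t0 : 0 < t by lra.
apply: He => /=; last by rewrite invr_gt0.
rewrite sub0r normrN gtr0_norm ?invr_gt0// invf_plt ?posrE//; lra.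
Qed.

Lemma near_shifted_inv (k : R) : \forall y \near (0 : R)^'+,
  [/\ 0 < 1 + k * y, 0 < (y^-1 + k)^-1 <= 2 * y &
      (y^-1 + k)^-1 = y * (1 + k * y)^-1].
Proof.
near=> y.
have y0 : 0 < y by near: y; exact: nbhs_right_gt.
have yk : y < (2 * (`|k| + 1))^-1.
  by near: y; apply: nbhs_right_lt; rewrite invr_gt0 mulr_gt0// ltr_wpDl.
have ky : `|k * y| <= 1 / 2.
  rewrite normrM (gtr0_norm y0).
  have : y * (2 * (`|k| + 1)) <= 1.
    by rewrite -ler_pdivlMr ?mul1r ?ltW// mulr_gt0// ltr_wpDl.
  by lra.
have h : 1 / 2 <= 1 + k * y by move: ky; rewrite ler_norml => /andP[? _]; lra.
have h0 : 0 < 1 + k * y by lra.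
have E : (y^-1 + k)^-1 = y * (1 + k * y)^-1.
  by rewrite (_ : y^-1 + k = (1 + k * y) / y) ?invf_div//; field; rewrite gt_eqF.
split => //; rewrite E mulr_gt0 ?invr_gt0//= mulrC ler_wpM2r ?(ltW y0)//.
by rewrite invf_ple ?posrE//; lra.
Unshelve. all: by end_near. Qed.

Lemma expands_shift (phi : R -> R) (a0 a1 a2 k E : R) :
  expands phi (cst a0) (cst a1) (cst a2) ->
  expands (fun y => phi (y^-1 + k)^-1 * (1 + k * y) `^ E)
    (cst a0) (cst (a1 + E * k * a0))
    (cst (a2 - k * a1 + E * k * a1 + E * (E - 1) / 2 * k ^+ 2 * a0)).
Proof.
move=> [M [e /= e0 HM]].
have kk : \forall y \near (0 : R)^'+, `|cst k y| <= `|k| by apply: nearW.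
have E1 := expands_powR E kk.
have E2 := expands_powR (-1) kk.
have E3 : expands (fun y => (y^-1 + k)^-1) (cst 0) (cst 1) (cst (- k)).
  apply: (expands_eq (expandsM expands_X E2)); near=> y.
  have [h0 _ ->] : [/\ 0 < 1 + k * y, 0 < (y^-1 + k)^-1 <= 2 * y &
      (y^-1 + k)^-1 = y * (1 + k * y)^-1] by near: y; exact: near_shifted_inv.
  split => /=; [|ring|ring|ring].
  by rewrite powR_inv1// ltW.
have E4 : expands (fun y => phi (y^-1 + k)^-1) (cst a0) (cst a1) (cst (a2 - k * a1)).
  have EP := expandsD (expandsD (expands_cst a0) (expandsZ a1 E3))
               (expandsZ a2 (expandsM E3 E3)).
  have {}EP : expands (fun y => a0 + a1 * (y^-1 + k)^-1 + a2 * (y^-1 + k)^-1 ^+ 2)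
      (cst a0) (cst a1) (cst (a2 - k * a1)).
    by apply: (expands_eq EP); near=> y; split => /=; ring.
  apply: (expands_approx (K := `|M| * 8) EP); near=> y.
  have y0 : 0 < y by near: y; exact: nbhs_right_gt.
  have [h0 h1 _] : [/\ 0 < 1 + k * y, 0 < (y^-1 + k)^-1 <= 2 * y &
      (y^-1 + k)^-1 = y * (1 + k * y)^-1] by near: y; exact: near_shifted_inv.
  case/andP: h1 => h1 h2.
  have ye : y < e / 2 by near: y; apply: nbhs_right_lt; rewrite divr_gt0.
  have [|_ _ _] := HM (y^-1 + k)^-1 _ h1.
    by rewrite /= sub0r normrN gtr0_norm//; lra.
  move=> /le_trans; apply.
  rewrite -mulrA (le_trans (_ : _ <= `|M| * (y^-1 + k)^-1 ^+ 3))//.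
    by rewrite ler_wpM2r ?exprn_ge0 ?(ltW h1)// ler_norm.
  rewrite ler_wpM2l// (_ : 8 * y ^+ 3 = (2 * y) ^+ 3); last by ring.
  by rewrite lerXn2r ?nnegrE ?(ltW h1)// mulr_ge0// ltW.
apply: (expands_eq (expandsM E4 E1)); near=> y.
by split => //=; ring.
Unshelve. all: by end_near. Qed.

End shifted_expansion.

Section kernel.
Context {R : realType}.
Variables (alpha k2 cm c0 cp dp dq p q : R).

(** Response of the scheme, at unit step, to a derivative of order [r + 1]
    concentrated at distance [t] to the left: truncated powers from the
    fractional derivatives, splines from the Grünwald differences, and [sg] times
    the fractional derivative of order [alpha + 2]. *)
Definition kernel (sg : R) (r : nat) (t : R) : R :=
  kappa alpha k2 r * (cm * tpow (r%:R - alpha) (t - 1) + c0 * tpow (r%:R - alpha) t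
                      + cp * tpow (r%:R - alpha) (t + 1))
  - (dp * spline alpha r (t + p) + dq * spline alpha r (t + q))
  - sg * kappa alpha k2 r.-2 * tpow (r%:R - 2 - alpha) t.

(** Second coefficient of the symbol of the left side minus that of the right. *)
Definition symbol_coef2 : R := (cm + cp) / 2
  - dp * (p ^+ 2 / 2 - p * alpha / 2 + (alpha / 24 + alpha ^+ 2 / 8))
  - dq * (q ^+ 2 / 2 - q * alpha / 2 + (alpha / 24 + alpha ^+ 2 / 8)).

Hypothesis alpha12 : 1 < alpha <= 2.
Hypothesis asym : spline_asymptotics alpha k2.
Hypothesis c_sum : cm + c0 + cp = 1.
Hypothesis d_sum : dp + dq = 1.
Hypothesis first_order : cp - cm = dp * (p - alpha / 2) + dq * (q - alpha / 2).

Let E_tpow (k : R) (E : R) :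
  expands (fun y => tpow E (y^-1 + k) * y `^ E) (cst 1) (cst (E * k))
    (cst (E * (E - 1) / 2 * k ^+ 2)).
Proof.
have kk : \forall y \near (0 : R)^'+, `|cst k y| <= `|k| by apply: nearW.
apply: (expands_eq (expands_powR E kk)); near=> y.
have y0 : 0 < y by near: y; exact: nbhs_right_gt.
have [ky _ _] : [/\ 0 < 1 + k * y, 0 < (y^-1 + k)^-1 <= 2 * y &
    (y^-1 + k)^-1 = y * (1 + k * y)^-1] by near: y; exact: near_shifted_inv.
split => //=.
have Ey : y^-1 + k = y^-1 * (1 + k * y) by field; rewrite gt_eqF.
rewrite Ey tpow_gt0 ?mulr_gt0 ?invr_gt0// -powRM ?mulr_ge0 ?invr_ge0 ?ltW//.
by rewrite mulrAC mulVf ?mul1r// gt_eqF.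
Unshelve. all: by end_near. Qed.

Let E_spline (r : nat) (k : R) : (2 <= r <= 4)%N ->
  expands (fun y => spline alpha r (y^-1 + k) * y `^ (r%:R - alpha))
    (cst (kappa alpha k2 r)) (cst ((k - alpha / 2) * kappa alpha k2 r.-1))
    (cst ((k ^+ 2 / 2 - k * alpha / 2 + (alpha / 24 + alpha ^+ 2 / 8)) * kappa alpha k2 r.-2)).
Proof.
move=> r24; apply: (expands_eq (expands_shift k (r%:R - alpha) (asym r24))).
near=> y.
have y0 : 0 < y by near: y; exact: nbhs_right_gt.
have [ky _ Ek] : [/\ 0 < 1 + k * y, 0 < (y^-1 + k)^-1 <= 2 * y &
    (y^-1 + k)^-1 = y * (1 + k * y)^-1] by near: y; exact: near_shifted_inv.
have a2 : alpha <= 2 by case/andP: alpha12.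
have K1 : kappa alpha k2 r.-1 = (r%:R - alpha) * kappa alpha k2 r.
  by case: r r24 => // r /andP[_ h]; exact: kappaS.
have K2 : kappa alpha k2 r.-2 = (r%:R - 1 - alpha) * kappa alpha k2 r.-1.
  case: r r24 {K1} => [|[|r]]// /andP[_ h].
  by rewrite (@kappaS _ alpha k2 r a2 (ltnW h))//= -[r.+2%:R]natr1 addrK.
split => //=; last 2 first.
- by rewrite K1; ring.
- by rewrite K2 K1; field.
rewrite invrK -mulrA; congr (_ * _).
rewrite Ek -powRM ?mulr_ge0 ?invr_ge0 ?ltW// mulfVK ?gt_eqF//.
Unshelve. all: by end_near. Qed.

(** Order 0 cancels because both families of coefficients sum to 1, order 1 by
    the matching of first moments, order 2 by the choice of [symbol_coef2]. *)
Lemma kernel_expands (r : nat) : (2 <= r <= 4)%N ->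
  expands (fun y => kernel symbol_coef2 r y^-1 * y `^ (r%:R - alpha)) (cst 0) (cst 0) (cst 0).
Proof.
move=> r24; have a2 : alpha <= 2 by case/andP: alpha12.
have K1 : kappa alpha k2 r.-1 = (r%:R - alpha) * kappa alpha k2 r.
  by case: r r24 => // r /andP[_ h]; exact: kappaS.
have K2 : kappa alpha k2 r.-2 = (r%:R - 1 - alpha) * kappa alpha k2 r.-1.
  case: r r24 {K1} => [|[|r]]// /andP[_ h].
  by rewrite (@kappaS _ alpha k2 r a2 (ltnW h))//= -[r.+2%:R]natr1 addrK.
have X2 : expands (fun y : R => y ^+ 2) (cst 0) (cst 0) (cst 1).
  by apply: expands_exact; apply: nearW => y; rewrite mul0r !add0r mul1r.
have T k := E_tpow k (r%:R - alpha).
have S k := E_spline k r24.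
have E := expandsD (expandsD (expandsZ (kappa alpha k2 r)
   (expandsD (expandsD (expandsZ cm (T (-1))) (expandsZ c0 (T 0))) (expandsZ cp (T 1))))
   (expandsZ (-1) (expandsD (expandsZ dp (S p)) (expandsZ dq (S q)))))
   (expandsZ (- (symbol_coef2 * kappa alpha k2 r.-2)) X2).
apply: (expands_eq E); near=> y.
have y0 : 0 < y by near: y; exact: nbhs_right_gt.
split => /=.
- rewrite /kernel addr0 (tpow_gt0 (r%:R - 2 - alpha)) ?invr_gt0//.
  have -> : y ^+ 2 = y^-1 `^ (r%:R - 2 - alpha) * y `^ (r%:R - alpha).
    rewrite -(@powR_inv1 _ y) ?ltW// -powRrM -powRD; last by rewrite (gt_eqF y0) implybT.
    by rewrite -powR_mulrn ?ltW//; congr (_ `^ _); ring.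
  move: (y `^ _) (y^-1 `^ _) (kappa _ _ r) (kappa _ _ r.-2) => A B C D.
  by ring.
- have -> : c0 = 1 - cm - cp by move: c_sum; lra.
  have -> : dq = 1 - dp by move: d_sum; lra.
  by ring.
- rewrite K1 (_ : cp = cm + (dp * (p - alpha / 2) + dq * (q - alpha / 2))); last by move: first_order; lra.
  by ring.
- rewrite K2 K1 /symbol_coef2.
  by field.
Unshelve. all: by end_near. Qed.

Lemma kernel_decay (r : nat) : (2 <= r <= 4)%N -> exists2 M : R, 0 <= M & exists2 T : R, 1 <= T &
  forall t, T <= t -> `|kernel symbol_coef2 r t| <= M * t `^ (r%:R - 3 - alpha).
Proof.
move=> r24; have [M HM] := kernel_expands r24.
have [T T1 HT] := near0r_at_infty HM.
exists `|M| => //; exists T => // t tT.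
have [_ _ _] := HT t tT.
have t0 : 0 < t by lra.
rewrite invrK /= !mul0r !addr0 subr0 normrM (ger0_norm (powR_ge0 _ _)) => h.
rewrite -(@ler_pM2r _ (t^-1 `^ (r%:R - alpha))) ?powR_gt0 ?invr_gt0//.
rewrite (le_trans h)//.
have -> : `|M| * t `^ (r%:R - 3 - alpha) * t^-1 `^ (r%:R - alpha) = `|M| * t^-1 ^+ 3.
  rewrite -mulrA; congr (_ * _).
  rewrite -(@powR_inv1 _ t) ?ltW// -powRrM -powRD; last by rewrite (gt_eqF t0) implybT.
  rewrite powR_inv1 ?ltW// -[RHS]powR_mulrn ?invr_ge0 ?ltW// -powR_inv1 ?ltW// -powRrM.
  by congr (_ `^ _); ring.
by rewrite ler_wpM2r ?ler_norm// exprn_ge0// invr_ge0 ltW.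
Qed.

Lemma kernel_decay0 (r : nat) : (2 <= r <= 4)%N -> exists2 M : R, 0 <= M & exists2 T : R, 1 <= T &
  forall t, T <= t -> `|kernel 0 r t| <= M * t `^ (r%:R - 2 - alpha).
Proof.
move=> r24; have [M M0 [T T1 HT]] := kernel_decay r24.
exists (M + `|symbol_coef2 * kappa alpha k2 r.-2|); first by rewrite addr_ge0.
exists T => // t tT; have t1 : 1 <= t by apply: le_trans tT.
have t0 : 0 < t by lra.
have -> : kernel 0 r t = kernel symbol_coef2 r t + symbol_coef2 * kappa alpha k2 r.-2 * t `^ (r%:R - 2 - alpha).
  by rewrite /kernel (tpow_gt0 (r%:R - 2 - alpha) t0); ring.
rewrite (le_trans (ler_normD _ _))// [leRHS]mulrDl lerD//; last first.
  by rewrite normrM (ger0_norm (powR_ge0 _ _)).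
rewrite (le_trans (HT t tT))// ler_wpM2l// ler_powR//; lra.
Qed.

Lemma tpow_le (E t T : R) : 0 <= E -> t <= T -> 0 <= T -> tpow E t <= T `^ E.
Proof.
move=> E0 tT T0; have [t0|t0] := leP t 0; first by rewrite tpow_le0// powR_ge0.
by rewrite tpow_gt0// ge0_ler_powR// nnegrE// ltW.
Qed.

Lemma spline_bounded (r : nat) (T : R) : 0 <= T -> exists2 A : R, 0 <= A &
  forall t, t <= T -> `|spline alpha r t| <= A.
Proof.
move=> T0; pose N := (Num.trunc T).+1.
exists (\sum_(j < N) `|grunwald_coef alpha j| * (T `^ r%:R / r`!%:R)).
  by apply: sumr_ge0 => j _; rewrite !mulr_ge0 ?powR_ge0 ?invr_ge0.
move=> t tT; have /andP[_ /ltW TN] := truncn_itv T0.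
rewrite -(splineE _ _ (le_trans tT TN)) (le_trans (ler_norm_sum _ _ _))//.
apply: ler_sum => j _; rewrite normrM ler_wpM2l// ger0_norm; last first.
  by rewrite divr_ge0// tpow_ge0.
rewrite ler_wpM2r ?invr_ge0//; apply: tpow_le => //.
by rewrite (le_trans _ tT)// lerBlDr lerDl.
Qed.

Hypothesis p1 : p <= 1.
Hypothesis q1 : q <= 1.

Lemma kernel_support (sg : R) (r : nat) (t : R) : t < -1 -> kernel sg r t = 0.
Proof.
move=> t1; rewrite /kernel !tpow_le0; [|lra..].
have h1 : t + p <= 0 by move: p1; lra.
have h2 : t + q <= 0 by move: q1; lra.
by rewrite (spline_lt0 _ _ h1) (spline_lt0 _ _ h2); ring.
Qed.

(** Beyond the last knot all terms are polynomials in [t], of degree at most one. *)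
Lemma kernel_second_difference (sg : R) (r : nat) (t : R) : alpha = 2 -> k2 = 1 -> (2 <= r <= 3)%N ->
  ((r == 2)%N -> sg = 0) -> 2 - p <= t -> 2 - q <= t -> 1 < t -> kernel sg r t = 0.
Proof.
move=> al k1 r23 sg0 pt qt t1; rewrite /kernel al k1.
have hp : 2 <= t + p by lra.
have hq : 2 <= t + q by lra.
rewrite !(spline_second_difference _ hp) ?(spline_second_difference _ hq)//; last 2 first.
- by case/andP: r23 => /ltnW.
- by case/andP: r23 => /ltnW.
move: first_order; rewrite al => fo.
have t10 : 0 < t - 1 by lra. have t0 : 0 < t by lra. have t11 : 0 < t + 1 by lra.
case: r r23 sg0 => [|[|[|[|//]]]]// _ sg0; last rewrite /kappa.
  rewrite sg0//= subrr !mul0r subr0 !tpow_gt0// !powRr0 !mulr1 mul1r c_sum.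
  rewrite (_ : 2`!%:R = 2)//.
  have -> : dq = 1 - dp by move: d_sum; lra.
  by field.
rewrite (_ : 3%:R - 2 = 1 :> R); last by ring.
rewrite !tpow_gt0// !powRr1 ?ltW// (_ : 3`!%:R = 6)//.
have -> : c0 = 1 - cm - cp by move: c_sum; lra.
have -> : cp = cm + (dp * (p - 2 / 2) + dq * (q - 2 / 2)) by move: fo; lra.
have -> : dq = 1 - dp by move: d_sum; lra.
by rewrite /=; field.
Qed.

(** The first moment of the kernel is dominated by a bump, which absorbs the
    singularity of order [1 - alpha] at [0], and by the homogeneous tail
    [t ^ (1 - alpha)]. That tail is not integrable at [0] when [alpha = 2], but
    then the kernel has compact support and the tail drops out. *)
Lemma kernel_moment_bound (sg : R) (r : nat) : (2 <= r <= 3)%N -> ((r == 2)%N -> sg = 0) ->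
  (alpha = 2 -> k2 = 1) ->
  (exists2 M : R, 0 <= M & exists2 T : R, 1 <= T &
     forall t, T <= t -> `|kernel sg r t| <= M * t `^ (- alpha)) ->
  exists A M T : R, [/\ 0 <= A, 0 <= M, 1 <= T, alpha = 2 -> M = 0 & forall t,
    `|t| * `|kernel sg r t| <= A * (tpow 0 (t + T) - tpow 0 (t - T)) + M * tpow (1 - alpha) t].
Proof.
move=> r23 sg0 ak [M0' M0'0 [T' T'1 HT']].
case/andP: alpha12 => a1 a2.
have [M [T [M0 T1 aM HT]]] : exists M T : R, [/\ 0 <= M, 1 < T, alpha = 2 -> M = 0 &
    forall t, T <= t -> `|kernel sg r t| <= M * t `^ (- alpha)].
  have [al|al] := eqVneq alpha 2.
    exists 0, (4 + `|p| + `|q|).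
    have := ler_norm (- p); have := ler_norm (- q); rewrite !normrN => hq hp.
    have := normr_ge0 p; have := normr_ge0 q => hq0 hp0.
    split => //; first by lra.
    move=> t tT; have pt : 2 - p <= t by lra.
    have qt : 2 - q <= t by lra.
    have t1 : 1 < t by lra.
    by rewrite (kernel_second_difference al (ak al) r23 sg0 pt qt t1) normr0 mul0r.
  exists M0', (T' + 1); split => //; first by lra.
    by move=> /eqP; rewrite (negbTE al).
  by move=> t tT; apply: HT'; lra.
have T0 : 0 <= T by lra.
have T10 : 0 <= T + 1 by lra.
have [A A0 HA] := spline_bounded r T10.
have rE : 0 <= r%:R - alpha.
  by case/andP: r23 => r2 _; rewrite subr_ge0 (le_trans a2)// ler_nat.
pose B := `|kappa alpha k2 r| * ((`|cm| + `|c0| + `|cp|) * (T + 1) `^ (r%:R - alpha))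
   + (`|dp| + `|dq|) * A.
have B0 : 0 <= B by rewrite !(addr_ge0, mulr_ge0)// powR_ge0.
pose S : R := `|sg * kappa alpha k2 r.-2|.
have S0 : 0 <= S by exact: normr_ge0.
have loc t : t <= T -> `|kernel sg r t| <= B + S * tpow (1 - alpha) t.
  move=> tT; rewrite /kernel (le_trans (ler_normB _ _))// lerD//; last first.
    rewrite normrM (ger0_norm (tpow_ge0 _ _)).
    case: r r23 sg0 {HA rE B B0 HT HT' S0} @S => [|[|[|[|//]]]]// _ sg0 S.
      by rewrite sg0// /S sg0// mul0r normr0 !mul0r.
    by rewrite (_ : 3%:R - 2 - alpha = 1 - alpha :> R)//; ring.
  rewrite (le_trans (ler_normB _ _))// lerD//.
    rewrite normrM ler_wpM2l//.
    have tb k : k <= 1 -> `|tpow (r%:R - alpha) (t + k)| <= (T + 1) `^ (r%:R - alpha).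
      by move=> k1; rewrite ger0_norm ?tpow_ge0// tpow_le//; lra.
    have tb1 := tb 1 (lexx _).
    have tb0 : `|tpow (r%:R - alpha) t| <= (T + 1) `^ (r%:R - alpha).
      by have := tb 0 ler01; rewrite addr0.
    have tbm : `|tpow (r%:R - alpha) (t - 1)| <= (T + 1) `^ (r%:R - alpha).
      by apply: tb; lra.
    rewrite !mulrDl (le_trans (ler_normD _ _))// lerD//; last by rewrite normrM ler_wpM2l.
    by rewrite (le_trans (ler_normD _ _))// lerD// normrM ler_wpM2l.
  rewrite mulrDl (le_trans (ler_normD _ _))// lerD// normrM ler_wpM2l// HA//; move: p1 q1; lra.
exists (T * B + S * T `^ (2 - alpha)), M, T.
have C0 : 0 <= T * B + S * T `^ (2 - alpha) by rewrite addr_ge0// mulr_ge0// powR_ge0.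
split => //; first by lra.
move=> t; have [tT|tT] := leP T t.
  have t0 : 0 < t by lra.
  have tT0 : 0 < t + T by lra.
  rewrite (tpow_gt0 0 tT0) (tpow_gt0 (1 - alpha) t0) powRr0.
  have tail : `|t| * `|kernel sg r t| <= M * t `^ (1 - alpha).
    rewrite gtr0_norm// (le_trans (ler_wpM2l (ltW t0) (HT t tT)))//.
    by rewrite powRD ?(gt_eqF t0) ?implybT// powRr1 ?(ltW t0)// mulrCA.
  rewrite (le_trans tail)// lerDr mulr_ge0// /tpow; case: ifP => _; rewrite ?powRr0 ?subrr// subr0.
have [tm|tm] := ltP t (-1).
  rewrite kernel_support// normr0 mulr0 addr_ge0// mulr_ge0// ?tpow_ge0//.
  by rewrite (tpow_le0 0 (_ : t - T <= 0)) ?subr0 ?tpow_ge0//; lra.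
have tT0 : 0 < t + T by lra.
rewrite (tpow_gt0 0 tT0) powRr0 (tpow_le0 0 (_ : t - T <= 0)); last by lra.
rewrite subr0 mulr1 -[leLHS]addr0 lerD ?mulr_ge0 ?tpow_ge0//.
have nT : `|t| <= T by rewrite ler_norml; apply/andP; split; lra.
rewrite (le_trans (ler_wpM2l (normr_ge0 _) (loc t (ltW tT))))// mulrDr lerD//.
  by rewrite ler_wpM2r.
rewrite mulrCA ler_wpM2l//.
have [tn|tp] := leP t 0; first by rewrite tpow_le0// mulr0 powR_ge0.
rewrite tpow_gt0// gtr0_norm// -{1}(powRr1 (ltW tp)) -powRD ?(gt_eqF tp) ?implybT//.
rewrite (_ : 1 + (1 - alpha) = 2 - alpha); last by ring.
by rewrite ge0_ler_powR// ?nnegrE; lra.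
Qed.

End kernel.


(** * Second coefficient of the symbol *)

Section symbol.
Context {R : realType}.
Implicit Types (z gam alpha : R) (p : int).

(** Coefficients of the [k]-th derivative of [(1 - exp (- z)) / z]. *)
Definition symbol_series (k n : nat) : R := (-1) ^+ (n + k) / (n`!%:R * (n + k).+1%:R).

Lemma symbol_series_diffs k : pseries_diffs (symbol_series k) = symbol_series k.+1.
Proof.
apply/funext => n; rewrite /pseries_diffs /symbol_series addSn addnS factS natrM.
have h1 : n.+1%:R != 0 :> R by []. have h2 : n`!%:R != 0 :> R by rewrite pnatr_eq0 -lt0n fact_gt0.
have h3 : (n + k).+2%:R != 0 :> R by [].
move: h1 h2 h3; move: (n.+1%:R : R) (n`!%:R : R) ((n + k).+2%:R : R) => A B C a b c.
by field; rewrite a b c.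
Qed.

Lemma symbol_series_cvg k z : cvgn (pseries (symbol_series k) z).
Proof.
apply: normed_cvg.
apply: (series_le_cvg (v_ := exp_coeff `|z|)) => [n|n|n|].
- exact: normr_ge0.
- exact: exp_coeff_ge0.
- rewrite /= normrM normrX exp_coeffE ler_wpM2r ?exprn_ge0//.
  rewrite /symbol_series normrM normrX normrN normr1 expr1n mul1r.
  have f0 : 0 < n`!%:R :> R by rewrite ltr0n fact_gt0.
  have k0 : 0 < (n + k).+1%:R :> R by [].
  rewrite normfV gtr0_norm ?mulr_gt0// lef_pV2 ?posrE ?mulr_gt0//.
  by rewrite ler_peMr ?(ltW f0)// ler1n.
- exact: is_cvg_series_exp_coeff.
Qed.

Definition symbol_derivative k z : R := limn (pseries (symbol_series k) z).

Lemma is_derive_symbol k z :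
  is_derive z 1 (symbol_derivative k) (symbol_derivative k.+1 z).
Proof.
rewrite /symbol_derivative -symbol_series_diffs.
apply: (@pseries_snd_diffs _ _ (`|z| + 1)); rewrite ?symbol_series_diffs.
- exact: symbol_series_cvg.
- exact: symbol_series_cvg.
- exact: symbol_series_cvg.
- by rewrite [ltRHS]ger0_norm// ltrDl.
Qed.

Lemma symbol_derivative_at0 k : symbol_derivative k 0 = (-1) ^+ k / k.+1%:R.
Proof.
apply/cvg_lim => //; apply: cvg_near_cst; near=> n.
have n0 : (0 < n)%N by near: n; exact: nbhs_infty_gt.
rewrite /pseries /series/= -(prednK n0) big_nat_recl// expr0 mulr1 big1.
  by rewrite addr0 /symbol_series add0n fact0 mul1r.
by move=> i _; rewrite expr0n mulr0.
Unshelve. all: by end_near. Qed.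

(** The power series removes the singularity at [0], where derivatives are needed. *)
Lemma backward_symbolE : backward_symbol = symbol_derivative 0 :> (R -> R).
Proof.
apply/funext => z; rewrite /backward_symbol; case: eqP => [->|/eqP z0].
  by rewrite symbol_derivative_at0 expr0 divr1.
apply/esym/cvg_lim => //.
have E n : (1 - series (exp_coeff (- z)) n.+1) / z = pseries (symbol_series 0) z n.
  rewrite /pseries /series/= big_nat_recl// exp_coeffE /= expr0 fact0 invr1 mulr1 opprD addrA subrr add0r.
  rewrite mulrC mulrN -mulNr mulr_sumr; apply: eq_bigr => i _.
  rewrite /symbol_series addn0 [(- z) ^+ i.+1]exprNn (exprS (-1)) [z ^+ i.+1]exprS factS natrM.
  have h1 : i.+1%:R != 0 :> R by []. have h2 : i`!%:R != 0 :> R by rewrite pnatr_eq0 -lt0n fact_gt0.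
  move: h1 h2; move: (i.+1%:R : R) (i`!%:R : R) => A B a b.
  by field; rewrite a b z0.
rewrite (_ : pseries _ z = fun n => (1 - series (exp_coeff (- z)) n.+1) / z); last first.
  by apply/funext => n; rewrite E.
apply: cvgM; last exact: cvg_cst.
apply: cvgB; first exact: cvg_cst.
have := is_cvg_series_exp_coeff (- z).
by rewrite -(cvg_shiftS (series (exp_coeff (- z)))).
Qed.

Let is_derive_expZ (k z : R) : is_derive z 1 (fun z => expR (k * z)) (k * expR (k * z)).
Proof.
have h : is_derive z 1 (fun z : R => k * z) k.
  by apply: is_derive_eq; rewrite /GRing.scale/=; ring.
have := @is_derive1_comp _ (@expR R) (fun z : R => k * z) z _ _ (is_derive_expR _) h.
by move/is_derive_eq; apply; rewrite mulrC.
Qed.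

Let is_derive_pow (E z : R) : 0 < symbol_derivative 0 z ->
  is_derive z 1 (fun z => symbol_derivative 0 z `^ E)
    (E * symbol_derivative 0 z `^ (E - 1) * symbol_derivative 1 z).
Proof.
move=> h0.
exact: (@is_derive1_comp _ (fun x : R => x `^ E) (symbol_derivative 0) z _ _
  (is_derive1_powR E h0) (is_derive_symbol 0 z)).
Qed.

Lemma a2E alpha gam p :
  a2 alpha gam p = gam ^+ 2 / 2 - p%:~R ^+ 2 / 2 + p%:~R * alpha / 2
                   - (alpha / 24 + alpha ^+ 2 / 8).
Proof.
rewrite /a2; set P := p%:~R : R.
have pos : \forall z \near (0 : R), 0 < symbol_derivative 0 z.
  have c0 : {for 0, continuous (symbol_derivative 0)}.
    by apply/differentiable_continuous/derivable1_diffP/ex_derive; exact: is_derive_symbol.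
  have : 0 < symbol_derivative 0 (0 : R) by rewrite symbol_derivative_at0 expr0 divr1.
  by move=> h; exact: (cvgr_gt _ c0 _ h).
have errE : error_symbol alpha gam p =
    fun z => expR (gam * z) - expR (P * z) * symbol_derivative 0 z `^ alpha.
  by apply/funext => z; rewrite /error_symbol backward_symbolE.
pose d1 z := gam * expR (gam * z) - (expR (P * z) *
     (alpha * symbol_derivative 0 z `^ (alpha - 1) * symbol_derivative 1 z)
   + symbol_derivative 0 z `^ alpha * (P * expR (P * z))).
have D1 : \forall z \near (0 : R), derive1 (error_symbol alpha gam p) z = d1 z.
  rewrite errE; near=> z.
  have z0 : 0 < symbol_derivative 0 z by near: z.
  have h1 := is_derive_expZ gam z; have h2 := is_derive_expZ P z.
  have h3 := is_derive_pow alpha z0.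
  by rewrite derive1E; have /@derive_val -> := is_deriveB h1 (is_deriveM h2 h3).
have s0 : symbol_derivative 0 (0 : R) = 1 by rewrite symbol_derivative_at0 expr0 divr1.
have s1 : symbol_derivative 1 (0 : R) = - 1 / 2 by rewrite symbol_derivative_at0 expr1.
have s2 : symbol_derivative 2 (0 : R) = 1 / 3 by rewrite symbol_derivative_at0 sqrrN expr1n.
have D2 : is_derive (0 : R) 1 d1 (gam ^+ 2 - (P ^+ 2 - P * alpha + alpha * (alpha - 1) / 4 + alpha / 3)).
  have p0 : 0 < symbol_derivative 0 (0 : R) by rewrite s0.
  have h1 := is_derive_expZ gam 0; have h2 := is_derive_expZ P 0.
  have h3 := is_derive_pow alpha p0. have h4 := is_derive_pow (alpha - 1) p0.
  have h5 := is_derive_symbol 1 (0 : R).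
  have h6 := is_deriveB (is_deriveZ gam h1)
     (is_deriveD (is_deriveM h2 (is_deriveM (is_deriveZ alpha h4) h5))
                 (is_deriveM h3 (is_deriveZ P h2))).
  apply: (@is_derive_eq _ _ _ _ _ _ _ _ h6); rewrite /GRing.scale/=.
  rewrite [(_ * symbol_derivative 1) 0](_ : _ =
    alpha * symbol_derivative 0 0 `^ (alpha - 1) * symbol_derivative 1 0)//.
  rewrite !mulr0 expR0 s0 s1 s2 !powR1 !mulr1 /GRing.scale/= !mulr1.
  by field.
rewrite derive1nS derive1n1 derive1E (near_eq_derive _ D1)//.
have /@derive_val -> := D2.
by rewrite (_ : 2`!%:R = 2)//; field.
Unshelve. all: by end_near. Qed.

End symbol.


(** * The Gamma integral and the limit of the weights *)

Lemma cvg_invS2 (R : realType) : (n.+2%:R)^-1 @[n --> \oo] --> (0 : R).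
Proof.
apply/cvgrVy; first by near=> n; rewrite invr_gt0.
apply/cvgryPge => A; near=> n; rewrite /= invrK.
have : A <= n%:R by near: n; exact: (cvgry_ge cvgr_idn).
by move/le_trans; apply; rewrite ler_nat -addn2 leq_addr.
Unshelve. all: by end_near. Qed.

Section tangent_lines.
Context {R : realType}.

(** Young's inequality with one factor equal to [1]; the converse inequality for
    [E >= 1] is this one for the inverse power. *)
Lemma powR_tangent_le (E u : R) : 0 < E -> E <= 1 -> 0 <= u -> u `^ E <= 1 + E * (u - 1).
Proof.
move=> E0; rewrite le_eqVlt => /predU1P[->|E1] u0; first by rewrite powRr1//; lra.
have E1' : 0 < 1 - E by lra.
have := @conjugate_powR R (u `^ E) 1 E^-1 (1 - E)^-1.
rewrite powR_ge0 ler01 !invr_gt0 E0 E1' !invrK addrC subrK => /(_ erefl erefl erefl erefl erefl).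
rewrite -powRrM mulfV ?gt_eqF// powRr1// powR1; lra.
Qed.

Lemma powR_tangent_ge (E u : R) : 1 <= E -> 0 <= u -> 1 + E * (u - 1) <= u `^ E.
Proof.
move=> E1 u0; have E0 : 0 < E by lra.
have h : E^-1 <= 1 by rewrite invf_le1.
have := powR_tangent_le (eq_ind_r _ E0 (invr_gt0 E)) h (powR_ge0 u E).
rewrite -powRrM mulfV ?gt_eqF// powRr1// => H.
have := ler_wpM2l (ltW E0) H; rewrite mulrDr mulrA mulfV ?gt_eqF//; lra.
Qed.

End tangent_lines.

Section real_integrals.
Context {R : realType}.
Implicit Types r : R.

Lemma powRD_gt0 (x r s : R) : 0 < x -> x `^ (r + s) = x `^ r * x `^ s.
Proof. by move=> x0; rewrite powRD// (gt_eqF x0) implybT. Qed.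

Context {d : measure_display} {T : measurableType d} (mu : {measure set T -> \bar R}).
Variables (A : set T) (mA : measurable A).
Implicit Types f g : T -> R.

Lemma integrableZl_real r f : mu.-integrable A (EFin \o f) ->
  mu.-integrable A (EFin \o (fun x => r * f x)).
Proof. by move=> fi; exact: (integrableZl mA r fi). Qed.

Lemma integrableD_real f g : mu.-integrable A (EFin \o f) -> mu.-integrable A (EFin \o g) ->
  mu.-integrable A (EFin \o (fun x => f x + g x)).
Proof. by move=> fi gi; exact: (integrableD mA fi gi). Qed.

Lemma integrableB_real f g : mu.-integrable A (EFin \o f) -> mu.-integrable A (EFin \o g) ->
  mu.-integrable A (EFin \o (fun x => f x - g x)).
Proof. by move=> fi gi; exact: (integrableB mA fi gi). Qed.

End real_integrals.

Section gamma.
Context {R : realType}.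
Local Notation mu := (@lebesgue_measure R).
Implicit Types (f F : R -> R) (a b x s t e : R).

Lemma FTC2_is_derive F f a b : a < b ->
  (forall x, a <= x <= b -> is_derive x 1 F (f x)) ->
  (forall x, a <= x <= b -> {for x, continuous f}) ->
  (\int[mu]_(x in `[a, b]) (f x)%:E = (F b - F a)%:E)%E.
Proof.
move=> ab dF cf.
have cF x : a <= x <= b -> {for x, continuous F}.
  by move=> /dF h; apply/differentiable_continuous/derivable1_diffP/ex_derive.
rewrite EFinB; apply: continuous_FTC2 => //.
- by apply: continuous_in_subspaceT => x; rewrite inE/= in_itv/=; exact: cf.
- split.
  + move=> x; rewrite in_itv/= => /andP[/ltW ax /ltW xb]; apply: ex_derive.
    by apply: dF; rewrite ax.
  + by apply: cvg_at_right_filter; apply: cF; rewrite lexx ltW.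
  + by apply: cvg_at_left_filter; apply: cF; rewrite lexx ltW.
- move=> x; rewrite in_itv/= => /andP[/ltW ax /ltW xb].
  have axb : a <= x <= b by rewrite ax.
  by rewrite derive1E; have /@derive_val -> := dF _ axb.
Qed.

Let exhaust (i : nat) : set R := `[(i.+2%:R)^-1, i.+2%:R]%classic.

Lemma exhaust_positive_itv : \bigcup_i exhaust i = `]0, +oo[%classic.
Proof.
apply/seteqP; split => [t [i _]|t]; rewrite /exhaust /= !in_itv/= ?andbT.
  by move=> /andP[+ _]; apply: lt_le_trans; rewrite invr_gt0.
move=> t0; pose M := Num.max t t^-1.
have M0 : 0 <= M by rewrite le_max ltW.
have /andP[_ MN] := truncn_itv M0.
exists (Num.trunc M) => //; rewrite /exhaust /= in_itv/=; apply/andP; split.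
  rewrite -[leRHS]invrK lef_pV2 ?posrE ?invr_gt0//.
  by rewrite (le_trans _ (_ : (Num.trunc M).+1%:R <= _)) ?ler_nat// (le_trans _ (ltW MN))// le_max lexx orbT.
by rewrite (le_trans _ (_ : (Num.trunc M).+1%:R <= _)) ?ler_nat// (le_trans _ (ltW MN))// le_max lexx.
Qed.

Lemma exhaust_homo : {homo exhaust :
  n m / (n <= m)%N >-> (n <= m)%O}.
Proof.
move=> n m nm; apply/subsetPset => t; rewrite /exhaust /= !in_itv/= => /andP[h1 h2].
apply/andP; split; first by apply: le_trans h1; rewrite lef_pV2 ?posrE// ler_nat !ltnS.
by apply: (le_trans h2); rewrite ler_nat !ltnS.
Qed.

Definition gamma_integrand x t : R := t `^ x * expR (- t).

Lemma gamma_integrand_ge0 x t : 0 <= gamma_integrand x t.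
Proof. by rewrite mulr_ge0 ?powR_ge0 ?expR_ge0. Qed.

Lemma measurable_gamma_integrand x (D : set R) : measurable_fun D (gamma_integrand x).
Proof.
apply: measurable_funTS; apply: measurable_funM; first exact: measurable_powR.
apply: measurableT_comp; first exact: measurable_expR.
exact: measurable_funN.
Qed.

Lemma is_derive_gamma_integrand x t : 0 < t ->
  is_derive t 1 (gamma_integrand x) (x * gamma_integrand (x - 1) t - gamma_integrand x t).
Proof.
move=> t0; have h1 := is_derive1_powR x t0.
have h2 : is_derive t 1 (fun t : R => expR (- t)) (- expR (- t)).
  have hN : is_derive t 1 (fun t : R => - t) (- 1) by apply: is_derive_eq.
  have := @is_derive1_comp _ (@expR R) (fun t : R => - t) t _ _ (is_derive_expR _) hN.
  by move/is_derive_eq; apply; rewrite mulrN1.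
have h3 := is_deriveM h1 h2.
by apply: (@is_derive_eq _ _ _ _ _ _ _ _ h3); rewrite /gamma_integrand /GRing.scale/=; ring.
Qed.

Lemma continuous_gamma_integrand x t : 0 < t -> {for t, continuous (gamma_integrand x)}.
Proof.
move=> t0; apply/differentiable_continuous/derivable1_diffP/ex_derive.
exact: is_derive_gamma_integrand.
Qed.

Lemma gamma_exhaust x :
  (\int[mu]_(t in exhaust i) (gamma_integrand x t)%:E)%E @[i --> \oo] -->
  (\int[mu]_(t in `]0%R, +oo[) (gamma_integrand x t)%:E)%E.
Proof.
rewrite -exhaust_positive_itv.
have := @ge0_nondecreasing_set_cvg_integral _ (measurableTypeR R) R exhaust (EFin \o gamma_integrand x) mu.
apply.
- exact: exhaust_homo.
- by move=> i; exact: measurable_itv.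
- by move=> i; apply/measurable_EFinP; exact: measurable_gamma_integrand.
- by move=> i t _; rewrite lee_fin gamma_integrand_ge0.
Qed.

Let gamma_integrand_small (x : R) : 0 < x ->
  gamma_integrand x (n.+2%:R)^-1 @[n --> \oo] --> (0 : R).
Proof.
move=> x0.
have h : (n.+2%:R)^-1 `^ x @[n --> \oo] --> (0 : R).
  have /cvg_at_rightP/(_ (fun n => (n.+2%:R)^-1)) := powR_cvg0 x0.
  by apply; split => [n|]; [rewrite invr_gt0|exact: (@cvg_invS2 R)].
apply: (squeeze_cvgr _ (cvg_cst 0) h); near=> n.
by rewrite gamma_integrand_ge0/= /gamma_integrand ler_piMr ?powR_ge0// expR_le1 oppr_le0.
Unshelve. all: by end_near. Qed.

Let gamma_integrand_large (x : R) : 0 < x ->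
  gamma_integrand x n.+2%:R @[n --> \oo] --> (0 : R).
Proof.
move=> x0.
have h : expR (x * ln (2 * x)) * (2 * (n.+2%:R)^-1) @[n --> \oo] --> (0 : R).
  rewrite (_ : 0 = expR (x * ln (2 * x)) * (2 * 0)); last by rewrite !mulr0.
  by apply: cvgM; [exact: cvg_cst|apply: cvgM; [exact: cvg_cst|exact: (@cvg_invS2 R)]].
apply: (squeeze_cvgr _ (cvg_cst 0) h); near=> n.
rewrite gamma_integrand_ge0/= /gamma_integrand.
have N0 : 0 < n.+2%:R :> R by [].
move: (n.+2%:R : R) N0 => N N0.
have x2 : 0 < 2 * x by rewrite mulr_gt0.
have lnN : ln N <= N / (2 * x) + ln (2 * x).
  rewrite -[leLHS](_ : ln (N / (2 * x) * (2 * x)) = _); last by rewrite divfK ?gt_eqF.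
  rewrite lnM ?posrE ?divr_gt0// lerD2r.
  by rewrite ltW// ln_sublinear// divr_gt0.
have xlnN : x * ln N - N <= x * ln (2 * x) - N / 2.
  have : x * ln N <= x * (N / (2 * x) + ln (2 * x)) by rewrite ler_wpM2l// ltW.
  rewrite (_ : x * (_ + _) = N / 2 + x * ln (2 * x)); last by field; rewrite gt_eqF.
  lra.
rewrite /powR gt_eqF// -expRD (le_trans (_ : _ <= expR (x * ln (2 * x) - N / 2))) ?ler_expR//.
rewrite expRD ler_wpM2l ?expR_ge0// expRN invf_ple ?posrE ?expR_gt0 ?divr_gt0// invf_div.
by rewrite (le_trans _ (expR_ge1Dx _))// lerDr.
Unshelve. all: by end_near. Qed.

Let integrable_exhaust x i : mu.-integrable (exhaust i) (EFin \o gamma_integrand x).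
Proof.
apply: continuous_compact_integrable; first exact: segment_compact.
apply: continuous_in_subspaceT => t; rewrite inE /exhaust/= in_itv/= => /andP[ti _].
by apply: continuous_gamma_integrand; apply: lt_le_trans ti; rewrite invr_gt0.
Qed.

(** Integration by parts on compact segments of the positive axis. *)
Lemma gamma_recursion x : 0 < x ->
  (\int[mu]_(t in `]0%R, +oo[) (gamma_integrand x t)%:E =
   x%:E * \int[mu]_(t in `]0%R, +oo[) (gamma_integrand (x - 1) t)%:E)%E.
Proof.
move=> x0.
have E i : (\int[mu]_(t in exhaust i) (gamma_integrand x t)%:E +
    (gamma_integrand x i.+2%:R - gamma_integrand x (i.+2%:R)^-1)%:E =
   x%:E * \int[mu]_(t in exhaust i) (gamma_integrand (x - 1) t)%:E)%E.
  have i1 : (i.+2%:R)^-1 < i.+2%:R :> R.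
    by rewrite (@lt_le_trans _ _ 1)// ?invf_lt1// ?ltr1n// ler1n.
  have pos t : (i.+2%:R)^-1 <= t <= i.+2%:R -> 0 < t.
    by move=> /andP[+ _]; apply: lt_le_trans; rewrite invr_gt0.
  have <- : (\int[mu]_(t in exhaust i) (x * gamma_integrand (x - 1) t - gamma_integrand x t)%:E =
      (gamma_integrand x i.+2%:R - gamma_integrand x (i.+2%:R)^-1)%:E)%E.
    apply: (@FTC2_is_derive (gamma_integrand x)
      (fun t => x * gamma_integrand (x - 1) t - gamma_integrand x t) _ _ i1).
    + by move=> t /pos; exact: is_derive_gamma_integrand.
    + move=> t /pos t0; apply: cvgB; last exact: continuous_gamma_integrand.
      by apply: cvgM; [exact: cvg_cst|exact: continuous_gamma_integrand].
  have -> : (\int[mu]_(t in exhaust i) (x * gamma_integrand (x - 1) t - gamma_integrand x t)%:E =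
     x%:E * \int[mu]_(t in exhaust i) (gamma_integrand (x - 1) t)%:E
     - \int[mu]_(t in exhaust i) (gamma_integrand x t)%:E)%E.
    have mE : measurable (exhaust i) by exact: measurable_itv.
    rewrite -integralZl//; last exact: integrable_exhaust.
    rewrite -integralB//; last exact: integrable_exhaust.
    by apply: integrableZl => //; exact: integrable_exhaust.
  rewrite addeC subeK//.
  by apply: integrable_fin_num; [exact: measurable_itv|exact: integrable_exhaust].
have L : (x%:E * \int[mu]_(t in exhaust i) (gamma_integrand (x - 1) t)%:E)%E
    @[i --> \oo] --> (x%:E * \int[mu]_(t in `]0%R, +oo[) (gamma_integrand (x - 1) t)%:E)%E.
  by apply: cvgeZl => //; exact: gamma_exhaust.
apply: (cvg_unique (@ereal_hausdorff R) _ L) => /=.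
rewrite (_ : (fun i => x%:E * _)%E = fun i : nat => (\int[mu]_(t in exhaust i) (gamma_integrand x t)%:E +
    (gamma_integrand x i.+2%:R - gamma_integrand x (i.+2%:R)^-1)%:E)%E); last first.
  by apply/funext => i; rewrite E.
rewrite -[X in _ --> X]adde0; apply: cvgeD => //.
- by rewrite fin_num_adde_defl.
- exact: gamma_exhaust.
- apply: cvg_EFin; first by near=> n.
  rewrite -(subrr 0); apply: cvgB; first exact: gamma_integrand_large.
  exact: gamma_integrand_small.
Unshelve. all: by end_near. Qed.

Lemma gamma_integrand0 : (\int[mu]_(t in `]0%R, +oo[) (gamma_integrand 0 t)%:E = 1)%E.
Proof.
have E i : (\int[mu]_(t in exhaust i) (gamma_integrand 0 t)%:E =
    (expR (- (i.+2%:R)^-1) - expR (- i.+2%:R))%:E)%E.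
  have i1 : (i.+2%:R)^-1 < i.+2%:R :> R.
    by rewrite (@lt_le_trans _ _ 1)// ?invf_lt1// ?ltr1n// ler1n.
  have -> : expR (- (i.+2%:R)^-1) - expR (- i.+2%:R) =
     (fun t => - expR (- t)) i.+2%:R - (fun t => - expR (- t)) (i.+2%:R)^-1 :> R by ring.
  apply: (@FTC2_is_derive (fun t => - expR (- t)) (gamma_integrand 0) _ _ i1) => t /andP[h1 h2].
    have hN : is_derive t 1 (fun t : R => - t) (- 1) by apply: is_derive_eq.
    have := is_deriveN (@is_derive1_comp _ (@expR R) (fun t : R => - t) t _ _ (is_derive_expR _) hN).
    by move/is_derive_eq; apply; rewrite /gamma_integrand powRr0; ring.
  by apply: continuous_gamma_integrand; apply: lt_le_trans h1; rewrite invr_gt0.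
apply: (cvg_unique (@ereal_hausdorff R) (@gamma_exhaust 0)) => /=.
rewrite (_ : (fun i : nat => _) = fun i : nat => (expR (- (i.+2%:R)^-1) - expR (- i.+2%:R))%:E); last first.
  by apply/funext => i; rewrite E.
apply: cvg_EFin; first by near=> n.
have h1 : expR (- (n.+2%:R)^-1) @[n --> \oo] --> (1 : R).
  have h0 : - (n.+2%:R)^-1 @[n --> \oo] --> (0 : R) by rewrite -oppr0; apply: cvgN; exact: (@cvg_invS2 R).
  have := continuous_cvg _ (@continuous_expR R 0) h0.
  by rewrite expR0; apply.
have h2 : expR (- n.+2%:R) @[n --> \oo] --> (0 : R).
  apply: (squeeze_cvgr _ (cvg_cst 0) (@cvg_invS2 R)); near=> n.
  rewrite expR_ge0/= expRN lef_pV2 ?posrE ?expR_gt0//.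
  by rewrite (le_trans _ (expR_ge1Dx _))// lerDr.
have := cvgB h1 h2; rewrite subr0.
exact.
Unshelve. all: by end_near. Qed.

(** [gamma_int x] is [Gamma (x + 1)]. *)
Definition gamma_int x : R := \int[mu]_(t in `]0%R, +oo[) gamma_integrand x t.

Let gam_ge0 x : (0 <= \int[mu]_(t in `]0%R, +oo[) (gamma_integrand x t)%:E)%E.
Proof. by apply: integral_ge0 => t _; rewrite lee_fin gamma_integrand_ge0. Qed.

Let gamma_integrable_fin x :
  (\int[mu]_(t in `]0%R, +oo[) (gamma_integrand x t)%:E \is a fin_num)%E ->
  mu.-integrable `]0%R, +oo[ (EFin \o gamma_integrand x).
Proof.
move=> fin; apply/integrableP; split.
  by apply/measurable_EFinP; exact: measurable_gamma_integrand.
under eq_integral do rewrite /= ger0_norm ?gamma_integrand_ge0//.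
by move: fin; rewrite fin_numE => /andP[_ ?]; rewrite ltey.
Qed.

Lemma gamma_integrable_nat n : mu.-integrable `]0%R, +oo[ (EFin \o gamma_integrand n%:R).
Proof.
apply: gamma_integrable_fin; elim: n => [|n ih]; first by rewrite gamma_integrand0.
by rewrite gamma_recursion// -[n.+1%:R]natr1 addrK fin_numM.
Qed.

(** Positive exponents are dominated by integer ones; one step of the recursion
    then reaches the exponents above [-1]. *)
Lemma gamma_integrable x : -1 < x -> mu.-integrable `]0%R, +oo[ (EFin \o gamma_integrand x).
Proof.
have pos y : 0 < y -> mu.-integrable `]0%R, +oo[ (EFin \o gamma_integrand y).
  move=> y0; have yge0 := ltW y0; have /andP[_ yN] := truncn_itv yge0.
  set N := (Num.trunc y).+1 in yN.
  apply: (@le_integrable _ _ _ mu _ _ _ ((EFin \o gamma_integrand 0%:R) \+ (EFin \o gamma_integrand N%:R))%E).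
  - exact: measurable_itv.
  - by apply/measurable_EFinP; exact: measurable_gamma_integrand.
  - move=> t; rewrite /= in_itv/= andbT => t0.
    rewrite lee_fin ger0_norm ?gamma_integrand_ge0//.
    rewrite ger0_norm ?addr_ge0 ?gamma_integrand_ge0// /gamma_integrand -mulrDl ler_wpM2r ?expR_ge0//.
    have [t1|t1] := leP t 1.
      by rewrite (le_trans (_ : _ <= t `^ 0%:R)) ?lerDl ?powR_ge0// ger_powR ?t0// ltW.
    by rewrite (le_trans (_ : _ <= t `^ N%:R)) ?lerDr ?powR_ge0// ler_powR ?ltW.
  - by apply: integrableD; [exact: measurable_itv|exact: gamma_integrable_nat..].
move=> x1; apply: gamma_integrable_fin.
have x10 : 0 < x + 1 by lra.
have : (\int[mu]_(t in `]0%R, +oo[) (gamma_integrand (x + 1) t)%:E)%E \is a fin_num.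
  by apply: integrable_fin_num; [exact: measurable_itv|exact: pos].
rewrite gamma_recursion// addrK.
have := gam_ge0 x; case: (\int[mu]_(t in _) _)%E => // _.
by rewrite gt0_muley.
Qed.

Lemma gamma_intS x : 0 < x -> gamma_int x = x * gamma_int (x - 1).
Proof.
move=> x0; rewrite /gamma_int /Rintegral gamma_recursion// fineM//.
apply: integrable_fin_num; [exact: measurable_itv|apply: gamma_integrable; lra].
Qed.

Lemma gamma_int_nat n : gamma_int n%:R = n`!%:R.
Proof.
elim: n => [|n ih]; first by rewrite /gamma_int /Rintegral gamma_integrand0.
by rewrite gamma_intS// -[n.+1%:R]natr1 addrK ih factS natrM natr1.
Qed.

Lemma gamma_int_affine (n : nat) (c d : R) :
  let G := fun t => t `^ n%:R * (c + d * t) * expR (- t) in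
  mu.-integrable `]0%R, +oo[ (EFin \o G) /\
  \int[mu]_(t in `]0%R, +oo[) G t = n`!%:R * (c + d * n.+1%:R).
Proof.
move=> G; have mE : measurable (`]0, +oo[%classic : set (measurableTypeR R)).
  exact: measurable_itv.
have i0 := gamma_integrable_nat n; have i1 := gamma_integrable_nat n.+1.
have j0 := integrableZl_real mE c i0; have j1 := integrableZl_real mE d i1.
have GE t : t \in (`]0, +oo[%classic : set R) ->
    c * gamma_integrand n%:R t + d * gamma_integrand n.+1%:R t = G t.
  rewrite inE/= in_itv/= andbT /gamma_integrand /G => t0.
  by rewrite -[n.+1%:R]natr1 (powRD_gt0 n%:R 1 t0) powRr1 ?(ltW t0)//; ring.
split.
  apply: eq_integrable (integrableD_real mE j0 j1) => // t tE.
  by rewrite /= GE.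
have <- := eq_Rintegral mu GE.
rewrite (RintegralD mE j0 j1) (RintegralZl _ mE i0) (RintegralZl _ mE i1).
by rewrite -!/(gamma_int _) !gamma_int_nat factS natrM; ring.
Qed.

(** Comparison with a function that is affine up to the weight: only the two
    integrals [n!] and [(n + 1)!] enter, and they are explicit. *)
Lemma gamma_int_affine_le (n : nat) x (c d : R) : -1 < x ->
  (forall t, 0 < t -> t `^ x <= t `^ n%:R * (c + d * t)) ->
  gamma_int x <= n`!%:R * (c + d * n.+1%:R).
Proof.
move=> x1 h; have [iG <-] := gamma_int_affine n c d.
apply: le_Rintegral => //; first exact: gamma_integrable.
move=> t; rewrite /= in_itv/= andbT => t0.
by rewrite /gamma_integrand ler_wpM2r ?expR_ge0 ?h.
Qed.

Lemma gamma_int_affine_ge (n : nat) x (c d : R) : -1 < x ->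
  (forall t, 0 < t -> t `^ n%:R * (c + d * t) <= t `^ x) ->
  n`!%:R * (c + d * n.+1%:R) <= gamma_int x.
Proof.
move=> x1 h; have [iG <-] := gamma_int_affine n c d.
apply: le_Rintegral => //; first exact: gamma_integrable.
move=> t; rewrite /= in_itv/= andbT => t0.
by rewrite /gamma_integrand ler_wpM2r ?expR_ge0 ?h.
Qed.

(** Tangent lines of the concave [t^s] at [n] and of the convex [t^(s - 1)] at
    [n + 1], integrated against the weights [t^(n - 1) exp (- t)] and
    [t^n exp (- t)], of which they match the mean. *)
Lemma gamma_int_bounds (s : R) (n : nat) : 0 < s < 1 -> (0 < n)%N ->
  n.+1%:R `^ (s - 1) * n`!%:R <= gamma_int (n%:R + s - 1) <= n%:R `^ (s - 1) * n`!%:R.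
Proof.
move=> /andP[s0 s1] n0.
have x1 : -1 < n%:R + s - 1 by have : 0 <= n%:R :> R by []; lra.
have n0' : 0 < n%:R :> R by rewrite ltr0n.
apply/andP; split.
  have m0 : 0 < n.+1%:R :> R by [].
  have -> : n.+1%:R `^ (s - 1) * n`!%:R = n`!%:R *
    (n.+1%:R `^ (s - 1) * (2 - s) + (n.+1%:R `^ (s - 1) * (s - 1) / n.+1%:R) * n.+1%:R).
    by field; rewrite gt_eqF.
  apply: gamma_int_affine_ge => // t t0.
  move: (n.+1%:R : R) m0 => m m0.
  rewrite (_ : n%:R + s - 1 = n%:R + (s - 1)); last by ring.
  rewrite (powRD_gt0 n%:R (s - 1) t0) ler_wpM2l ?powR_ge0//.
  have -> : m `^ (s - 1) * (2 - s) + m `^ (s - 1) * (s - 1) / m * t =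
     m `^ (s - 1) * (1 + (s - 1) * (t / m - 1)) by field; rewrite gt_eqF.
  have -> : t `^ (s - 1) = m `^ (s - 1) * (t / m) `^ (s - 1).
    by rewrite -powRM ?divr_ge0 ?ltW// mulrCA divff ?mulr1// gt_eqF.
  rewrite ler_wpM2l ?powR_ge0//.
  have u0 : 0 < t / m by rewrite divr_gt0.
  move: (t / m) u0 => u u0.
  rewrite /powR gt_eqF// (le_trans _ (expR_ge1Dx _))// lerD2l ler_nM2l; last by lra.
  by have := @le_ln1Dx R (u - 1); rewrite subrKC; apply; lra.
case: n n0 n0' x1 => // n _ m0 x1.
have -> : n.+1%:R `^ (s - 1) * n.+1`!%:R =
  n`!%:R * (n.+1%:R `^ s * (1 - s) + (n.+1%:R `^ s * s / n.+1%:R) * n.+1%:R).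
  rewrite factS natrM (powRD_gt0 s (- 1) m0) powR_inv1 ?(ltW m0)//.
  by field; rewrite gt_eqF.
apply: gamma_int_affine_le => // t t0.
rewrite (_ : n.+1%:R + s - 1 = n%:R + s); last by rewrite -natr1; ring.
rewrite (powRD_gt0 n%:R s t0) ler_wpM2l ?powR_ge0//.
move: (n.+1%:R : R) m0 => m m0.
have -> : m `^ s * (1 - s) + m `^ s * s / m * t =
   m `^ s * (s * (t / m) + (1 - s)) by field; rewrite gt_eqF.
have -> : t `^ s = m `^ s * (t / m) `^ s.
  by rewrite -powRM ?divr_ge0 ?ltW// mulrCA divff ?mulr1// gt_eqF.
rewrite ler_wpM2l ?powR_ge0//.
have u0 : 0 < t / m by rewrite divr_gt0.
move: (t / m) u0 => u u0.
by have := powR_tangent_le s0 (ltW s1) (ltW u0); lra.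
Qed.

Lemma gamma_int_weight (s : R) (n : nat) : 0 < s ->
  gamma_int (n%:R + s - 1) = grunwald_coef (- s) n * n`!%:R * gamma_int (s - 1).
Proof.
move=> s0; elim: n => [|n ih]; first by rewrite add0r grunwald_coef0 fact0 !mul1r.
have ns0 : 0 < n%:R + s by rewrite ltr_wpDl.
rewrite (_ : n.+1%:R + s - 1 = n%:R + s); last by rewrite -natr1; ring.
rewrite gamma_intS// ih grunwald_coefS factS natrM opprK -natr1.
have n1 : n%:R + 1 != 0 :> R by rewrite natr1.
move: (grunwald_coef _ _) (gamma_int _) (n`!%:R : R) => A B C.
by field.
Qed.

Lemma gamma_int_gt0 (s : R) : 0 < s < 1 -> 0 < gamma_int (s - 1).
Proof.
move=> s01; case/andP: (s01) => s0 s1.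
have /andP[+ _] := gamma_int_bounds s01 (isT : (0 < 1)%N).
rewrite gamma_int_weight// !mulr1 => h.
have : 0 < grunwald_coef (- s) 1 * gamma_int (s - 1).
  by apply: lt_le_trans h; rewrite powR_gt0.
by rewrite pmulr_rgt0// grunwald_coef_gt0.
Qed.

(** The weight is [Gamma (n + s) / (n! Gamma s)], and [gamma_int_bounds] squeezes
    the quotient [Gamma (n + s) / n!]. *)
Lemma ln_weight_limit (s : R) : 0 < s < 1 ->
  (fun n => ln (grunwald_coef (- s) n) - (s - 1) * ln (n%:R + s / 2)) @ \oo -->
  - ln (gamma_int (s - 1)).
Proof.
move=> s01; case/andP: (s01) => s0 s1.
have g0 := gamma_int_gt0 s01.
have h0 : (1 - s) * (2 * (n%:R)^-1) @[n --> \oo] --> (0 : R).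
  rewrite (_ : 0 = (1 - s) * (2 * 0)); last by rewrite !mulr0.
  apply: cvgM; first exact: cvg_cst.
  apply: cvgM; first exact: cvg_cst.
  apply/cvgrVy; first by near=> n; rewrite invr_gt0 ltr0n; near: n; exact: nbhs_infty_gt.
  by apply: cvg_trans cvgr_idn; apply: near_eq_cvg; near=> n; rewrite /= invrK.
have cl (n : nat) : (0 < n)%N ->
    `|- ln (gamma_int (s - 1)) - (ln (grunwald_coef (- s) n) - (s - 1) * ln (n%:R + s / 2))|
    <= (1 - s) * (2 * (n%:R)^-1).
  move=> n0; have n0' : 0 < n%:R :> R by rewrite ltr0n.
  have r0 := grunwald_coef_gt0 n s0.
  have f0 : 0 < n`!%:R :> R by rewrite ltr0n fact_gt0.
  have := gamma_int_bounds s01 n0.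
  rewrite gamma_int_weight//.
  move: (grunwald_coef _ _) (gamma_int _) g0 r0 => r G G0 r0.
  rewrite (mulrAC r) !ler_pM2r// => /andP[].
  have ns0 : 0 < n%:R + s / 2 by lra.
  have rG0 : 0 < r * G by rewrite mulr_gt0.
  have lnr : ln (r * G) = ln r + ln G by rewrite lnM ?posrE.
  move=> h1' h2'.
  have h1 : (s - 1) * ln n.+1%:R <= ln r + ln G by rewrite -lnr -ln_powR ler_ln ?posrE ?powR_gt0.
  have h2 : ln r + ln G <= (s - 1) * ln n%:R by rewrite -lnr -ln_powR ler_ln ?posrE ?powR_gt0.
  have l1 : ln n%:R <= ln (n%:R + s / 2) by rewrite ler_ln ?posrE//; lra.
  have l2 : ln (n%:R + s / 2) <= ln n.+1%:R by rewrite ler_ln ?posrE// -[n.+1%:R]natr1; lra.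
  have l3 : ln n.+1%:R <= ln n%:R + (n%:R)^-1 :> R.
    rewrite -[n.+1%:R]natr1 (_ : n%:R + 1 = n%:R * (1 + (n%:R)^-1)); last by field; rewrite gt_eqF.
    have i0 : 0 < (n%:R)^-1 :> R by rewrite invr_gt0.
    rewrite lnM ?posrE ?addr_gt0// lerD2l le_ln1Dx//; lra.
  have m1 : (1 - s) * ln (n%:R + s / 2) <= (1 - s) * ln n.+1%:R by rewrite ler_wpM2l//; lra.
  have m2 : (1 - s) * ln n%:R <= (1 - s) * ln (n%:R + s / 2) by rewrite ler_wpM2l//; lra.
  have m3 : (1 - s) * ln n.+1%:R <= (1 - s) * (ln n%:R + (n%:R)^-1) by rewrite ler_wpM2l//; lra.
  have m4 : 0 <= (1 - s) * (n%:R)^-1 by rewrite mulr_ge0 ?invr_ge0//; lra.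
  rewrite ler_norml; apply/andP; split; lra.
apply/cvgrPdist_le => e e0.
have /cvgrPdist_le/(_ _ e0) := h0; apply: filterS2 (nbhs_infty_gt 0) => n n0.
rewrite distrC subr0 => /(le_trans (ler_norm _)).
exact: le_trans (cl n n0).
Unshelve. all: by end_near. Qed.

End gamma.


(** * One-sided derivatives on a segment *)

Section one_sided_derivative.
Context {R : realType}.
Variables a b : R.
Hypothesis ab : a < b.
Implicit Types (f g : R -> R) (x y l : R).

(** [D a b f x = l] together with existence of the limit, see [hasD_cvg]; this form
    is the convenient one for estimates. *)
Definition hasD f x l := forall e : R, 0 < e -> exists2 d : R, 0 < d &
  forall y, a <= y <= b -> `|y - x| < d -> `|f y - f x - l * (y - x)| <= e * `|y - x|.

Let quot f x y := (f y - f x) / (y - x).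

Lemma within_dnbhs_proper x : a <= x <= b -> ProperFilter (within `[a, b] x^').
Proof.
move=> /andP[ax xb]; apply: Build_ProperFilter => -[d /= d0 Hd].
have [xb'|xb'] := ltP x b.
- pose y := x + Num.min d (b - x) / 2.
  have m0 : 0 < Num.min d (b - x) by rewrite lt_min d0 subr_gt0.
  have m1 : Num.min d (b - x) <= d by rewrite ge_min lexx.
  have m2 : Num.min d (b - x) <= b - x by rewrite ge_min lexx orbT.
  apply: (Hd y) => /=.
  + by rewrite /y opprD addrA subrr sub0r normrN gtr0_norm ?divr_gt0//; lra.
  + by rewrite /y gt_eqF// ltrDl divr_gt0.
  + by rewrite in_itv/= /y; apply/andP; split; lra.
- pose y := x - Num.min d (x - a) / 2.
  have xa : a < x by apply: lt_le_trans xb'.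
  have m0 : 0 < Num.min d (x - a) by rewrite lt_min d0 subr_gt0.
  have m1 : Num.min d (x - a) <= d by rewrite ge_min lexx.
  have m2 : Num.min d (x - a) <= x - a by rewrite ge_min lexx orbT.
  apply: (Hd y) => /=.
  + by rewrite /y opprB addrA addrAC subrr add0r gtr0_norm ?divr_gt0//; lra.
  + by rewrite /y lt_eqF// gtrBl divr_gt0.
  + by rewrite in_itv/= /y; apply/andP; split; lra.
Qed.

Lemma hasD_cvg f x l : hasD f x l <-> quot f x y @[y --> within `[a, b] x^'] --> l.
Proof.
split=> [H|].
  apply/cvgrPdist_le => e e0; have [d d0 Hd] := H e e0.
  exists d => //= y /= yd yx; rewrite in_itv/= => yab.
  have yx0 : y - x != 0 by rewrite subr_eq0.
  rewrite distrC in yd; have := Hd y yab yd.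
  rewrite [X in `|X| <= _](_ : _ = (quot f x y - l) * (y - x)); last first.
    by rewrite /quot mulrBl divfK.
  by rewrite normrM ler_pM2r ?normr_gt0// distrC.
move=> /cvgrPdist_le H e e0; have [d /= d0 Hd] := H e e0.
exists d => // y yab yd; have [->|yx] := eqVneq y x.
  by rewrite !subrr mulr0 subrr normr0 mulr0.
have yx0 : y - x != 0 by rewrite subr_eq0.
have := Hd y; rewrite /= distrC => /(_ yd yx); rewrite in_itv/= => /(_ yab).
rewrite distrC -(@ler_pM2r _ `|y - x|) ?normr_gt0// -normrM.
by rewrite mulrBl /quot divfK// (distrC x).
Qed.

Lemma hasD_derivable f x l : a <= x <= b -> hasD f x l ->
  derivable_ab a b f x /\ D a b f x = l.
Proof.
move=> xab /hasD_cvg h; have PF := within_dnbhs_proper xab.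
split; first by apply/cvg_ex; exists l.
exact: (cvg_lim _ h).
Qed.

Lemma derivable_hasD f x : derivable_ab a b f x -> hasD f x (D a b f x).
Proof. by move=> h; apply/hasD_cvg. Qed.

Lemma hasD_ext f g x l : a <= x <= b -> (forall y, a <= y <= b -> f y = g y) ->
  hasD f x l -> hasD g x l.
Proof.
move=> xab E H e e0; have [d d0 Hd] := H e e0; exists d => // y yab yd.
by rewrite -!E//; exact: Hd.
Qed.

Lemma hasDZ f x l k : hasD f x l -> hasD (fun y => k * f y) x (k * l).
Proof.
move=> H e e0; have k0 : 0 < `|k| + 1 by rewrite ltr_wpDl.
have [d d0 Hd] := H (e / (`|k| + 1)) (divr_gt0 e0 k0); exists d => // y yab yd.
rewrite [X in `|X|](_ : _ = k * (f y - f x - l * (y - x))); last by ring.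
rewrite normrM (le_trans (ler_wpM2l (normr_ge0 k) (Hd y yab yd)))//.
rewrite mulrA ler_wpM2r// mulrCA ler_piMr ?(ltW e0)// ler_pdivrMr// mul1r lerDl.
exact: ler01.
Qed.

Lemma hasD_lipschitz f x l : hasD f x l -> exists d M : R, [/\ 0 < d, 0 <= M &
  forall y, a <= y <= b -> `|y - x| < d -> `|f y - f x| <= M * `|y - x|].
Proof.
move=> H; have [d d0 Hd] := H 1 ltr01; exists d, (1 + `|l|); split => //; try by rewrite addr_ge0.
move=> y yab yd; rewrite (_ : f y - f x = (f y - f x - l * (y - x)) + l * (y - x)); last by ring.
by rewrite (le_trans (ler_normD _ _))// mulrDl lerD ?normrM// (le_trans (Hd y yab yd)).
Qed.

Lemma hasDM f g x l m : a <= x <= b -> hasD f x l -> hasD g x m ->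
  hasD (fun y => f y * g y) x (l * g x + f x * m).
Proof.
move=> xab hf hg; have PF := within_dnbhs_proper xab.
have cf : f y @[y --> within `[a, b] x^'] --> f x.
  have [d [M [d0 M0 HM]]] := hasD_lipschitz hf.
  apply/cvgrPdist_le => e e0.
  exists (Num.min d (e / (M + 1))) => /=; first by rewrite lt_min d0 divr_gt0// ltr_wpDl.
  move=> y /=; rewrite distrC lt_min => /andP[yd ye] _; rewrite in_itv/= => yab.
  rewrite distrC (le_trans (HM y yab yd))//.
  have : `|y - x| * (M + 1) <= e by rewrite -ler_pdivlMr ?ltW// ltr_wpDl.
  have : 0 <= `|y - x| by [].
  lra.
move/hasD_cvg: hf => hf; move/hasD_cvg: hg => hg; apply/hasD_cvg.
rewrite (_ : quot _ x = fun y => quot f x y * g x + f y * quot g x y); last first.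
  by apply/funext => y; rewrite /quot; ring.
by apply: cvgD; [apply: cvgM => //; exact: cvg_cst|exact: cvgM].
Qed.

Lemma is_derive_hasD f x l : is_derive x 1 f l -> hasD f x l.
Proof.
move=> [dfx <-] e e0.
have /cvgrPdist_le/(_ e e0)[d /= d0 Hd] := dfx; exists d => // y _ yd.
have [->|yx] := eqVneq y x; first by rewrite !subrr mulr0 subrr normr0 mulr0.
have yx0 : y - x != 0 by rewrite subr_eq0.
have := Hd (y - x); rewrite /= sub0r normrN => /(_ yd yx0).
rewrite /GRing.scale/= mulr1 subrK -(@ler_pM2r _ `|y - x|) ?normr_gt0// -normrM mulrBl.
by rewrite mulrAC mulVf// mul1r distrC.
Qed.

Lemma hasD_is_derive f x l : a < x < b -> hasD f x l -> is_derive x 1 f l.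
Proof.
move=> /andP[ax xb] H.
have h : h^-1 *: (f (h *: 1 + x) - f x) @[h --> (0 : R)^'] --> l.
  apply/cvgrPdist_le => e e0; have [d d0 Hd] := H e e0.
  exists (Num.min d (Num.min (x - a) (b - x))) => /=.
    by rewrite !lt_min d0 !subr_gt0 ax xb.
  move=> h /=; rewrite sub0r normrN !lt_min => /andP[hd /andP[ha hb]] h0.
  rewrite /GRing.scale/= mulr1.
  have hxab : a <= h + x <= b.
    by move: ha hb; rewrite !ltr_norml => /andP[? ?] /andP[? ?]; apply/andP; split; lra.
  have := Hd (h + x) hxab; rewrite addrK => /(_ hd).
  rewrite -(@ler_pM2l _ `|h|^-1) ?invr_gt0 ?normr_gt0// mulrCA mulVf ?normr_eq0// mulr1.
  rewrite -normfV -normrM distrC mulrBr (mulrCA _ l) mulVf// mulr1.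
  by [].
apply: DeriveDef; first by apply/cvg_ex; exists l.
exact: (cvg_lim _ h).
Qed.

Lemma hasD_continuous f g : (forall x, a <= x <= b -> hasD f x (g x)) ->
  {within `[a, b], continuous f}.
Proof.
move=> H; apply/subspace_continuousP => x; rewrite /= in_itv/= => xab.
have [d [M [d0 M0 HM]]] := hasD_lipschitz (H x xab).
apply/cvgrPdist_le => e e0.
exists (Num.min d (e / (M + 1))) => /=.
  by rewrite lt_min d0 divr_gt0// ltr_wpDl.
move=> y /=; rewrite distrC lt_min => /andP[yd ye]; rewrite in_itv/= => yab.
rewrite distrC (le_trans (HM y yab yd))//.
have : `|y - x| * (M + 1) <= e by rewrite -ler_pdivlMr ?ltW// ltr_wpDl.
have : 0 <= `|y - x| by [].
lra.
Qed.

(** [D] takes the values of a function on the whole segment, so the iterates are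
    identified one after the other along a chain of candidates. *)
Lemma Dn_chain (u : nat -> R -> R) (n : nat) f :
  (forall x, a <= x <= b -> f x = u 0%N x) ->
  (forall k x, (k < n)%N -> a <= x <= b -> hasD (u k) x (u k.+1 x)) ->
  forall k x, (k <= n)%N -> a <= x <= b -> Dn a b k f x = u k x.
Proof.
move=> fu H; elim=> [|k ih] x kn xab; first exact: fu.
rewrite /Dn iterS -/(Dn a b k f).
have E y : a <= y <= b -> u k y = Dn a b k f y by move=> yab; rewrite ih// ltnW.
by have [_ ->] := hasD_derivable xab (hasD_ext xab E (H k x kn xab)).
Qed.

Lemma Cn_hasD n f : Cn a b n f -> forall k x, (k < n)%N -> a <= x <= b ->
  hasD (Dn a b k f) x (Dn a b k.+1 f x).
Proof.
move=> [H _] k x kn xab; apply: derivable_hasD; by apply: H => //; rewrite in_itv.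
Qed.

End one_sided_derivative.


(** * Fractional integrals *)

Lemma measurable_segment {R : realType} (c d : R) :
  measurable (`[c, d]%classic : set (measurableTypeR R)).
Proof. exact: measurable_itv. Qed.

Section fractional_integral.
Context {R : realType}.
Local Notation mu := (@lebesgue_measure R).
Variables a b : R.
Hypothesis ab : a < b.
Implicit Types (e y s : R) (v : R -> R).

Lemma measurable_tpow e (D : set R) : measurable_fun D (@tpow R e).
Proof.
apply: measurable_funTS; apply: measurable_fun_ifT => //.
exact: measurable_fun_ltr.
Qed.

Lemma measurable_tpow_shift e y (D : set R) : measurable_fun D (fun s => tpow e (y - s)).
Proof.
apply: (measurableT_comp (@measurable_tpow e setT)).
by apply: measurable_funB.
Qed.

(** For [e < 0] the integrand is unbounded near [y], hence the exhaustion of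
    [[c, y[] by segments that stay away from [y]. *)
Lemma integral_tpow_full e y c : -1 < e -> c < y ->
  (\int[mu]_(s in `[c, y[) (tpow e (y - s))%:E = ((y - c) `^ (e + 1) / (e + 1))%:E)%E.
Proof.
move=> e1 cy.
pose z (i : nat) := y - (y - c) / i.+2%:R.
have yc : 0 < y - c by rewrite subr_gt0.
have e0 : 0 < e + 1 by lra.
have zc i : c < z i.
  by rewrite /z ltrBrDl -ltrBrDr ltr_pdivrMr// ltr_pMr// ltr1n.
have zy i : z i < y by rewrite /z gtrBl divr_gt0.
have FE : \bigcup_i `[c, z i]%classic = `[c, y[%classic.
  apply/seteqP; split => [t [i _]|t]; rewrite /= !in_itv/=.
    by move=> /andP[-> /le_lt_trans]; apply.
  move=> /andP[ct ty]; have yt : 0 < y - t by rewrite subr_gt0.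
  have M0 : 0 <= (y - c) / (y - t) by rewrite divr_ge0// ltW.
  have /andP[_ MN] := truncn_itv M0.
  exists (Num.trunc ((y - c) / (y - t))) => //=; rewrite in_itv/= ct/= /z lerBrDl -lerBrDr.
  rewrite ler_pdivrMr// mulrC -ler_pdivrMr// (le_trans (ltW MN))// ler_nat//.
have Fhomo : {homo (fun i => `[c, z i]%classic) : n m / (n <= m)%N >-> (n <= m)%O}.
  move=> n m nm; apply/subsetPset => t; rewrite /= !in_itv/= => /andP[-> /le_trans]; apply.
  by rewrite /z lerD2l lerN2 ler_pM2l// lef_pV2 ?posrE// ler_nat !ltnS.
have L1 := @ge0_nondecreasing_set_cvg_integral _ (measurableTypeR R) R
  (fun i => `[c, z i]%classic) (fun s => (tpow e (y - s))%:E) mu Fhomo.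
have {}L1 : (\int[mu]_(s in `[c, z i]) (tpow e (y - s))%:E)%E @[i --> \oo] -->
    (\int[mu]_(s in `[c, y[) (tpow e (y - s))%:E)%E.
  rewrite -FE; apply: L1.
  - by move=> i; exact: measurable_itv.
  - by move=> i; apply/measurable_EFinP; exact: measurable_tpow_shift.
  - by move=> i s _; rewrite lee_fin tpow_ge0.
have E i : (\int[mu]_(s in `[c, z i]) (tpow e (y - s))%:E)%E =
    ((y - c) `^ (e + 1) / (e + 1) - ((y - c) / i.+2%:R) `^ (e + 1) / (e + 1))%:E.
  have -> : (y - c) `^ (e + 1) / (e + 1) - ((y - c) / i.+2%:R) `^ (e + 1) / (e + 1) =
     (fun s => - ((y - s) `^ (e + 1) / (e + 1))) (z i) - (fun s => - ((y - s) `^ (e + 1) / (e + 1))) c.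
    by rewrite /z; rewrite (_ : y - (y - _) = (y - c) / i.+2%:R); [ring|ring].
  have pos t : c <= t <= z i -> 0 < y - t.
    by move=> /andP[_ tz]; rewrite subr_gt0; apply: le_lt_trans tz _.
  transitivity (\int[mu]_(s in `[c, z i]) ((y - s) `^ e)%:E)%E.
    by apply: eq_integral => s; rewrite inE/= in_itv/= => /pos h; rewrite tpow_gt0.
  have dN (t : R) : is_derive t 1 (fun s : R => y - s) (- 1).
    have := is_deriveB (is_derive_cst y t 1) (is_derive_id t 1).
    by move/is_derive_eq; apply; rewrite sub0r.
  apply: (@FTC2_is_derive R (fun s => - ((y - s) `^ (e + 1) / (e + 1)))) => // t /pos t0.
    have h1 := @is_derive1_comp _ (fun u : R => u `^ (e + 1)) (fun s : R => y - s) t _ _ (is_derive1_powR (e + 1) t0) (dN t).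
    have h2 := is_deriveZ (- (e + 1)^-1) h1.
    have -> : (fun s => - ((y - s) `^ (e + 1) / (e + 1))) =
       (- (e + 1)^-1) \*: ((fun u : R => u `^ (e + 1)) \o (fun s : R => y - s)).
      by apply/funext => s /=; rewrite /GRing.scale/=; ring.
    apply: (is_derive_eq h2); rewrite /GRing.scale/= addrK.
    by field; rewrite gt_eqF.
  have h1 := @is_derive1_comp _ (fun u : R => u `^ e) (fun s : R => y - s) t _ _ (is_derive1_powR e t0) (dN t).
  exact/differentiable_continuous/derivable1_diffP/(@ex_derive _ _ _ _ _ _ _ h1).
apply: (cvg_unique (@ereal_hausdorff R) L1) => /=.
rewrite (_ : (fun i : nat => _) = fun i : nat =>
  ((y - c) `^ (e + 1) / (e + 1) - ((y - c) / i.+2%:R) `^ (e + 1) / (e + 1))%:E); last first.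
  by apply/funext => i; rewrite E.
apply: cvg_EFin; first by near=> n.
rewrite -[X in _ --> X]subr0; apply: cvgB; first exact: cvg_cst.
rewrite -(mul0r (e + 1)^-1); apply: cvgM; last exact: cvg_cst.
have /cvg_at_rightP/(_ (fun n : nat => (y - c) / n.+2%:R)) := powR_cvg0 e0.
apply; split => [n|]; first by rewrite divr_gt0.
rewrite -(mulr0 (y - c)); apply: cvgM; first exact: cvg_cst.
exact: (@cvg_invS2 R).
Unshelve. all: by end_near. Qed.

Lemma integral_tpow c d e y : -1 < e -> y <= d ->
  (\int[mu]_(s in `[c, d]) (tpow e (y - s))%:E = (tpow (e + 1) (y - c) / (e + 1))%:E)%E.
Proof.
move=> e1 yd; have [yc|cy] := leP y c.
  rewrite (tpow_le0 (e + 1)) ?subr_le0// mul0r; apply: integral0_eq => s.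
  by rewrite /= in_itv/= => /andP[cs _]; rewrite tpow_le0// subr_le0 (le_trans yc).
rewrite tpow_gt0 ?subr_gt0// -integral_tpow_full// integral_mkcond [RHS]integral_mkcond.
apply: eq_integral => s _; rewrite /patch.
have [ys|sy] := leP y s; first by rewrite tpow_le0 ?subr_le0// !if_same.
by rewrite !mem_setE !in_itv/= sy (le_trans (ltW sy) yd) !andbT.
Qed.

Lemma integrable_tpow c d e y : -1 < e -> y <= d ->
  mu.-integrable `[c, d] (EFin \o (fun s => tpow e (y - s))).
Proof.
move=> e1 yd; apply/integrableP; split.
  by apply/measurable_EFinP; exact: measurable_tpow_shift.
rewrite (_ : (\int[mu]_(s in `[c, d]) _)%E = (tpow (e + 1) (y - c) / (e + 1))%:E) ?ltry//.
rewrite -(integral_tpow c e1 yd); apply: eq_integral => s _ /=.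
by rewrite ger0_norm// tpow_ge0.
Qed.

Lemma Rintegral_tpow c d e y : -1 < e -> y <= d ->
  \int[mu]_(s in `[c, d]) tpow e (y - s) = tpow (e + 1) (y - c) / (e + 1).
Proof. by move=> e1 yd; rewrite /Rintegral integral_tpow. Qed.

Lemma continuous_itv_bounded v : {within `[a, b], continuous v} ->
  exists2 B : R, 0 <= B & forall s, a <= s <= b -> `|v s| <= B.
Proof.
move=> cv.
have cn : {within `[a, b], continuous (fun s => `|v s|)}.
  by move=> s; apply: (continuous_comp (cv s)); exact: norm_continuous.
have [c _ H] := EVT_max (ltW ab) cn; by exists `|v c|.
Qed.

Lemma integrableM_continuous (k v : R -> R) : mu.-integrable `[a, b] (EFin \o k) ->
  {within `[a, b], continuous v} -> mu.-integrable `[a, b] (EFin \o (fun s => k s * v s)).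
Proof.
move=> ik cv.
apply: (integrableMl (measurable_segment a b) ik).
  exact: subspace_continuous_measurable_fun.
have [B B0 HB] := continuous_itv_bounded cv.
exists B; split; first exact: num_real.
move=> M BM s /=; rewrite in_itv/= => sab.
by rewrite (le_trans (HB s sab))// ltW.
Qed.

Lemma Rintegral_dominated (k v G : R -> R) (B : R) : mu.-integrable `[a, b] (EFin \o k) ->
  {within `[a, b], continuous v} -> mu.-integrable `[a, b] (EFin \o G) ->
  0 <= B -> (forall s, a <= s <= b -> `|v s| <= B) ->
  (forall s, a <= s <= b -> `|k s| <= G s) ->
  `|\int[mu]_(s in `[a, b]) (k s * v s)| <= B * \int[mu]_(s in `[a, b]) G s.
Proof.
move=> ik cv iG B0 HB HG.
have ikv := integrableM_continuous ik cv.
rewrite (le_trans (le_normr_Rintegral (measurable_segment a b) ikv))// -RintegralZl//.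
apply: le_Rintegral => //.
- by have := integrable_norm ikv.
- exact: integrableZl_real.
- move=> s; rewrite /= in_itv/= => sab; rewrite normrM mulrC.
  by rewrite ler_pM// ?HB ?HG.
Qed.

(** The left fractional integral of order [e + 1], up to its factor
    [Gamma (e + 1)]. *)
Definition frac_int e v y : R := \int[mu]_(s in `[a, b]) (tpow e (y - s) * v s).

Lemma frac_int_integrable e v y : -1 < e -> y <= b -> {within `[a, b], continuous v} ->
  mu.-integrable `[a, b] (EFin \o (fun s => tpow e (y - s) * v s)).
Proof. by move=> e1 yb cv; apply: integrableM_continuous => //; exact: integrable_tpow. Qed.

Lemma frac_int_base e v : frac_int e v a = 0.
Proof.
rewrite /frac_int (@eq_Rintegral _ _ _ _ _ (fun=> 0)) ?Rintegral_cst ?mul0r//.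
by move=> s; rewrite inE/= in_itv/= => /andP[h _]; rewrite tpow_le0 ?mul0r// subr_le0.
Qed.

Lemma is_derive_tpow e (t : R) : 0 < e -> is_derive t 1 (tpow (e + 1)) ((e + 1) * tpow e t).
Proof.
move=> e0; have [t0|t0|->] := ltgtP t 0.
- rewrite tpow_le0 ?ltW// mulr0.
  have E : \forall s \near t, cst 0 s = tpow (e + 1) s.
    by near=> s; rewrite tpow_le0//= ltW//; near: s; exact: lt_nbhsl.
  exact: (near_eq_is_derive E (is_derive_cst _ _ _)).
- rewrite tpow_gt0//.
  have E : \forall s \near t, s `^ (e + 1) = tpow (e + 1) s.
    by near=> s; rewrite tpow_gt0//; near: s; exact: lt_nbhsr.
  have := is_derive1_powR (e + 1) t0; rewrite addrK.
  exact: (near_eq_is_derive E).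
- rewrite tpow_le0// mulr0.
  have h : h^-1 *: (tpow (e + 1) (h *: 1 + 0) - tpow (e + 1) 0) @[h --> (0 : R)^'] --> (0 : R).
    apply/cvgrPdist_le => d d0.
    have d1 : 0 < d `^ e^-1 by rewrite powR_gt0.
    exists (d `^ e^-1) => //= h; rewrite /ball_ /= sub0r normrN => hd h0.
    rewrite ?sub0r ?normrN /GRing.scale/= mulr1 addr0 (tpow_le0 (e + 1) (lexx 0)) subr0 ?sub0r ?normrN normrM normfV.
    rewrite mulrC ler_pdivrMr ?normr_gt0// ger0_norm ?tpow_ge0//.
    have [hn|hp] := leP h 0; first by rewrite tpow_le0// mulr_ge0// ltW.
    rewrite tpow_gt0// gtr0_norm// powRD_gt0// powRr1 ?(ltW hp)// ler_wpM2r ?(ltW hp)//.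
    rewrite gtr0_norm// in hd.
    have := ge0_ler_powR (ltW e0) _ _ (ltW hd); rewrite !nnegrE => /(_ (ltW hp) (ltW d1)).
    by rewrite -powRrM mulVf ?gt_eqF// powRr1// ltW.
  apply: DeriveDef; first by apply/cvg_ex; exists 0.
  exact: (cvg_lim _ h).
Unshelve. all: by end_near. Qed.

Lemma continuous_tpow e (t : R) : 0 < e -> {for t, continuous (tpow e)}.
Proof.
move=> e0; have [t0|t0|->] := ltgtP t 0.
- have E : \forall s \near t, tpow e s = 0.
    by near=> s; rewrite tpow_le0//= ltW//; near: s; exact: lt_nbhsl.
  by rewrite /prop_for /continuous_at (tpow_le0 e (ltW t0)); exact: (cvg_near_cst 0 E).
- have E : \forall s \near t, s `^ e = tpow e s.
    by near=> s; rewrite tpow_gt0//; near: s; exact: lt_nbhsr.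
  rewrite /prop_for /continuous_at (tpow_gt0 e t0); apply: cvg_trans; first exact: (near_eq_cvg E).
  have h := is_derive1_powR e t0.
  have /differentiable_continuous : differentiable (@powR R ^~ e) t by apply/derivable1_diffP/ex_derive.
  exact.
- rewrite /prop_for /continuous_at (tpow_le0 e (lexx 0)); apply/cvgrPdist_le => d d0.
  have d1 : 0 < d `^ e^-1 by rewrite powR_gt0.
  exists (d `^ e^-1) => //= h; rewrite /ball_ /= !sub0r !normrN => hd.
  rewrite ger0_norm ?tpow_ge0//.
  have [hn|hp] := leP h 0; first by rewrite tpow_le0// ltW.
  rewrite tpow_gt0//.
  rewrite gtr0_norm// in hd.
  have := ge0_ler_powR (ltW e0) _ _ (ltW hd); rewrite !nnegrE => /(_ (ltW hp) (ltW d1)).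
  by rewrite -powRrM mulVf ?gt_eqF// powRr1// ltW.
Unshelve. all: by end_near. Qed.

End fractional_integral.


Section fractional_derivative.
Context {R : realType}.
Local Notation mu := (@lebesgue_measure R).
Variables a b : R.
Hypothesis ab : a < b.
Implicit Types (e y s : R) (v : R -> R).

(** The first-order remainder of [tpow E] has the sign of [E - 1], by the tangent
    inequalities, except where [u] and [u + h] are separated by [0]. Up to the
    two correction terms its absolute value therefore has the same integral as
    the remainder itself, which is explicit. *)
Lemma tpow_increment (E u h : R) : 0 < E ->
  let sg : R := if E <= 1 then -1 else 1 in
  let d := tpow E (u + h) - tpow E u - E * h * tpow (E - 1) u in
  is_true (`|d| <= sg * d + 2 * ((u <= 0)%R%:R * tpow E (u + h)
                        + E * `|h| * ((u + h <= 0)%R%:R * tpow (E - 1) u))).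
Proof.
move=> E0 sg d; have [u0|u0] := leP u 0.
  have -> : d = tpow E (u + h) by rewrite /d (tpow_le0 _ u0) (tpow_le0 _ u0) mulr0 !subr0.
  rewrite (tpow_le0 (E - 1) u0) !mulr0 addr0 mul1r.
  have := tpow_ge0 E (u + h); move: (tpow E (u + h)) => X X0.
  by rewrite ger0_norm// /sg; case: ifP => _; lra.
have hu : tpow E u = u * tpow (E - 1) u.
  by rewrite !tpow_gt0// -[X in X * _]powRr1 ?ltW// -powRD_gt0// addrC subrK.
have [h0|h0] := leP (u + h) 0.
  have hn : `|h| = - h by rewrite ler0_norm//; lra.
  rewrite mul0r add0r mul1r.
  have -> : d = (- u + E * `|h|) * tpow (E - 1) u.
    by rewrite /d (tpow_le0 _ h0) hu hn; ring.
  have := tpow_ge0 (E - 1) u; move: (tpow (E - 1) u) => X X0.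
  have uh : u <= `|h| by rewrite hn; lra.
  have Eh : 0 <= E * `|h| by rewrite mulr_ge0// ltW.
  have uX : 0 <= u * X by rewrite mulr_ge0// ltW.
  have EX : 0 <= E * `|h| * X by rewrite mulr_ge0.
  rewrite mulrDl mulNr /sg; case: ifPn => [_|]; first by rewrite ler_norml; apply/andP; split; lra.
  rewrite -ltNge => E1.
  have uEX : u * X <= E * `|h| * X.
    rewrite ler_wpM2r// (le_trans uh)// ler_peMl//; lra.
  by rewrite ler_norml; apply/andP; split; lra.
rewrite !mul0r mulr0 addr0 mulr0 addr0.
pose w := (u + h) / u.
have w0 : 0 <= w by rewrite divr_ge0// ltW.
have -> : d = tpow E u * (w `^ E - (1 + E * (w - 1))).
  rewrite /d !tpow_gt0// (_ : (u + h) `^ E = u `^ E * w `^ E); last first.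
    by rewrite -powRM ?(ltW u0)// /w mulrC divfK// gt_eqF.
  have -> : u `^ (E - 1) = u `^ E / u.
    by rewrite powRD_gt0// powRN powRr1// ltW.
  rewrite /w; move: (u `^ E) (_ `^ E) => X Y; field; by rewrite gt_eqF.
rewrite /sg; case: ifPn => [E1|].
  have H := powR_tangent_le E0 E1 w0.
  by rewrite ler0_norm ?mulN1r// mulr_ge0_le0 ?tpow_ge0//; lra.
rewrite -ltNge => /ltW E1; have H := powR_tangent_ge E1 w0.
by rewrite ger0_norm ?mul1r// mulr_ge0 ?tpow_ge0//; lra.
Qed.

Lemma tail_patch c (k : R -> R) : a <= c -> c <= b ->
  (fun s => (c <= s)%R%:R * k s) \_ `[a, b] = k \_ `[c, b].
Proof.
move=> ac cb; apply/funext => s; rewrite /patch !mem_setE !in_itv/=.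
have [cs|sc] := leP c s; first by rewrite (le_trans ac cs)/= mul1r.
by rewrite mul0r if_same.
Qed.

Lemma integrable_tail c (k : R -> R) : a <= c -> c <= b ->
  mu.-integrable `[c, b] (EFin \o k) ->
  mu.-integrable `[a, b] (EFin \o (fun s => (c <= s)%R%:R * k s)).
Proof.
move=> ac cb /(integrable_mkcond _ (measurable_segment c b)) H; apply/(integrable_mkcond _ (measurable_segment a b)).
by move: H; rewrite !restrict_EFin (tail_patch k ac cb).
Qed.

Lemma Rintegral_tail c (k : R -> R) : a <= c -> c <= b ->
  \int[mu]_(s in `[a, b]) ((c <= s)%R%:R * k s) = \int[mu]_(s in `[c, b]) k s.
Proof.
move=> ac cb; rewrite Rintegral_mkcond [RHS]Rintegral_mkcond.
by rewrite (tail_patch k ac cb).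
Qed.

(** By [tpow_increment] the error of the difference quotient is controlled by the
    case of a constant [v], in which it is the remainder of a power. This covers
    [E < 1], where the differentiated kernel is singular. *)
Lemma frac_int_hasD E v y : 0 < E -> a <= y <= b -> {within `[a, b], continuous v} ->
  hasD a b (frac_int a b E v) y (E * frac_int a b (E - 1) v y).
Proof.
move=> E0 /andP[ay yb] cv e e0.
have [B B0 HB] := continuous_itv_bounded ab cv.
have E1 : -1 < E - 1 by lra.
have E1' : -1 < E by lra.
pose F (y' : R) := tpow (E + 1) (y' - a) / (E + 1).
have hF : hasD a b F y (tpow E (y - a)).
  apply: is_derive_hasD.
  have hN : is_derive y 1 (fun y' : R => y' - a) 1.
    by have := is_deriveB (is_derive_id y 1) (is_derive_cst a y 1); move/is_derive_eq; apply; rewrite subr0.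
  have h1 := @is_derive1_comp _ (tpow (E + 1)) (fun y' : R => y' - a) y _ _ (is_derive_tpow (y - a) E0) hN.
  have h2 := is_deriveZ (E + 1)^-1 h1.
  have -> : F = (E + 1)^-1 \*: (tpow (E + 1) \o (fun y' : R => y' - a)).
    by apply/funext => z; rewrite /F /= /GRing.scale/= mulrC.
  apply: (is_derive_eq h2); rewrite /GRing.scale/= mulr1 mulrA mulVf ?mul1r// gt_eqF//; lra.
(* One share for the remainder of [F], two for each of the correction terms. *)
pose e' := e / (5 * (B + 1)).
have B1 : 0 < B + 1 by lra.
have e'0 : 0 < e' by rewrite divr_gt0// mulr_gt0.
have [d d0 Hd] := hF e' e'0.
exists (Num.min d (e' `^ E^-1)); first by rewrite lt_min d0 powR_gt0.
move=> y' /andP[ay' y'b]; rewrite lt_min => /andP[hd he].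
pose h := y' - y.
pose sg : R := if E <= 1 then -1 else 1.
pose k s := tpow E (y' - s) - tpow E (y - s) - E * h * tpow (E - 1) (y - s).
pose W s := (y <= s)%R%:R * tpow E (y' - s) + E * `|h| * ((y' <= s)%R%:R * tpow (E - 1) (y - s)).
have i1 := integrable_tpow a E1' y'b.
have i2 := integrable_tpow a E1' yb.
have i3 := integrable_tpow a E1 yb.
have i23 := integrableB_real (measurable_segment a b) i1 i2.
have i3' := integrableZl_real (measurable_segment a b) (E * h) i3.
have ik : mu.-integrable `[a, b] (EFin \o k) by exact: (integrableB_real (measurable_segment a b) i23 i3').
have j1 := integrable_tail ay yb (integrable_tpow y E1' y'b).
have j2 := integrableZl_real (measurable_segment a b) (E * `|h|) (integrable_tail ay' y'b (integrable_tpow y' E1 yb)).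
have iW : mu.-integrable `[a, b] (EFin \o W) by exact: (integrableD_real (measurable_segment a b) j1 j2).
have ik' := integrableZl_real (measurable_segment a b) sg ik.
have iW' := integrableZl_real (measurable_segment a b) 2 iW.
have iG := integrableD_real (measurable_segment a b) ik' iW'.
have H := Rintegral_dominated ab ik cv iG B0 HB.
have -> : frac_int a b E v y' - frac_int a b E v y - E * frac_int a b (E - 1) v y * (y' - y)
   = \int[mu]_(s in `[a, b]) (k s * v s).
  have g1 := frac_int_integrable ab E1' y'b cv.
  have g2 := frac_int_integrable ab E1' yb cv.
  have g3 := frac_int_integrable ab E1 yb cv.
  have g12 := integrableB_real (measurable_segment a b) g1 g2.
  have g3' := integrableZl_real (measurable_segment a b) (E * h) g3.
  rewrite (_ : E * _ * _ = E * h * frac_int a b (E - 1) v y); last by rewrite /h; ring.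
  rewrite /frac_int -(RintegralB (measurable_segment a b) g1 g2) -(RintegralZl _ (measurable_segment a b) g3).
  rewrite -(RintegralB (measurable_segment a b) g12 g3').
  by apply: eq_Rintegral => s _; rewrite /k; ring.
apply: (le_trans (H _)).
  move=> s _; have := @tpow_increment E (y - s) h E0.
  rewrite /= -/sg /k /W /h (_ : y - s + (y' - y) = y' - s); last by ring.
  by rewrite !subr_le0.
rewrite (RintegralD (measurable_segment a b) ik' iW') (RintegralZl _ (measurable_segment a b) ik) (RintegralZl _ (measurable_segment a b) iW).
rewrite (RintegralD (measurable_segment a b) j1 j2) (RintegralZl _ (measurable_segment a b) (integrable_tail ay' y'b (integrable_tpow y' E1 yb))).
rewrite (RintegralB (measurable_segment a b) i23 i3') (RintegralB (measurable_segment a b) i1 i2) (RintegralZl _ (measurable_segment a b) i3).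
rewrite !Rintegral_tail// !Rintegral_tpow// subrK -/(F y') -/(F y).
have [h0|h0] := eqVneq h 0.
  have E2 : y' = y by move: h0; rewrite /h => /eqP; rewrite subr_eq0 => /eqP.
  rewrite h0 E2 !subrr normr0 !mulr0 !mul0r subrr (tpow_le0 _ (lexx 0)) !mulr0 !mul0r.
  by rewrite !(addr0, mulr0).
have nh : 0 < `|h| by rewrite normr_gt0.
have hE : `|h| `^ E <= e'.
  have := ge0_ler_powR (ltW E0) _ _ (ltW he); rewrite !nnegrE => /(_ (normr_ge0 _) (powR_ge0 _ _)).
  by rewrite -powRrM mulVf ?gt_eqF// powRr1// ltW.
have tE z : `|z| = `|h| -> tpow E z <= e'.
  move=> zh; have [z0|z0] := leP z 0; first by rewrite tpow_le0// ltW.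
  by rewrite tpow_gt0// -(gtr0_norm z0) zh.
have tE1 z : `|z| = `|h| -> tpow (E + 1) z <= e' * `|h|.
  move=> zh; have [z0|z0] := leP z 0; first by rewrite tpow_le0// mulr_ge0// ltW.
  by rewrite tpow_gt0// -(gtr0_norm z0) zh powRD_gt0// powRr1// ler_wpM2r.
have := Hd y'; rewrite ay' y'b => /(_ erefl hd); rewrite -/h.
rewrite (_ : E * h * (tpow E (y - a) / E) = tpow E (y - a) * h); last by field; rewrite gt_eqF.
move: (F y' - F y - tpow E (y - a) * h) => D HD.
have sD : sg * D <= e' * `|h|.
  apply: le_trans HD; rewrite /sg; case: ifP => _; first by rewrite mulN1r -normrN ler_norm.
  by rewrite mul1r ler_norm.
have t1 : tpow (E + 1) h / (E + 1) <= e' * `|h|.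
  rewrite ler_pdivrMr; last by lra.
  apply: (le_trans (tE1 h erefl)); rewrite ler_peMr//; last by lra.
  by rewrite mulr_ge0// ltW.
have t2 : E * `|h| * (tpow E (y - y') / E) <= e' * `|h|.
  rewrite (_ : E * `|h| * _ = tpow E (y - y') * `|h|); last by field; rewrite gt_eqF.
  by rewrite ler_wpM2r// tE// distrC.
apply: (@le_trans _ _ (B * (5 * (e' * `|h|)))).
  rewrite ler_wpM2l//; lra.
have -> : e * `|h| = (B + 1) * (5 * (e' * `|h|)).
  by rewrite /e'; field; rewrite gt_eqF.
by rewrite ler_wpM2r ?lerDl ?ler01// mulr_ge0// mulr_ge0// ltW.
Qed.

Lemma hasD_FTC (u u' : R -> R) c d : a <= c -> c < d -> d <= b ->
  (forall x, a <= x <= b -> hasD a b u x (u' x)) -> {within `[a, b], continuous u'} ->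
  \int[mu]_(s in `[c, d]) u' s = u d - u c.
Proof.
move=> ac cd db Hu cu'; have cu := hasD_continuous Hu.
have sub : `[c, d]%classic `<=` `[a, b]%classic.
  move=> s /=; rewrite !in_itv/= => /andP[h1 h2].
  by rewrite (le_trans ac h1) (le_trans h2 db).
have cu2 : {within `[c, d], continuous u} by exact: continuous_subspaceW cu.
have cu'2 : {within `[c, d], continuous u'} by exact: continuous_subspaceW cu'.
have /(continuous_within_itvP _ cd) [_ cuc cud] := cu2.
have dU x : x \in `]c, d[ -> is_derive x 1 u (u' x).
  rewrite in_itv/= => /andP[cx xd].
  have axb : a < x < b by rewrite (le_lt_trans ac cx) (lt_le_trans xd db).
  apply: (hasD_is_derive axb); apply: Hu.
  by case/andP: axb => /ltW -> /ltW ->.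
rewrite /Rintegral (@continuous_FTC2 R u' u c d cd cu'2)//.
  split => // x xcd; exact: (@ex_derive _ _ _ _ _ _ _ (dU x xcd)).
move=> x xcd; rewrite derive1E; exact: (@derive_val _ _ _ _ _ _ _ (dU x xcd)).
Qed.

Lemma frac_int_antiderivative (u u' : R -> R) y : a <= y <= b -> u a = 0 ->
  (forall x, a <= x <= b -> hasD a b u x (u' x)) -> {within `[a, b], continuous u'} ->
  frac_int a b 0 u' y = u y.
Proof.
move=> /andP[]; rewrite le_eqVlt => /predU1P[<- _ ->|ay yb ua Hu cu']; first by rewrite frac_int_base.
have <- : u y - u a = u y by rewrite ua subr0.
rewrite -(hasD_FTC (lexx a) ay yb Hu cu') /frac_int.
have iu : mu.-integrable `[a, y[ (EFin \o u').
  have : mu.-integrable `[a, b] (EFin \o u').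
    by apply: continuous_compact_integrable => //; exact: segment_compact.
  apply: (integrableS (measurable_segment a b)); first exact: measurable_itv.
  by move=> s /=; rewrite !in_itv/= => /andP[-> /ltW h]; rewrite (le_trans h).
rewrite -(Rintegral_itv_bndo_bndc iu) Rintegral_mkcond [RHS]Rintegral_mkcond.
apply: eq_Rintegral => s _; rewrite /patch !mem_setE !in_itv/=.
have [sy|ys] := ltP s y; last by rewrite tpow_le0 ?subr_le0// mul0r andbF if_same.
by rewrite (le_trans (ltW sy) yb) tpow_gt0 ?subr_gt0// powRr0 mul1r.
Qed.

(** The boundary term [tpow (e + 1) (y - s) * u s] vanishes at both ends. *)
Lemma frac_int_by_parts_gt0 e (u u' : R -> R) y : 0 < e -> a <= y <= b -> u a = 0 ->
  (forall x, a <= x <= b -> hasD a b u x (u' x)) -> {within `[a, b], continuous u'} ->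
  (e + 1) * frac_int a b e u y = frac_int a b (e + 1) u' y.
Proof.
move=> e0 /andP[ay yb] ua Hu cu'; have cu := hasD_continuous Hu.
pose H s := tpow (e + 1) (y - s) * u s.
pose H' s := tpow (e + 1) (y - s) * u' s - (e + 1) * (tpow e (y - s) * u s).
have dN (t : R) : is_derive t 1 (fun s : R => y - s) (- 1).
  have := is_deriveB (is_derive_cst y t 1) (is_derive_id t 1).
  by move/is_derive_eq; apply; rewrite sub0r.
have hH x : a <= x <= b -> hasD a b H x (H' x).
  move=> xab.
  have h1 : is_derive x 1 (fun s => tpow (e + 1) (y - s)) (- ((e + 1) * tpow e (y - x))).
    have := @is_derive1_comp _ (tpow (e + 1)) (fun s : R => y - s) x _ _ (is_derive_tpow (y - x) e0) (dN x).
    by move/is_derive_eq; apply; rewrite mulrN1.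
  have := hasDM ab xab (is_derive_hasD a b h1) (Hu x xab).
  by rewrite (_ : - _ * u x + _ * u' x = H' x)//; rewrite /H'; ring.
have ct z : 0 < z -> {within `[a, b], continuous (fun s => tpow z (y - s))}.
  move=> z0; apply: continuous_subspaceT => s.
  apply: (@continuous_comp _ _ _ (fun s : R => y - s) (tpow z)); last exact: continuous_tpow.
  have h := dN s.
  have /differentiable_continuous : differentiable (fun s : R => y - s) s by apply/derivable1_diffP/ex_derive.
  exact.
have e10 : 0 < e + 1 by lra.
have cH' : {within `[a, b], continuous H'}.
  move=> s; apply: cvgB; first by apply: cvgM; [exact: ct|exact: cu'].
  by apply: cvgM; [exact: cvg_cst|apply: cvgM; [exact: ct|exact: cu]].
have e1 : -1 < e by lra.
have e2 : -1 < e + 1 by lra.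
have := hasD_FTC (lexx a) ab (lexx b) hH cH'.
rewrite /H ua mulr0 (tpow_le0 _ (_ : y - b <= 0)) ?subr_le0// mul0r subrr.
have i1 := frac_int_integrable ab e2 yb cu'.
have i2 := frac_int_integrable ab e1 yb cu.
have i2' := integrableZl_real (measurable_segment a b) (e + 1) i2.
rewrite (RintegralB (measurable_segment a b) i1 i2') (RintegralZl _ (measurable_segment a b) i2).
by move/eqP; rewrite subr_eq0 => /eqP.
Qed.

(** For [e <= 0] the kernel is singular at [s = y]; differentiating the
    identity of exponent [e + 1] avoids integrating by parts there. *)
Lemma frac_int_by_parts e (u u' : R -> R) y : -1 < e -> a <= y <= b -> u a = 0 ->
  (forall x, a <= x <= b -> hasD a b u x (u' x)) -> {within `[a, b], continuous u'} ->
  (e + 1) * frac_int a b e u y = frac_int a b (e + 1) u' y.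
Proof.
move=> e1 yab ua Hu cu'; have cu := hasD_continuous Hu.
have e0 : 0 < e + 1 by lra.
have e0' : 0 < e + 1 + 1 by lra.
have h1 := frac_int_hasD e0 yab cu.
have h2 := frac_int_hasD e0' yab cu'.
have h1' := hasDZ (e + 1 + 1) h1.
have h3 : hasD a b (frac_int a b (e + 1 + 1) u') y
    ((e + 1 + 1) * ((e + 1) * frac_int a b (e + 1 - 1) u y)).
  by apply: hasD_ext h1' => // z zab; exact: frac_int_by_parts_gt0.
have [_ E1] := hasD_derivable ab yab h2.
have [_ E2] := hasD_derivable ab yab h3.
move: E2; rewrite E1 !addrK => /(mulfI _) ->//.
by rewrite gt_eqF.
Qed.

End fractional_derivative.


(** * Representation by the highest derivative *)

Section representation.
Context {R : realType}.
Local Notation mu := (@lebesgue_measure R).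
Variables a b : R.
Hypothesis ab : a < b.
Implicit Types (e y s : R) (v f : R -> R).

Lemma frac_int_le e v y : y <= a -> frac_int a b e v y = 0.
Proof.
move=> ya; rewrite /frac_int (@eq_Rintegral _ _ _ _ _ (fun=> 0)) ?Rintegral_cst ?mul0r//.
by move=> s; rewrite inE/= in_itv/= => /andP[h _]; rewrite tpow_le0 ?mul0r// subr_le0 (le_trans ya).
Qed.

Lemma frac_int_subc e v y (c : R) : -1 < e -> y <= b -> {within `[a, b], continuous v} ->
  frac_int a b e (fun s => v s - c) y = frac_int a b e v y - c * (tpow (e + 1) (y - a) / (e + 1)).
Proof.
move=> e1 yb cv; have i1 := frac_int_integrable ab e1 yb cv.
have i2 := integrable_tpow a e1 yb.
have i3 := integrableZl_real (measurable_segment a b) c i2.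
rewrite -(Rintegral_tpow a e1 yb) -(RintegralZl _ (measurable_segment a b) i2).
rewrite /frac_int -(RintegralB (measurable_segment a b) i1 i3).
by apply: eq_Rintegral => s _; ring.
Qed.

Lemma frac_int_iter_by_parts e (u : nat -> R -> R) (n : nat) y : -1 < e -> a <= y <= b ->
  (forall k, (k < n)%N -> u k a = 0) ->
  (forall k x, (k < n)%N -> a <= x <= b -> hasD a b (u k) x (u k.+1 x)) ->
  (forall k, (0 < k <= n)%N -> {within `[a, b], continuous (u k)}) ->
  (\prod_(i < n) (e + 1 + i%:R)) * frac_int a b e (u 0%N) y = frac_int a b (e + n%:R) (u n) y.
Proof.
move=> e1 yab; elim: n => [|n ih] u0 Hu cu; first by rewrite big_ord0 mul1r addr0.
rewrite big_ord_recr /= mulrAC ih; first last.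
- by move=> k /andP[k0 kn]; apply: cu; rewrite k0 leqW.
- by move=> k x kn; apply: Hu; rewrite ltnW.
- by move=> k kn; apply: u0; rewrite ltnW.
have en : -1 < e + n%:R by rewrite ltr_wpDr.
have := frac_int_by_parts ab en yab (u0 n (leqnn _)) (fun x => Hu n x (leqnn _)) (cu n.+1 (leqnn _)).
by move=> E; rewrite -[n.+1%:R]natr1 addrA -E (addrAC e) mulrC.
Qed.

Variables (f : R -> R) (r : nat).
Hypothesis Cf : Cn a b r.+1 f.
Hypothesis f0 : forall k : nat, (k <= r)%N -> Dn a b k f a = 0.

Let g := Dn a b r.+1 f.

Lemma Dn_continuous k : (k <= r.+1)%N -> {within `[a, b], continuous (Dn a b k f)}.
Proof.
rewrite leq_eqVlt => /predU1P[->|kr]; first by case: Cf.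
by apply: hasD_continuous => x xab; exact: (Cn_hasD Cf kr xab).
Qed.

Lemma frac_int_Dn e y : -1 < e -> a <= y <= b ->
  (\prod_(i < r.+1) (e + 1 + i%:R)) * frac_int a b e f y = frac_int a b (e + r.+1%:R) g y.
Proof.
move=> e1 yab; apply: (frac_int_iter_by_parts (u := fun k => Dn a b k f)) => //.
- by move=> k x kr xab; exact: (Cn_hasD Cf kr xab).
- by move=> k /andP[_]; exact: Dn_continuous.
Qed.

(** Taylor's formula at [a] with integral remainder. *)
Lemma function_frac_int y : a <= y <= b -> f y = frac_int a b r%:R g y / r`!%:R.
Proof.
move=> yab.
have H := @frac_int_iter_by_parts 0 (fun k => Dn a b k.+1 f) r y _ yab.
have fy := @frac_int_antiderivative R a b f (Dn a b 1 f) y yab (f0 (leq0n r))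
  (fun x xab => Cn_hasD Cf (ltn0Sn r) xab) (Dn_continuous (ltn0Sn r)).
have P : \prod_(i < r) (0 + 1 + i%:R) = r`!%:R :> R.
  rewrite fact_prod natr_prod big_add1 big_mkord; apply: eq_bigr => i _.
  by rewrite add0r addrC natr1.
rewrite P add0r fy in H; rewrite -H ?mulrK//; first last.
- by move=> k /andP[_ kr]; exact: Dn_continuous.
- by move=> k x kr xab; exact: (Cn_hasD Cf (_ : k.+1 < r.+1)%N xab).
- by move=> k kr; exact: f0.
by rewrite mulrC mulKf// pnatr_eq0 -lt0n fact_gt0.
Qed.

Lemma RLint_frac_int c y : c != 1 -> a <= y <= b ->
  RLint a c f y = (Gamma c)^-1 * frac_int a b (c - 1) f y.
Proof.
move=> c1 /andP[ay yb]; rewrite /RLint /frac_int; congr (_ * _).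
rewrite Rintegral_mkcond [RHS]Rintegral_mkcond; apply: eq_Rintegral => s _.
rewrite /patch !mem_setE !in_itv/=; have [as_|] := leP a s; last by [].
have [sy|ys] := ltP s y.
  by rewrite (ltW sy) (le_trans (ltW sy) yb)/= tpow_gt0// subr_gt0.
rewrite (tpow_le0 (c - 1) (_ : y - s <= 0)) ?subr_le0// mul0r if_same.
case: ifP => // sy; have -> : y = s by apply: le_anti; rewrite ys.
by rewrite subrr powR0 ?mul0r// subr_eq0.
Qed.

Variable alpha : R.
Hypothesis alpha12 : 1 < alpha < 2.

(** Each order of differentiation lowers the exponent of the kernel by one; the
    constants are those of [RLint (2 - alpha) f] after [r + 1] integrations by
    parts. *)
Lemma Dn_RLint k y : (k <= r.+1)%N -> a <= y <= b ->
  Dn a b k (RLint a (2 - alpha) f) y =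
  (Gamma (2 - alpha))^-1 / (\prod_(i < r.+1) (2 - alpha + i%:R)) *
  (\prod_(i < k) (r.+2%:R - alpha - i%:R)) * frac_int a b (r.+2%:R - alpha - k%:R) g y.
Proof.
case/andP: alpha12 => a1 a2.
pose C := (Gamma (2 - alpha))^-1 / (\prod_(i < r.+1) (2 - alpha + i%:R)).
pose u k y := C * (\prod_(i < k) (r.+2%:R - alpha - i%:R)) * frac_int a b (r.+2%:R - alpha - k%:R) g y.
apply: (Dn_chain ab (u := u)) => [x xab|j x jr xab].
  rewrite RLint_frac_int// ?lt_eqF//; last by lra.
  have e1 : -1 < 2 - alpha - 1 by lra.
  have := frac_int_Dn e1 xab; rewrite subrK => H.
  rewrite /u big_ord0 mulr1 subr0 /C (_ : r.+2%:R - alpha = 2 - alpha - 1 + r.+1%:R); last first.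
    by rewrite -[r.+2%:R]natr1; ring.
  rewrite -H mulrA; congr (_ * _); rewrite mulfVK//.
  rewrite gt_eqF// prodr_gt0// => i _; rewrite ltr_wpDr//; lra.
rewrite /u; have E0 : 0 < r.+2%:R - alpha - j%:R.
  have : j.+2%:R <= r.+2%:R :> R by rewrite ler_nat.
  rewrite -[j.+2%:R]natr1 -[j.+1%:R]natr1; lra.
have cg : {within `[a, b], continuous g} by exact: Dn_continuous.
have := hasDZ (C * \prod_(i < j) (r.+2%:R - alpha - i%:R)) (frac_int_hasD ab E0 xab cg).
by rewrite big_ord_recr /= -[j.+1%:R]natr1 opprD !addrA !mulrA.
Qed.

End representation.


Section riemann_liouville.
Context {R : realType}.
Local Notation mu := (@lebesgue_measure R).
Implicit Types alpha : R.

(** The reciprocal of [Gamma (3 - alpha)]. *)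
Definition rl_const alpha : R :=
  if alpha == 2 then 1 else (Gamma (2 - alpha))^-1 / (2 - alpha).

Lemma Gamma_gt0 (s : R) : 0 < s < 1 -> 0 < Gamma s.
Proof. exact: gamma_int_gt0. Qed.

Lemma GammaE (s : R) : gamma_int (s - 1) = Gamma s.
Proof. by []. Qed.

Lemma spline_asymptotics_rl alpha : 1 < alpha <= 2 -> spline_asymptotics alpha (rl_const alpha).
Proof.
move=> /andP[a1]; rewrite le_eqVlt /rl_const => /predU1P[->|a2].
  by rewrite eqxx; exact: spline_asymptotics_eq2.
rewrite lt_eqF//; have s01 : 0 < 2 - alpha < 1 by apply/andP; split; lra.
have := ln_weight_limit s01; rewrite GammaE; have := Gamma_gt0 s01.
move: (Gamma _) => G G0.
rewrite opprB (_ : 2 - alpha - 1 = 1 - alpha); last by ring.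
move=> /spline_asymptotics_lt2; rewrite a1 a2 => /(_ erefl).
by rewrite expRN lnK.
Qed.

Variables a b : R.
Hypothesis ab : a < b.
Variables (f : R -> R) (r : nat) (alpha : R).
Hypothesis alpha12 : 1 < alpha <= 2.
Hypothesis Cf : Cn a b r.+1 f.
Hypothesis f0 : forall k : nat, (k <= r)%N -> Dn a b k f a = 0.

Let g := Dn a b r.+1 f.

Lemma ceil_alpha : Num.ceil alpha = 2.
Proof. by case/andP: alpha12 => a1 a2; apply: ceil_def; apply/andP; split; lra. Qed.

Lemma ceil_alphaD2 : Num.ceil (alpha + 2) = 4.
Proof. by case/andP: alpha12 => a1 a2; apply: ceil_def; apply/andP; split; lra. Qed.

Lemma RLder_frac_int y : (2 <= r <= 3)%N -> a <= y <= b ->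
  RLder a b alpha f y = kappa alpha (rl_const alpha) r * frac_int a b (r%:R - alpha) g y.
Proof.
move=> r23 yab; rewrite /RLder ceil_alpha (_ : `|2|%N = 2%N)// /rl_const.
case/andP: alpha12 => a1; rewrite le_eqVlt => /predU1P[al|a2].
  rewrite al eqxx.
  have D3 z : a <= z <= b -> frac_int a b 0 (Dn a b 3 f) z = Dn a b 2 f z.
    move=> zab; have r2 : (2 < r.+1)%N by case/andP: r23.
    apply: (frac_int_antiderivative zab) => //.
    - by apply: f0; case/andP: r23.
    - by move=> x xab; exact: (Cn_hasD Cf r2 xab).
    - by apply: (Dn_continuous Cf).
  rewrite /g -D3//; case: r r23 Cf f0 => [|[|[|[|//]]]]// _ Cf' f0'.
    by rewrite /= subrr mul1r.
  have m10 : (-1 : R) < 0 by rewrite oppr_lt0 ltr01.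
  have := frac_int_by_parts ab m10 yab (f0' 3 (leqnn _))
    (fun x xab => Cn_hasD Cf' (ltnSn 3) xab) (Dn_continuous Cf' (leqnn 4)).
  rewrite add0r mul1r => ->.
  by rewrite /kappa (_ : 3 - 2 = 1 :> R); [rewrite divr1 mul1r|ring].
rewrite !lt_eqF// (Dn_RLint ab Cf f0 _ _ yab)//; last 2 first.
- by rewrite a1.
- by rewrite ltnW// ltnS; case/andP: r23.
rewrite -/g -[r.+2%:R]natr1 -[r.+1%:R]natr1.
rewrite (_ : r%:R + 1 + 1 - alpha - 2 = r%:R - alpha); last by ring.
congr (_ * _); move: (Gamma _)^-1 => G.
have n2 : 2 - alpha != 0 by rewrite gt_eqF//; lra.
have n3 : 3 - alpha != 0 by rewrite gt_eqF//; lra.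
have n4 : 4 - alpha != 0 by rewrite gt_eqF//; lra.
have n5 : 5 - alpha != 0 by rewrite gt_eqF//; lra.
have m1 : 2 - alpha + 1 != 0 by rewrite gt_eqF//; lra.
have m2 : 2 - alpha + 2 != 0 by rewrite gt_eqF//; lra.
have m3 : 2 - alpha + 3 != 0 by rewrite gt_eqF//; lra.
case: r r23 => [|[|[|[|//]]]]// _; rewrite /= !big_ord_recl !big_ord0 /=.
  rewrite /bump /=; field.
  by rewrite n2 m1 m2.
rewrite /bump /=; field.
by rewrite n2 n3 m2 m3.
Qed.

(** At [alpha = 2] the singular integral carries the factor [0] and the boundary
    term is the classical fourth derivative. *)
Lemma RLderD2_frac_int x : r = 3%N -> a < x < b ->
  RLder a b (alpha + 2) f x =
  kappa alpha (rl_const alpha) 1 * frac_int a b (1 - alpha) (fun s => g s - g x) x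
  + g x * (rl_const alpha * (x - a) `^ (2 - alpha)).
Proof.
move=> r3 /andP[ax xb]; have xab : a <= x <= b by rewrite !ltW.
rewrite /RLder ceil_alphaD2 (_ : `|4|%N = 4%N)// /rl_const.
case/andP: alpha12 => a1; rewrite le_eqVlt => /predU1P[al|a2].
  rewrite al eqxx (_ : 2 + 2 = 4%:R :> R) ?eqxx; last by ring.
  by rewrite (_ : kappa 2 1 1 = 0) /kappa subrr ?mulr0// !mul0r add0r powRr0 !mulr1 /g r3.
rewrite !lt_eqF//; last by lra.
rewrite (_ : 4%:R - (alpha + 2) = 2 - alpha); last by ring.
rewrite (Dn_RLint ab Cf f0 _ _ xab)//; last 2 first.
- by rewrite a1.
- by rewrite r3.
have e1 : -1 < 1 - alpha by lra.
have cg : {within `[a, b], continuous g} by exact: (Dn_continuous Cf).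
rewrite (_ : r.+2%:R - alpha - 4%:R = 1 - alpha); last by rewrite r3; ring.
have -> : frac_int a b (1 - alpha) g x =
    frac_int a b (1 - alpha) (fun s => g s - g x) x + g x * ((x - a) `^ (2 - alpha) / (2 - alpha)).
  rewrite (frac_int_subc ab (g x) e1 (ltW xb) cg) tpow_gt0 ?subr_gt0//.
  rewrite (_ : 1 - alpha + 1 = 2 - alpha); last by ring.
  by rewrite subrK.
move: (frac_int _ _ _ _ _) => I; move: (Gamma _)^-1 (_ `^ _) (g x) => G X gx.
have n2 : 2 - alpha != 0 by rewrite gt_eqF//; lra.
have n3 : 3 - alpha != 0 by rewrite gt_eqF//; lra.
have n4 : 4 - alpha != 0 by rewrite gt_eqF//; lra.
have n5 : 5 - alpha != 0 by rewrite gt_eqF//; lra.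
have m1 : 2 - alpha + 1 != 0 by rewrite gt_eqF//; lra.
have m2 : 2 - alpha + 2 != 0 by rewrite gt_eqF//; lra.
have m3 : 2 - alpha + 3 != 0 by rewrite gt_eqF//; lra.
rewrite r3 /= !big_ord_recl !big_ord0 /= /bump /=; field.
by rewrite n2 m1 m2 m3.
Qed.

Lemma ext0_frac_int y : y <= b -> ext0 a f y = frac_int a b r%:R g y / r`!%:R.
Proof.
move=> yb; rewrite /ext0; case: ifPn => [ya|].
  by rewrite frac_int_le ?(ltW ya)// mul0r.
by rewrite -leNgt => ay; apply: (function_frac_int ab Cf f0); rewrite ay.
Qed.

(** The representation of [f] holds to the left of [a] as well, where both sides
    vanish; only finitely many terms of the Grünwald series survive. *)
Lemma grunwald_frac_int (h x : R) (p : int) (N : nat) : 0 < h -> x + p%:~R * h <= b ->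
  (x - a) / h + p%:~R <= N%:R ->
  grunwald a alpha h p f x = h `^ (- alpha) *
    \sum_(k < N) grunwald_coef alpha k / r`!%:R * frac_int a b r%:R g (x + p%:~R * h - k%:R * h).
Proof.
move=> h0 xb xN; rewrite /grunwald; congr (_ * _).
pose u (k : nat) := grunwald_coef alpha k * ext0 a f (x - (k%:Z - p)%:~R * h).
have uE k : u k = grunwald_coef alpha k / r`!%:R * frac_int a b r%:R g (x + p%:~R * h - k%:R * h).
  rewrite /u (_ : x - _ = x + p%:~R * h - k%:R * h); last first.
    by rewrite intrD intrN /=; ring.
  rewrite ext0_frac_int; first by ring.
  by rewrite (le_trans _ xb)// gerBl mulr_ge0// ltW.
have u0 k : (N <= k)%N -> u k = 0.
  move=> Nk; rewrite uE frac_int_le ?mulr0//.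
  have : (x - a) / h + p%:~R <= k%:R by rewrite (le_trans xN)// ler_nat.
  rewrite -(ler_pM2r h0) mulrDl divfK ?gt_eqF//; lra.
have E : \forall n \near \oo, series u n = \sum_(k < N) u k.
  near=> n; have Nn : (N <= n)%N by near: n; exact: nbhs_infty_ge.
  rewrite /series /= big_mkord (big_ord_widen n u Nn) [LHS](bigID (fun k : 'I_n => (k < N)%N))/=.
  by rewrite [X in _ + X]big1 ?addr0// => k; rewrite -leqNgt; exact: u0.
rewrite -/u (_ : limn (series u) = \sum_(k < N) u k); last exact: lim_near_cst E.
by apply: eq_bigr => k _; rewrite uE.
Unshelve. all: by end_near. Qed.

End riemann_liouville.


(** * Error of the scheme *)

Section has_integral.
Context {R : realType}.
Local Notation mu := (@lebesgue_measure R).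
Variables a b : R.
Hypothesis ab : a < b.
Implicit Types (F G v : R -> R) (I J k e y z : R).

(** Integrability and value are carried together, so that linear combinations can
    be integrated without side conditions. *)
Definition has_integral F I :=
  mu.-integrable `[a, b] (EFin \o F) /\ \int[mu]_(s in `[a, b]) F s = I.

Lemma has_integral_ext F G I : (forall s, a <= s <= b -> F s = G s) ->
  has_integral F I -> has_integral G I.
Proof.
move=> FG [iF <-]; split.
  apply: (@eq_integrable _ _ _ _ _ (measurable_segment a b) (EFin \o F) _ _ iF) => s.
  by rewrite inE/= in_itv/= => sab; rewrite /= FG.
by apply: eq_Rintegral => s; rewrite inE/= in_itv/= => sab; rewrite FG.
Qed.

Lemma has_integral0 : has_integral (fun=> 0) 0.
Proof.
split; last by rewrite Rintegral_cst ?mul0r.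
exact: integrable0.
Qed.

Lemma has_integralZ k F I : has_integral F I -> has_integral (fun s => k * F s) (k * I).
Proof.
move=> [iF <-]; split; first exact: (integrableZl_real (measurable_segment a b) k iF).
exact: (RintegralZl _ (measurable_segment a b) iF).
Qed.

Lemma has_integralD F G I J : has_integral F I -> has_integral G J ->
  has_integral (fun s => F s + G s) (I + J).
Proof.
move=> [iF <-] [iG <-]; split; first exact: (integrableD_real (measurable_segment a b) iF iG).
exact: (RintegralD (measurable_segment a b) iF iG).
Qed.

Lemma has_integralB F G I J : has_integral F I -> has_integral G J ->
  has_integral (fun s => F s - G s) (I - J).
Proof.
move=> [iF <-] [iG <-]; split; first exact: (integrableB_real (measurable_segment a b) iF iG).
exact: (RintegralB (measurable_segment a b) iF iG).
Qed.

Lemma has_integral_sum N (F : nat -> R -> R) (I : nat -> R) :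
  (forall k : nat, has_integral (F k) (I k)) ->
  has_integral (fun s => \sum_(k < N) F k s) (\sum_(k < N) I k).
Proof.
move=> H; elim: N => [|N ih].
  by rewrite big_ord0; apply: has_integral_ext has_integral0 => s _; rewrite big_ord0.
rewrite big_ord_recr /=; apply: has_integral_ext (has_integralD ih (H N)) => s _.
by rewrite big_ord_recr.
Qed.

Lemma has_integral_le F G I J : has_integral F I -> has_integral G J ->
  (forall s, a <= s <= b -> `|F s| <= G s) -> `|I| <= J.
Proof.
move=> [iF <-] [iG <-] FG.
rewrite (le_trans (le_normr_Rintegral (measurable_segment a b) iF))//.
apply: (le_Rintegral (measurable_segment a b) _ iG).
  by have := integrable_norm iF.
by move=> s; rewrite /= in_itv/=; exact: FG.
Qed.

Lemma has_integral_frac_int e v y : -1 < e -> y <= b -> {within `[a, b], continuous v} ->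
  has_integral (fun s => tpow e (y - s) * v s) (frac_int a b e v y).
Proof. by move=> e1 yb cv; split => //; exact: frac_int_integrable. Qed.

Lemma has_integral_tpow e y : -1 < e -> y <= b ->
  has_integral (fun s => tpow e (y - s)) (tpow (e + 1) (y - a) / (e + 1)).
Proof. by move=> e1 yb; split; [exact: integrable_tpow|rewrite Rintegral_tpow]. Qed.

End has_integral.

Section scheme_error.
Context {R : realType}.
Variables a b : R.
Hypothesis ab : a < b.
Variables (alpha k2 cm c0 cp dp dq : R) (p q : int) (r : nat) (x sg : R).
Hypothesis alpha12 : 1 < alpha <= 2.
Hypothesis axb : a < x < b.
Hypothesis r23 : (2 <= r <= 3)%N.
Hypothesis sg0 : (r == 2)%N -> sg = 0.
Hypothesis p1 : p%:~R <= 1 :> R.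
Hypothesis q1 : q%:~R <= 1 :> R.
Implicit Types (Phi Psi : R -> R -> R) (h e y c : R) (N : nat) (v : R -> R).

Local Notation ker := (kernel alpha k2 cm c0 cp dp dq p%:~R q%:~R).

(** The left side minus the Grünwald side, where [Phi e y] stands for the fractional
    integral of exponent [e] at [y] of the highest derivative. Keeping [Phi]
    abstract allows splitting it linearly. *)
Definition scheme Phi h N : R :=
  kappa alpha k2 r * (cm * Phi (r%:R - alpha) (x - h) + c0 * Phi (r%:R - alpha) x
                      + cp * Phi (r%:R - alpha) (x + h))
  - h `^ (- alpha) * (dp * (\sum_(k < N) grunwald_coef alpha k / r`!%:R * Phi r%:R (x + p%:~R * h - k%:R * h))
                    + dq * (\sum_(k < N) grunwald_coef alpha k / r`!%:R * Phi r%:R (x + q%:~R * h - k%:R * h))).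

Lemma node_le (pp : int) h (k : nat) : pp%:~R <= 1 :> R -> 0 < h -> x + h <= b ->
  x + pp%:~R * h - k%:R * h <= b.
Proof.
move=> pp1 h0 xh; rewrite (le_trans _ xh)// -addrA lerD2l -mulrBl ler_piMl ?(ltW h0)//.
by rewrite (le_trans _ pp1)// gerBl.
Qed.

Lemma scheme_linear Phi Phi1 Phi2 c h N : 0 < h -> x + h <= b ->
  (forall e y, 0 < e + 1 -> y <= b -> Phi e y = Phi1 e y + c * Phi2 e y) ->
  scheme Phi h N = scheme Phi1 h N + c * scheme Phi2 h N.
Proof.
move=> h0 xh E; have r2 : 2 <= r%:R :> R by rewrite ler_nat; case/andP: r23.
have e1 : 0 < r%:R - alpha + 1 by case/andP: alpha12 => *; lra.
have e2 : 0 < r%:R + 1 :> R by lra.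
have S (pp : int) : pp%:~R <= 1 :> R ->
    \sum_(k < N) grunwald_coef alpha k / r`!%:R * Phi r%:R (x + pp%:~R * h - k%:R * h) =
    \sum_(k < N) grunwald_coef alpha k / r`!%:R * Phi1 r%:R (x + pp%:~R * h - k%:R * h) +
    c * \sum_(k < N) grunwald_coef alpha k / r`!%:R * Phi2 r%:R (x + pp%:~R * h - k%:R * h).
  move=> pp1; rewrite mulr_sumr -big_split /=; apply: eq_bigr => k _.
  by rewrite E ?node_le//; ring.
have xb : x <= b by lra.
have xmb : x - h <= b by lra.
by rewrite /scheme !S// !E//; ring.
Qed.

Lemma spline_scaled (m : nat) (pp : int) h N s : 0 < h -> a <= s -> (x - a) / h + pp%:~R <= N%:R ->
  h `^ (- alpha) * (\sum_(k < N) grunwald_coef alpha k / m`!%:R * tpow m%:R (x + pp%:~R * h - k%:R * h - s))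
  = h `^ (m%:R - alpha) * spline alpha m ((x - s) / h + pp%:~R).
Proof.
move=> h0 as_ xN; have tN : (x - s) / h + pp%:~R <= N%:R.
  by rewrite (le_trans _ xN)// lerD2r ler_pM2r ?invr_gt0// lerD2l lerN2.
rewrite -(splineE _ _ tN) /spline_sum !mulr_sumr; apply: eq_bigr => k _.
rewrite (_ : x + pp%:~R * h - k%:R * h - s = h * ((x - s) / h + pp%:~R - k%:R)); last first.
  by field; rewrite gt_eqF.
rewrite tpowM// [m%:R - alpha]addrC powRD_gt0//.
move: (grunwald_coef _ _) (tpow _ _) (h `^ _) (h `^ _) => A B C D.
by ring.
Qed.

Lemma tpow_scaled e h u : 0 < h -> tpow e u = h `^ e * tpow e (u / h).
Proof. by move=> h0; rewrite -tpowM// mulrC divfK// gt_eqF. Qed.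

(** Every term is a truncated power of a node minus [s], hence homogeneous in the
    step. *)
Lemma scheme_kernel v h N : {within `[a, b], continuous v} -> 0 < h -> x + h <= b ->
  (x - a) / h + 1 <= N%:R ->
  has_integral a b (fun s => h `^ (r%:R - alpha) * ker sg r ((x - s) / h) * v s)
    (scheme (fun e y => frac_int a b e v y) h N
     - h ^+ 2 * (sg * kappa alpha k2 r.-2 * frac_int a b (r%:R - 2 - alpha) v x)).
Proof.
move=> cv h0 xh xN; have r2 : 2 <= r%:R :> R by rewrite ler_nat; case/andP: r23.
case/andP: axb => ax xb; case/andP: alpha12 => a1 a2.
have e1 : -1 < r%:R - alpha by lra.
have e2 : -1 < r%:R :> R by lra.
have P e y := @has_integral_frac_int R a b ab e v y.
have xmb : x - h <= b by lra.
have S (pp : int) : pp%:~R <= 1 :> R -> has_integral a b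
    (fun s => \sum_(k < N) grunwald_coef alpha k / r`!%:R * (tpow r%:R (x + pp%:~R * h - k%:R * h - s) * v s))
    (\sum_(k < N) grunwald_coef alpha k / r`!%:R * frac_int a b r%:R v (x + pp%:~R * h - k%:R * h)).
  move=> pp1; apply: (@has_integral_sum _ _ _ _
    (fun k s => grunwald_coef alpha k / r`!%:R * (tpow r%:R (x + pp%:~R * h - k%:R * h - s) * v s))
    (fun k => grunwald_coef alpha k / r`!%:R * frac_int a b r%:R v (x + pp%:~R * h - k%:R * h))) => k.
  by apply: has_integralZ; apply: P => //; exact: node_le.
have sgI : has_integral a b (fun s => sg * kappa alpha k2 r.-2 * (tpow (r%:R - 2 - alpha) (x - s) * v s))
    (sg * kappa alpha k2 r.-2 * frac_int a b (r%:R - 2 - alpha) v x).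
  have [z|nz] := eqVneq (sg * kappa alpha k2 r.-2) 0.
    by rewrite z mul0r; apply: has_integral_ext (has_integral0 a b) => s _; rewrite mul0r.
  apply: has_integralZ; apply: P => //; last exact: ltW.
  move: nz sg0; case: (r) r23 => [|[|[|[|//]]]]// _.
    by move=> nz sg2; move: nz; rewrite (sg2 erefl) mul0r eqxx.
  move=> nz _; have : alpha < 2.
    rewrite lt_neqAle a2 andbT; apply: contraNN nz => /eqP ->.
    by rewrite /= subrr !mulr0.
  lra.
have H := has_integralB (has_integralB (has_integralZ (kappa alpha k2 r)
  (has_integralD (has_integralD (has_integralZ cm (P _ _ e1 xmb cv)) (has_integralZ c0 (P _ _ e1 (ltW xb) cv)))
     (has_integralZ cp (P _ _ e1 xh cv))))
  (has_integralZ (h `^ (- alpha)) (has_integralD (has_integralZ dp (S _ p1)) (has_integralZ dq (S _ q1)))))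
  (has_integralZ (h ^+ 2) sgI).
apply: has_integral_ext H => s /andP[as_ sb].
have Sv (pp : int) : pp%:~R <= 1 :> R -> h `^ (- alpha) *
    \sum_(k < N) grunwald_coef alpha k / r`!%:R * (tpow r%:R (x + pp%:~R * h - k%:R * h - s) * v s)
    = h `^ (r%:R - alpha) * spline alpha r ((x - s) / h + pp%:~R) * v s.
  move=> pp1; rewrite -(@spline_scaled r pp h N s)//; last by rewrite (le_trans _ xN)// lerD2l.
  by rewrite -mulrA mulr_suml; congr (_ * _); apply: eq_bigr => k _; rewrite mulrA.
rewrite [h `^ (- alpha) * (_ + _)]mulrDr [h `^ (- alpha) * (dp * _)]mulrCA.
rewrite [h `^ (- alpha) * (dq * _)]mulrCA !Sv//.
rewrite /kernel (tpow_scaled (r%:R - alpha) (x - h - s) h0) (tpow_scaled (r%:R - alpha) (x - s) h0).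
rewrite (tpow_scaled (r%:R - alpha) (x + h - s) h0) (tpow_scaled (r%:R - 2 - alpha) (x - s) h0).
rewrite (_ : (x - h - s) / h = (x - s) / h - 1); last by field; rewrite gt_eqF.
rewrite (_ : (x + h - s) / h = (x - s) / h + 1); last by field; rewrite gt_eqF.
have -> : h `^ (r%:R - alpha) = h ^+ 2 * h `^ (r%:R - 2 - alpha).
  by rewrite -powR_mulrn ?ltW// -powRD_gt0//; congr (_ `^ _); ring.
move: (spline _ _ _) (spline _ _ _) (tpow _ _) (tpow _ _) (tpow _ _) (tpow _ _) => A B C D E F.
by ring.
Qed.

(** The integral of a truncated power is one of the next degree: the zeroth moment
    of the kernel is the kernel of index [r + 1]. *)
Lemma scheme_moment h N : 0 < h -> (x - a) / h + 1 <= N%:R ->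
  scheme (fun e y => tpow (e + 1) (y - a) / (e + 1)) h N
  - h ^+ 2 * (sg * kappa alpha k2 r.-1 * tpow (r%:R - 1 - alpha) (x - a))
  = h `^ (r.+1%:R - alpha) * ker sg r.+1 ((x - a) / h).
Proof.
move=> h0 xN; have r2 : 2 <= r%:R :> R by rewrite ler_nat; case/andP: r23.
case/andP: axb => ax xb; case/andP: alpha12 => a1 a2.
have e1 : r%:R - alpha + 1 != 0 by rewrite gt_eqF//; lra.
have K : kappa alpha k2 r = (r.+1%:R - alpha) * kappa alpha k2 r.+1.
  by apply: kappaS => //; case/andP: r23.
have S (pp : int) : pp%:~R <= 1 :> R -> h `^ (- alpha) *
    (\sum_(k < N) grunwald_coef alpha k / r`!%:R *
       (tpow (r%:R + 1) (x + pp%:~R * h - k%:R * h - a) / (r%:R + 1))) =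
    h `^ (r.+1%:R - alpha) * spline alpha r.+1 ((x - a) / h + pp%:~R).
  move=> pp1; rewrite -(@spline_scaled r.+1 pp h N a)//; last by rewrite (le_trans _ xN)// lerD2l.
  congr (_ * _); apply: eq_bigr => k _; rewrite -natr1 factS natrM -natr1.
  have f0 : r`!%:R != 0 :> R by rewrite pnatr_eq0 -lt0n fact_gt0.
  move: (grunwald_coef _ _) (tpow _ _) => A B; field.
  by rewrite f0/= gt_eqF//; lra.
rewrite /scheme [h `^ (- alpha) * (_ + _)]mulrDr [h `^ (- alpha) * (dp * _)]mulrCA.
rewrite [h `^ (- alpha) * (dq * _)]mulrCA !S//.
rewrite /kernel (_ : r%:R - alpha + 1 = r.+1%:R - alpha); last by rewrite -natr1; ring.
rewrite (tpow_scaled (r.+1%:R - alpha) (x - h - a) h0) (tpow_scaled (r.+1%:R - alpha) (x - a) h0).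
rewrite (tpow_scaled (r.+1%:R - alpha) (x + h - a) h0) (tpow_scaled (r%:R - 1 - alpha) (x - a) h0).
rewrite (_ : (x - h - a) / h = (x - a) / h - 1); last by field; rewrite gt_eqF.
rewrite (_ : (x + h - a) / h = (x - a) / h + 1); last by field; rewrite gt_eqF.
have -> : r.+1%:R - 2 - alpha = r%:R - 1 - alpha by rewrite -natr1; ring.
have -> : h `^ (r.+1%:R - alpha) = h ^+ 2 * h `^ (r%:R - 1 - alpha).
  by rewrite -powR_mulrn ?ltW// -powRD_gt0// -natr1; congr (_ `^ _); ring.
have e1' : r.+1%:R - alpha != 0 by rewrite -natr1 gt_eqF//; lra.
rewrite K (_ : r.+1.-2 = r.-1)//; move: (kappa alpha k2 r.+1) (kappa alpha k2 r.-1) => k3 k4.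
move: (spline _ _ _) (spline _ _ _) (tpow _ _) (tpow _ _) (tpow _ _) (tpow _ _) => A B C D E F.
move: (h `^ _) => H; move: e1'; move: (r.+1%:R - alpha) => w w0.
by field.
Qed.

Lemma lipschitz_at v l : {within `[a, b], continuous v} -> hasD a b v x l ->
  exists2 L : R, 0 <= L & forall s, a <= s <= b -> `|v s - v x| <= L * `|x - s|.
Proof.
move=> cv Hv; have [d [M [d0 M0 HM]]] := hasD_lipschitz Hv.
have [B B0 HB] := continuous_itv_bounded ab cv.
have BB : 0 <= 2 * B / d by rewrite divr_ge0 ?mulr_ge0// ltW.
exists (M + 2 * B / d) => [|s sab]; first by rewrite addr_ge0.
have xab : a <= x <= b by case/andP: axb => *; rewrite !ltW.
rewrite mulrDl; have [sd|sd] := ltP `|s - x| d.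
  rewrite (le_trans (HM s sab sd))// (distrC s) lerDl mulr_ge0//.
rewrite distrC in sd.
have h1 : 2 * B <= 2 * B / d * `|x - s|.
  by rewrite mulrAC ler_pdivlMr// ler_wpM2l// mulr_ge0.
have h2 : 0 <= M * `|x - s| by rewrite mulr_ge0.
have := ler_normB (v s) (v x); have := HB s sab; have := HB x xab; lra.
Qed.

Hypothesis c_sum : cm + c0 + cp = 1.
Hypothesis d_sum : dp + dq = 1.
Hypothesis first_order : cp - cm = dp * (p%:~R - alpha / 2) + dq * (q%:~R - alpha / 2).
Hypothesis k2_2 : alpha = 2 -> k2 = 1.
Hypothesis decay : exists2 M : R, 0 <= M & exists2 T : R, 1 <= T &
  forall t, T <= t -> `|ker sg r t| <= M * t `^ (- alpha).
Hypothesis moment_decay : exists2 M : R, 0 <= M & exists2 T : R, 1 <= T &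
  forall t, T <= t -> `|ker sg r.+1 t| <= M * t `^ (1 - alpha).

(** With [t = (x - s) / h] the integrand is at most [L h |t|] times the kernel, and
    [kernel_moment_bound] is integrated term by term: the bump has width [2 T h],
    and the tail [t ^ (1 - alpha)] scales as [h ^ (alpha - 1)]. *)
Lemma scheme_first_moment v L : {within `[a, b], continuous v} -> 0 <= L ->
  (forall s, a <= s <= b -> `|v s| <= L * `|x - s|) ->
  exists K : R, \forall h \near (0 : R)^'+, forall N, (x - a) / h + 1 <= N%:R ->
    `|scheme (fun e y => frac_int a b e v y) h N
     - h ^+ 2 * (sg * kappa alpha k2 r.-2 * frac_int a b (r%:R - 2 - alpha) v x)| <= K * h ^+ r.
Proof.
move=> cv L0 HL; case/andP: axb => ax xb; case/andP: alpha12 => a1 a2.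
have [A [M [T [A0 M0 T1 M2 HK]]]] := kernel_moment_bound alpha12 c_sum d_sum first_order
  p1 q1 r23 sg0 k2_2 decay.
have T0 : 0 < T by lra.
pose J := M * (tpow (1 - alpha + 1) (x - a) / (1 - alpha + 1)).
exists (L * (A * (2 * T)) + L * J); near=> h => N xN.
have h0 : 0 < h by near: h; exact: nbhs_right_gt.
have h1 : h <= 1 by near: h; apply: nbhs_right_le.
have xhb : h <= b - x by near: h; apply: nbhs_right_le; rewrite subr_gt0.
have xTb : h <= (b - x) / T by near: h; apply: nbhs_right_le; rewrite divr_gt0// subr_gt0.
have xTa : h <= (x - a) / T by near: h; apply: nbhs_right_le; rewrite divr_gt0// subr_gt0.
rewrite ler_pdivlMr// in xTb; rewrite ler_pdivlMr// in xTa.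
have xh : x + h <= b by lra.
have H := scheme_kernel cv h0 xh xN.
have IJ : has_integral a b (fun s => M * tpow (1 - alpha) (x - s)) J.
  have [al|al] := eqVneq alpha 2.
    rewrite /J (M2 al) mul0r; apply: has_integral_ext (has_integral0 a b) => s _.
    by rewrite mul0r.
  apply: has_integralZ; apply: has_integral_tpow => //; last exact: ltW.
  have : alpha < 2 by rewrite lt_neqAle al.
  lra.
have z1 : -1 < 0 :> R by lra.
have xT1 : x + h * T <= b by lra.
have xT2 : x - h * T <= b by have := mulr_gt0 h0 T0; lra.
have IG := has_integralZ (L * h `^ (r%:R - alpha) * h) (has_integralD
  (has_integralZ A (has_integralB (has_integral_tpow a z1 xT1) (has_integral_tpow a z1 xT2)))
  (has_integralZ (h `^ (alpha - 1)) IJ)).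
apply: le_trans (has_integral_le H IG _) _ => [s /andP[as_ sb]|].
  have sab : a <= s <= b by rewrite as_.
  have nE : `|x - s| = h * `|(x - s) / h|.
    by rewrite normrM normfV (gtr0_norm h0) mulrC divfK// gt_eqF.
  rewrite !normrM (ger0_norm (powR_ge0 _ _)).
  have hp : 0 <= h `^ (r%:R - alpha) by exact: powR_ge0.
  apply: (@le_trans _ _ (h `^ (r%:R - alpha) * `|ker sg r ((x - s) / h)| * (L * (h * `|(x - s) / h|)))).
    by rewrite ler_wpM2l ?mulr_ge0// -nE HL.
  rewrite [leLHS](_ : _ = L * h `^ (r%:R - alpha) * h * (`|(x - s) / h| * `|ker sg r ((x - s) / h)|)); last by ring.
  rewrite ler_wpM2l ?mulr_ge0 ?(ltW h0)//.
  apply: (le_trans (HK _)).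
  rewrite (tpow_scaled 0 (x + h * T - s) h0) (tpow_scaled 0 (x - h * T - s) h0) powRr0 !mul1r.
  rewrite (_ : (x + h * T - s) / h = (x - s) / h + T); last by field; rewrite gt_eqF.
  rewrite (_ : (x - h * T - s) / h = (x - s) / h - T); last by field; rewrite gt_eqF.
  rewrite lerD2l (tpow_scaled (1 - alpha) (x - s) h0) mulrCA [X in _ <= _ * X]mulrA -powRD_gt0//.
  by rewrite (_ : alpha - 1 + (1 - alpha) = 0) ?powRr0 ?mul1r//; ring.
rewrite !add0r !divr1 (tpow_gt0 1); last by have := mulr_gt0 h0 T0; lra.
have -> : tpow 1 (x - h * T - a) = x - h * T - a.
  have [z|z] := leP (x - h * T - a) 0; first by rewrite tpow_le0//; lra.
  by rewrite tpow_gt0// powRr1// ltW.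
rewrite powRr1; last by have := mulr_gt0 h0 T0; lra.
have -> : x + h * T - a - (x - h * T - a) = h * (2 * T) by ring.
have E1 : h `^ (r%:R - alpha) * h = h ^+ r * h `^ (1 - alpha).
  rewrite -[X in _ * X](powRr1 (ltW h0)) -powRD_gt0// -powR_mulrn ?(ltW h0)// -powRD_gt0//.
  by congr (_ `^ _); ring.
have J0 : 0 <= J by case: IJ => _ <-; apply: Rintegral_ge0 => s _; rewrite mulr_ge0// tpow_ge0.
have hr : 0 <= h ^+ r by rewrite exprn_ge0// ltW.
rewrite -(mulrA L) E1 [leRHS]mulrDl mulrDr lerD//.
  rewrite [leLHS](_ : _ = L * (A * (2 * T)) * h ^+ r * (h `^ (1 - alpha) * h)); last by ring.
  rewrite ler_piMr//.
    by rewrite !mulr_ge0// ltW.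
  rewrite -[X in _ * X](powRr1 (ltW h0)) -powRD_gt0//.
  have e0 : 0 <= 1 - alpha + 1 by lra.
  by have := ge0_ler_powR e0 (ltW h0 : h \in Num.nneg) (ler01 : 1 \in Num.nneg) h1; rewrite powR1.
rewrite [leLHS](_ : _ = L * J * h ^+ r * (h `^ (1 - alpha) * h `^ (alpha - 1))); last by ring.
by rewrite -powRD_gt0// (_ : 1 - alpha + (alpha - 1) = 0) ?powRr0 ?mulr1//; ring.
Unshelve. all: by end_near. Qed.

Lemma scheme_zeroth_moment : exists K : R, \forall h \near (0 : R)^'+, forall N, (x - a) / h + 1 <= N%:R ->
    `|scheme (fun e y => tpow (e + 1) (y - a) / (e + 1)) h N
     - h ^+ 2 * (sg * kappa alpha k2 r.-1 * tpow (r%:R - 1 - alpha) (x - a))| <= K * h ^+ r.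
Proof.
case/andP: axb => ax xb; have [M M0 [T T1 HT]] := moment_decay.
have xa : 0 < x - a by rewrite subr_gt0.
have T0 : 0 < T by lra.
exists (M * (x - a) `^ (1 - alpha)); near=> h => N xN.
have h0 : 0 < h by near: h; exact: nbhs_right_gt.
have xTa : h <= (x - a) / T by near: h; apply: nbhs_right_le; rewrite divr_gt0.
rewrite ler_pdivlMr// in xTa.
rewrite scheme_moment// normrM (ger0_norm (powR_ge0 _ _)).
have hp : 0 <= h `^ (r.+1%:R - alpha) by exact: powR_ge0.
apply: (le_trans (ler_wpM2l hp (HT _ _))); first by rewrite ler_pdivlMr// mulrC.
rewrite powRM ?(ltW xa) ?invr_ge0 ?(ltW h0)//.
rewrite -(powR_inv1 (ltW h0)) -powRrM.
rewrite [leLHS](_ : _ = M * (x - a) `^ (1 - alpha) * (h `^ (r.+1%:R - alpha) * h `^ (-1 * (1 - alpha)))); last by ring.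
rewrite -powRD_gt0// -powR_mulrn ?(ltW h0)// (_ : r.+1%:R - alpha + _ = r%:R)//.
by rewrite -natr1; ring.
Unshelve. all: by end_near. Qed.

(** Splitting [v] into its value at [x] and a part of order [|x - s|] separates
    the zeroth moment of the kernel from the first. *)
Lemma scheme_error v l : {within `[a, b], continuous v} -> hasD a b v x l ->
  exists K : R, \forall h \near (0 : R)^'+, forall N, (x - a) / h + 1 <= N%:R ->
    `|scheme (fun e y => frac_int a b e v y) h N
     - h ^+ 2 * (sg * (kappa alpha k2 r.-2 * frac_int a b (r%:R - 2 - alpha) (fun s => v s - v x) x
                       + v x * (kappa alpha k2 r.-1 * tpow (r%:R - 1 - alpha) (x - a))))| <= K * h ^+ r.
Proof.
move=> cv Hv; have [L L0 HL] := lipschitz_at cv Hv.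
have cw : {within `[a, b], continuous (fun s => v s - v x)}.
  by move=> s; apply: cvgB; [exact: cv|exact: cvg_cst].
have [K1 H1] := scheme_first_moment cw L0 HL.
have [K2 H2] := scheme_zeroth_moment.
exists (K1 + `|v x| * K2); near=> h => N xN.
have h0 : 0 < h by near: h; exact: nbhs_right_gt.
have xhb : h <= b - x by near: h; apply: nbhs_right_le; rewrite subr_gt0; case/andP: axb.
have xh : x + h <= b by lra.
rewrite (@scheme_linear _ (fun e y => frac_int a b e (fun s => v s - v x) y)
  (fun e y => tpow (e + 1) (y - a) / (e + 1)) (v x))//; last first.
  move=> e y e1 yb; have e1' : -1 < e by lra.
  by rewrite frac_int_subc// subrK.
have {}B1 : forall N, (x - a) / h + 1 <= N%:R ->
    `|scheme (fun e y => frac_int a b e (fun s => v s - v x) y) h N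
     - h ^+ 2 * (sg * kappa alpha k2 r.-2 * frac_int a b (r%:R - 2 - alpha) (fun s => v s - v x) x)| <= K1 * h ^+ r.
  by near: h.
have {}B2 : forall N, (x - a) / h + 1 <= N%:R ->
    `|scheme (fun e y => tpow (e + 1) (y - a) / (e + 1)) h N
     - h ^+ 2 * (sg * kappa alpha k2 r.-1 * tpow (r%:R - 1 - alpha) (x - a))| <= K2 * h ^+ r.
  by near: h.
have {}B1 := B1 N xN; have {}B2 := ler_wpM2l (normr_ge0 (v x)) (B2 N xN).
rewrite -normrM in B2.
rewrite [leRHS]mulrDl -[X in _ <= _ + X]mulrA; apply: (le_trans _ (lerD B1 B2)); apply: (le_trans _ (ler_normD _ _)).
rewrite le_eqVlt; apply/orP; left; apply/eqP; congr (`|_|).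
move: (scheme _ _ _) (scheme _ _ _) (frac_int _ _ _ _ _) (tpow _ _) => P Q F G.
by ring.
Unshelve. all: by end_near. Qed.

End scheme_error.


(** * Moments of the coefficients *)

Section families.
Context {R : realType}.
Variable beta : R.
Implicit Types (i s m n p q : int).

Lemma compact_node_moments i : compact_node i ->
  (-1 == i)%:R + (0 == i)%:R + (1 == i)%:R = 1 :> R /\ (1 == i)%:R - (-1 == i)%:R = i%:~R :> R.
Proof.
by rewrite /compact_node !inE => /or3P[] /eqP -> /=; rewrite ?intrN; split; ring.
Qed.

(** The two weights interpolate: their first moment depends on the shift [s]
    only, not on the pair of nodes. *)
Lemma lam_coef_moments s m n : m < n -> compact_node (s + m) -> compact_node (s + n) ->
  lam_coef beta s m n (-1) + lam_coef beta s m n 0 + lam_coef beta s m n 1 = 1 /\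
  lam_coef beta s m n 1 - lam_coef beta s m n (-1) = s%:~R + beta + 1.
Proof.
move=> mn /compact_node_moments[m0 m1] /compact_node_moments[n0 n1].
have d0 : (m - n)%:~R != 0 :> R by rewrite intr_eq0 subr_eq0 lt_eqF.
have d1 : (n - m)%:~R != 0 :> R by rewrite intr_eq0 subr_eq0 gt_eqF.
split.
  rewrite /lam_coef [LHS](_ : _ = lam beta m n * 1 + lam beta n m * 1).
    rewrite /lam; move: d0 d1; rewrite !intrD !intrN => d0 d1.
    by field; rewrite d0 d1.
  by rewrite -[X in _ = _ * X + _]m0 -[X in _ = _ + _ * X]n0; ring.
rewrite /lam_coef [LHS](_ : _ = lam beta m n * (s + m)%:~R + lam beta n m * (s + n)%:~R).
  rewrite /lam; move: d0 d1; rewrite !intrD !intrN => d0 d1.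
  by field; rewrite d0 d1.
by rewrite -m1 -n1; ring.
Qed.

Lemma xi_moments p q : p != q -> xi beta p q + xi beta q p = 1 /\
  xi beta p q * (p%:~R - 1 + beta) + xi beta q p * (q%:~R - 1 + beta) = 0.
Proof.
move=> pq; have d0 : (p - q)%:~R != 0 :> R by rewrite intr_eq0 subr_eq0.
have d1 : (q - p)%:~R != 0 :> R by rewrite intr_eq0 subr_eq0 eq_sym.
rewrite /xi; move: d0 d1; rewrite !intrD !intrN => d0 d1.
by split; field; rewrite d0 d1.
Qed.

(** The error estimate sees the three families only through these identities and the
    bounds on the shifts. *)
Lemma quasi_compact_moments p q (c : int -> R) (dp dq : R) : quasi_compact beta p q c dp dq ->
  [/\ c (-1) + c 0 + c 1 = 1, dp + dq = 1,
      c 1 - c (-1) = dp * (p%:~R - (1 - beta)) + dq * (q%:~R - (1 - beta)),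
      p <= 1 & q <= 1].
Proof.
case=> [m n|p' q' m1 n1 m2 n2|].
- move=> mn; have [mn' [cm cn]] : m < n /\ compact_node (-1 + m) /\ compact_node (-1 + n).
    by move: mn; rewrite !inE => /or3P[] /eqP[-> ->].
  have [-> ->] := lam_coef_moments mn' cm cn; split=> //; first by rewrite add0r.
  by rewrite (_ : (-1)%:~R = -1 :> R)// (_ : 1%:~R = 1 :> R)//; ring.
- move=> pq mn1 mn2 cm1 cn1 cm2 cn2.
  have E (s m : int) : s + m - 2 = s - 2 + m by rewrite addrAC.
  rewrite E in cm1; rewrite E in cn1; rewrite E in cm2; rewrite E in cn2.
  have [a1 b1] := lam_coef_moments mn1 cm1 cn1.
  have [a2 b2] := lam_coef_moments mn2 cm2 cn2.
  have [pq' [p1 q1]] : p' != q' /\ p' <= 1 /\ q' <= 1.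
    by move: pq; rewrite !inE => /or3P[] /eqP[-> ->].
  have [x0 x1] := xi_moments pq'; split=> //.
    transitivity (xi beta p' q' * 1 + xi beta q' p' * 1); last by rewrite !mulr1.
    by rewrite -[X in _ = _ * X + _]a1 -[X in _ = _ + _ * X]a2; ring.
  transitivity (xi beta p' q' * ((p' - 2)%:~R + beta + 1) + xi beta q' p' * ((q' - 2)%:~R + beta + 1)).
    by rewrite -b1 -b2; ring.
  by rewrite !intrD !intrN; ring.
- split=> //=; [by field|by rewrite add0r|].
  by rewrite (_ : 1%:~R = 1 :> R)//; field.
Qed.

End families.

(** * The error estimate *)

Section assembly.
Context {R : realType}.

Lemma bigO_at_right (F G : R -> R) (n : nat) (K : R) :
  (\forall h \near (0 : R)^'+, `|F h - G h| <= K * h ^+ n) ->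
  F = G +O_ (0^'+) (fun h : R => h ^+ n).
Proof.
move=> H; apply/eqaddOP; near=> k; near=> h.
have h0 : 0 < h by near: h; exact: nbhs_right_gt.
rewrite /= (ger0_norm (exprn_ge0 n (ltW h0))).
apply: (@le_trans _ _ (K * h ^+ n)); first by near: h.
rewrite ler_wpM2r ?exprn_ge0 ?(ltW h0)//; near: k; apply: nbhs_pinfty_ge; exact: num_real.
Unshelve. all: by end_near. Qed.

Lemma symbol_coef2E (alpha cm cp dp dq : R) (p q : int) :
  cm * a2 alpha (-1) p + (dp - cm) * a2 alpha 0 p + (dq - cp) * a2 alpha 0 q + cp * a2 alpha 1 q
  = symbol_coef2 alpha cm cp dp dq p%:~R q%:~R.
Proof. by rewrite !a2E /symbol_coef2; field. Qed.

Variables (a b : R).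
Hypothesis ab : a < b.
Variables (alpha cm c0 cp dp dq : R) (p q : int) (r : nat) (x sg : R) (f : R -> R).
Hypothesis alpha12 : 1 < alpha <= 2.
Hypothesis axb : a < x < b.
Hypothesis r23 : (2 <= r <= 3)%N.
Hypothesis sg0 : (r == 2)%N -> sg = 0.
Hypothesis p1 : p <= 1.
Hypothesis q1 : q <= 1.
Hypothesis c_sum : cm + c0 + cp = 1.
Hypothesis d_sum : dp + dq = 1.
Hypothesis first_order : cp - cm = dp * (p%:~R - alpha / 2) + dq * (q%:~R - alpha / 2).
Hypothesis Cf : Cn a b r.+1 f.
Hypothesis f0 : forall k : nat, (k <= r)%N -> Dn a b k f a = 0.
Hypothesis df : derivable_ab a b (Dn a b r.+1 f) x.

Local Notation k2 := (rl_const alpha).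
Local Notation ker := (kernel alpha k2 cm c0 cp dp dq p%:~R q%:~R).
Local Notation g := (Dn a b r.+1 f).

Lemma quasi_compact_error :
  (exists2 M : R, 0 <= M & exists2 T : R, 1 <= T &
     forall t, T <= t -> `|ker sg r t| <= M * t `^ (- alpha)) ->
  (exists2 M : R, 0 <= M & exists2 T : R, 1 <= T &
     forall t, T <= t -> `|ker sg r.+1 t| <= M * t `^ (1 - alpha)) ->
  exists K : R, \forall h \near (0 : R)^'+,
    `|cm * RLder a b alpha f (x - h) + c0 * RLder a b alpha f x + cp * RLder a b alpha f (x + h)
      - (dp * grunwald a alpha h p f x + dq * grunwald a alpha h q f x
         + sg * (kappa alpha k2 r.-2 * frac_int a b (r%:R - 2 - alpha) (fun s => g s - g x) x
                 + g x * (kappa alpha k2 r.-1 * tpow (r%:R - 1 - alpha) (x - a))) * h ^+ 2)|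
    <= K * h ^+ r.
Proof.
move=> D1 D2; case/andP: (axb) => ax xb.
have p1R : p%:~R <= 1 :> R by move: p1; rewrite -(ler_int R).
have q1R : q%:~R <= 1 :> R by move: q1; rewrite -(ler_int R).
have k22 : alpha = 2 -> k2 = 1 by rewrite /rl_const => ->; rewrite eqxx.
have [K HK] := scheme_error ab alpha12 axb r23 sg0 p1R q1R c_sum d_sum first_order k22 D1 D2
  (Dn_continuous Cf (leqnn _)) (derivable_hasD df).
have small : \forall h \near (0 : R)^'+, [/\ 0 < h, h <= b - x & h <= x - a].
  near=> h; split; near: h; first exact: nbhs_right_gt.
    by apply: nbhs_right_le; rewrite subr_gt0.
  by apply: nbhs_right_le; rewrite subr_gt0.
exists K; apply: filterS2 small HK => h [h0 xhb xha] HN.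
have t0 : 0 <= (x - a) / h + 1 by rewrite addr_ge0// divr_ge0 ?subr_ge0 ?(ltW ax) ?(ltW h0).
have /andP[_ /ltW xN] := truncn_itv t0.
move: (Num.trunc _).+1 xN => N xN.
have xabm : a <= x - h <= b by apply/andP; split; lra.
have xab : a <= x <= b by rewrite !ltW.
have xabp : a <= x + h <= b by apply/andP; split; lra.
have G (pp : int) : pp%:~R <= 1 :> R -> grunwald a alpha h pp f x = h `^ (- alpha) *
    \sum_(k < N) grunwald_coef alpha k / r`!%:R * frac_int a b r%:R g (x + pp%:~R * h - k%:R * h).
  move=> pp1; apply: (grunwald_frac_int ab) => //.
    by have := @node_le R b x pp h 0 pp1 h0 (_ : x + h <= b); rewrite mul0r subr0; apply; lra.
  by rewrite (le_trans _ xN)// lerD2l.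
have alg (k1 F1 F2 F3 H S1 S2 Y : R) :
  cm * (k1 * F1) + c0 * (k1 * F2) + cp * (k1 * F3)
    - (dp * (H * S1) + dq * (H * S2) + sg * Y * h ^+ 2)
  = k1 * (cm * F1 + c0 * F2 + cp * F3) - H * (dp * S1 + dq * S2) - h ^+ 2 * (sg * Y) by ring.
have {HN} := HN N xN; rewrite /scheme !(RLder_frac_int ab alpha12 Cf f0 r23)// !G//.
move/(le_trans _); apply; rewrite le_eqVlt; apply/orP; left; apply/eqP; congr (`|_|).
exact: alg.
Unshelve. all: by end_near. Qed.

End assembly.


Unset Implicit Arguments.
Set Strict Implicit.
Set Printing Implicit Defensive.

Theorem theorem2 (R : realType) (a b alpha beta : R) (f : R -> R)
    (p q : int) (c : int -> R) (dp dq : R)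
    (hab : a < b) (halpha : 1 < alpha <= 2) (hbeta : beta = 1 - alpha / 2)
    (hqc : quasi_compact beta p q c dp dq) :
  (Cn a b 3 f -> DS_L1 a b 3 f ->
   (forall k : nat, (k <= 3)%N -> Dn a b k f a = 0) ->
   [/\ c (-1) + c 0 + c 1 = 1, dp + dq = 1 &
    forall x : R, a < x < b -> derivable_ab a b (Dn a b 3 f) x ->
      (fun h : R => c (-1) * RLder a b alpha f (x - h)
         + c 0 * RLder a b alpha f x + c 1 * RLder a b alpha f (x + h))
      = (fun h : R => dp * grunwald a alpha h p f x
           + dq * grunwald a alpha h q f x)
        +O_ (0^'+) (fun h : R => h ^+ 2)]) /\
  (Cn a b 4 f -> DS_L1 a b 4 f ->
   (forall k : nat, (k <= 4)%N -> Dn a b k f a = 0) ->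
   let e2 := c (-1) * a2 alpha (-1) p + (dp - c (-1)) * a2 alpha 0 p
             + (dq - c 1) * a2 alpha 0 q + c 1 * a2 alpha 1 q in
   [/\ c (-1) + c 0 + c 1 = 1, dp + dq = 1 &
    forall x : R, a < x < b -> derivable_ab a b (Dn a b 4 f) x ->
      (fun h : R => c (-1) * RLder a b alpha f (x - h)
         + c 0 * RLder a b alpha f x + c 1 * RLder a b alpha f (x + h))
      = (fun h : R => dp * grunwald a alpha h p f x
           + dq * grunwald a alpha h q f x
           + e2 * RLder a b (alpha + 2) f x * h ^+ 2)
        +O_ (0^'+) (fun h : R => h ^+ 3)]).
Proof.
have [c_sum d_sum first_order p1 q1] := quasi_compact_moments hqc.
have {first_order} first_order : c 1 - c (-1) = dp * (p%:~R - alpha / 2) + dq * (q%:~R - alpha / 2).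
  by rewrite first_order hbeta (_ : 1 - (1 - alpha / 2) = alpha / 2)//; ring.
have asym := spline_asymptotics_rl halpha.
have decay := kernel_decay halpha asym c_sum d_sum first_order.
have decay0 := kernel_decay0 halpha asym c_sum d_sum first_order.
split=> [Cf _ f0|Cf _ f0 e2]; split=> // x axb df.
- have D1 := decay0 2%N erefl; have D2 := decay0 3%N erefl.
  rewrite (_ : 2%:R - 2 - alpha = - alpha) in D1; last by ring.
  rewrite (_ : 3%:R - 2 - alpha = 1 - alpha) in D2; last by ring.
  have [K HK] := quasi_compact_error hab halpha axb (isT : (2 <= 2 <= 3)%N) (fun _ => erefl) p1 q1
    c_sum d_sum first_order Cf (fun k hk => f0 k (leqW hk)) df D1 D2.
  by apply: (@bigO_at_right _ _ _ _ K); apply: filterS HK => h; rewrite mul0r mul0r addr0.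
- have D1 := decay 3%N erefl; have D2 := decay 4%N erefl.
  rewrite (_ : 3%:R - 3 - alpha = - alpha) in D1; last by ring.
  rewrite (_ : 4%:R - 3 - alpha = 1 - alpha) in D2; last by ring.
  have sg0 : (3 == 2)%N -> symbol_coef2 alpha (c (-1)) (c 1) dp dq p%:~R q%:~R = 0 by [].
  have [K HK] := quasi_compact_error hab halpha axb (isT : (2 <= 3 <= 3)%N) sg0 p1 q1
    c_sum d_sum first_order Cf (fun k hk => f0 k (leqW hk)) df D1 D2.
  apply: (@bigO_at_right _ _ _ _ K); apply: filterS HK => h.
  have RL4 := RLderD2_frac_int hab halpha Cf (fun k hk => f0 k (leqW hk)) erefl axb.
  rewrite /e2 symbol_coef2E RL4.
  rewrite (_ : 3%:R - 2 - alpha = 1 - alpha); last by ring.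
  rewrite (_ : 3%:R - 1 - alpha = 2 - alpha); last by ring.
  by rewrite (@tpow_gt0 _ _ (x - a)) ?subr_gt0//; case/andP: axb.
Qed.
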